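(* Let $F\in H^{-2}(\Omega)$ be independent of time and let $H=H^1_0(\Omega)$. There exists $\rho_0>0$ such that the ball $B_H(0,\rho_0)$ is absorbing in $H$ for the semigroup $\{S(t)\}_{t\ge0}$, in the sense that for $\rho>0$ there exists $t^\star(\rho)>0$ such that for $t\geq t^\star(\rho)$, $$S(t)B_H(0,\rho)\subset B_H(0,\rho_0).$$
   Context: $\Omega\subset\mathbb{R}^2$ is a bounded domain, and $\nu>0$, $\mu>0$ are constants. $(\cdot,\cdot)$ is the $L^2(\Omega)$ inner product (also the duality pairing), $\|\cdot\|$ the $L^2(\Omega)$ norm. $H=H^1_0(\Omega)$ is normed by $\|\nabla\cdot\|$ and $B_H(0,\rho)$ is the ball of radius $\rho$ centred at $0$ in $H$. Set $a(v,w)=(\Delta v,\Delta w)$, $b_0(v,w)=-\frac12[(v_x,w)-(v,w_x)]$, $b(\psi;v,w)=(\Delta\psi,\,v_yw_x-v_xw_y)$. For $\psi_0\in H^1_0(\Omega)$, $S(t)\psi_0=\psi(t)$, where $\psi$ is the (unique) weak solution of the quasi-geostrophic problem, i.e. $\psi(t)\in H^2_0(\Omega)$ and for almost all $t>0$ $$(\partial_t(\nabla\psi),\nabla\chi)+\nu a(\psi,\chi)+b(\psi;\psi,\chi)+\mu b_0(\psi,\chi)=\mu(F,\chi)\quad\forall\chi\in H^2_0(\Omega),\qquad \psi(0)=\psi_0 .$$ The family $\{S(t)\}_{t\ge0}$ is a semigroup of operators on $H^1_0(\Omega)$. *)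

(* Defs.v *)
From HB Require Import structures.
From mathcomp Require Import all_boot all_order all_algebra.
From mathcomp Require Import all_classical all_reals all_analysis.

Set Implicit Arguments.
Unset Strict Implicit.
Unset Printing Implicit Defensive.

Import Order.TTheory GRing.Theory Num.Theory.
Import numFieldNormedType.Exports.

Local Open Scope classical_set_scope.
Local Open Scope ring_scope.

(* Lebesgue measure on the plane; measurableTypeR R is R itself, with the Borel
   sigma-algebra on which lebesgue_measure is declared. *)
Definition leb2 (R : realType) :
    {measure set (measurableTypeR R * measurableTypeR R) -> \bar R} :=
  (@lebesgue_measure R \x @lebesgue_measure R)%E.
Arguments leb2 R : clear implicits.

Definition bounded_domain (R : realType) (Om : set (R * R)) : Prop :=
  [/\ open Om, connected Om, Om !=set0 & bounded_set Om].

(* Scalar functions on Om are represented by total functions on the plane, of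
   which only the values on Om matter; as usual, two functions that agree
   almost everywhere on Om stand for the same element of a function space. *)

Section FunctionSpaces.
Variables (R : realType) (Om : set (R * R)).
Implicit Types (u v g phi : R * R -> R) (i j k : nat).

(* iterD [:: e1; ...; en] u = D_{e1} ... D_{en} u *)
Definition iterD (s : seq (R * R)) u : R * R -> R :=
  foldr (fun (e : R * R) (f : R * R -> R) => 'D_e f) u s.

Definition smooth u : Prop := forall s (z : R * R), differentiable (iterD s u) z.

(* C_c^oo(Om) *)
Definition test_function : set (R * R -> R) :=
  [set phi | [/\ smooth phi,
                 compact (closure [set z | phi z != 0]) &
                 closure [set z | phi z != 0] `<=` Om]].

(* the classical derivative d^(i+j) u / dx^i dy^j *)
Definition pd i j u : R * R -> R :=
  iterD (nseq i ((1, 0) : R * R) ++ nseq j ((0, 1) : R * R)) u.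

Definition L2 : set (R * R -> R) := [set u | (u \_ Om) \in Lfun (leb2 R) 2%:E].

Definition ip u v : R := (\int[leb2 R]_(z in Om) (u z * v z))%R.

Definition L2norm u : R := Num.sqrt (ip u u).

Definition is_wpd i j u g : Prop :=
  forall phi, test_function phi -> ip u (pd i j phi) = (-1) ^+ (i + j) * ip g phi.

(* The weak derivative, as a chosen representative of the (a.e. unique) square
   integrable weak derivative; it is the junk value 0 if there is none. *)
Definition wpd i j u : R * R -> R :=
  xget (cst 0) [set g | L2 g /\ is_wpd i j u g].

(* The Sobolev space H^k(Om) and its norm *)
Definition Hk k : set (R * R -> R) :=
  [set u | L2 u /\
     forall i j, (i + j <= k)%N -> exists2 g, L2 g & is_wpd i j u g].

Definition Hk_norm k u : R :=
  Num.sqrt (\sum_(i < k.+1) \sum_(j < k.+1 | (i + j <= k)%N)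
              L2norm (wpd i j u) ^+ 2).

(* H^k_0(Om): the closure of C_c^oo(Om) in H^k(Om) *)
Definition Hk0 k : set (R * R -> R) :=
  [set u | Hk k u /\
     exists2 phi : nat -> R * R -> R, (forall n, test_function (phi n)) &
       Hk_norm k (phi n - u) @[n --> \oo] --> (0 : R)].

(* H^{-k}(Om): the bounded linear functionals on H^k_0(Om) *)
Definition Hkdual k : set ((R * R -> R) -> R) :=
  [set F | (forall (c : R) u v, Hk0 k u -> Hk0 k v ->
              F (c \*: u + v) = c * F u + F v) /\
           exists C : R, forall u, Hk0 k u -> `|F u| <= C * Hk_norm k u].

(* (\nabla u, \nabla v), \|\nabla u\| and the Laplacian *)
Definition ip_grad u v : R :=
  ip (wpd 1 0 u) (wpd 1 0 v) + ip (wpd 0 1 u) (wpd 0 1 v).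

Definition grad_norm u : R := Num.sqrt (ip_grad u u).

Definition lap u : R * R -> R := wpd 2 0 u + wpd 0 2 u.

Definition ball_H (rho : R) : set (R * R -> R) :=
  [set u | Hk0 1 u /\ grad_norm u < rho].

Definition form_a v w : R := ip (lap v) (lap w).

Definition form_b0 v w : R :=
  - 2^-1 * (ip (wpd 1 0 v) w - ip v (wpd 1 0 w)).

Definition form_b psi v w : R :=
  ip (lap psi) (wpd 0 1 v * wpd 1 0 w - wpd 1 0 v * wpd 0 1 w).

End FunctionSpaces.

Section WeakSolutions.
Variables (R : realType) (Om : set (R * R)).
Implicit Types (psi : R -> R * R -> R) (G : R -> (R * R -> R) -> R).

(* psi \in C([0, oo); H^1_0(Om)) *)
Definition continuous_H10 psi : Prop :=
  (forall t : R, 0 <= t -> Hk0 Om 1 (psi t)) /\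
  forall t : R, 0 <= t ->
    grad_norm Om (psi s - psi t) @[s --> within `[0, +oo[ (nbhs t)] --> (0 : R).

(* psi \in L^2_loc([0, oo); H^2_0(Om)).  As H^2_0(Om) is a separable Hilbert
   space in which a is an inner product, measurability of psi is measurability
   of all a(psi(t), chi). *)
Definition L2loc_H20 psi : Prop :=
  [/\ {ae @lebesgue_measure R, forall t, 0 < t -> Hk0 Om 2 (psi t)},
      forall chi, Hk0 Om 2 chi ->
        measurable_fun (`[0, +oo[ : set (measurableTypeR R)) (fun t : R => form_a Om (psi t) chi) &
      forall T : R, 0 < T ->
        (@lebesgue_measure R).-integrable `[0, T]
          (fun t => (Hk_norm Om 2 (psi t) ^+ 2)%:E)].

(* G \in L^2_loc([0, oo); H^{-2}(Om)); here m dominates the dual norm of G. *)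
Definition L2loc_Hm2 G : Prop :=
  [/\ {ae @lebesgue_measure R, forall t, 0 < t -> Hkdual Om 2 (G t)},
      forall chi, Hk0 Om 2 chi -> measurable_fun (`[0, +oo[ : set (measurableTypeR R)) (G^~ chi) &
      exists m : R -> R,
        (forall T : R, 0 < T ->
           (@lebesgue_measure R).-integrable `[0, T] (fun t => (m t ^+ 2)%:E)) /\
        {ae @lebesgue_measure R, forall t, 0 < t ->
           forall chi, Hk0 Om 2 chi -> `|G t chi| <= m t * Hk_norm Om 2 chi}].

(* G(t) chi = (\partial_t (\nabla psi), \nabla chi): the functional-valued map
   t |-> (\nabla psi(t), \nabla .) is an indefinite integral of G. *)
Definition is_dt_grad psi G : Prop :=
  L2loc_Hm2 G /\
  forall (s t : R) chi, 0 <= s -> s <= t -> Hk0 Om 2 chi ->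
    ip_grad Om (psi t) chi - ip_grad Om (psi s) chi =
    (\int[@lebesgue_measure R]_(r in `[s, t]) G r chi)%R.

Definition weak_solution (nu mu : R) (F : (R * R -> R) -> R)
    (psi0 : R * R -> R) psi : Prop :=
  [/\ continuous_H10 psi,
      L2loc_H20 psi,
      psi 0 = psi0 %[ae leb2 R in Om] &
      exists2 G, is_dt_grad psi G &
        {ae @lebesgue_measure R, forall t, 0 < t ->
           forall chi, Hk0 Om 2 chi ->
             G t chi + nu * form_a Om (psi t) chi
               + form_b Om (psi t) (psi t) chi
               + mu * form_b0 Om (psi t) chi
             = mu * F chi}].

(* S(t) psi0 = psi(t), where psi is the weak solution starting at psi0 *)
Definition QG_semigroup (nu mu : R) (F : (R * R -> R) -> R)
    (S : R -> (R * R -> R) -> R * R -> R) : Prop :=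
  forall psi0 : R * R -> R, Hk0 Om 1 psi0 -> weak_solution nu mu F psi0 (fun t => S t psi0).

End WeakSolutions.

(* Main.v *)
Require Import Defs.
From HB Require Import structures.
From mathcomp Require Import all_boot all_order all_algebra.
From mathcomp Require Import all_classical all_reals all_analysis.
From mathcomp Require Import measurable_realfun.
From mathcomp Require Import ring lra.

Set Implicit Arguments.
Unset Strict Implicit.
Unset Printing Implicit Defensive.

Import Order.TTheory GRing.Theory Num.Theory.
Import numFieldNormedType.Exports.

Local Open Scope classical_set_scope.
Local Open Scope ring_scope.

(* Put E(t) = |grad psi(t)|^2. Testing the equation with psi(t) itself kills both
   the trilinear form and b_0; with |v|_{H^2} <= C |lap v| on H^2_0 this suggests
   E' <= K - lam E, and then E drops below 2K / lam after a time that depends only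
   on E(0).
   Since d/dt grad psi is only known as a functional G(t), with |G(t)| <= m(t) and
   m square integrable, the energy inequality is derived from backward difference
   quotients. Let Phi' = m^2. Because E(t) - E(s) <= 2 int_s^t G(r) psi(t) dr, the
   quotients of Phi - E at t are bounded below by -|psi(t)|_{H^2}^2, so Fatou's lemma
   applies as soon as the means of G(r) psi(t) over [t - h, t] tend to G(t) psi(t)
   for almost every t. By Lebesgue differentiation this holds for almost every t
   when psi(t) is replaced by any of countably many values psi(q); for fixed t the
   admissible test functions form a closed subspace of H^2_0, which contains psi(t)
   because psi(t) is a weak limit of such values. *)

(** As a function of time, psi is merely continuous into H^1, so E has no derivative to compute.
    Backward quotients fit the algebra: dropping |grad (psi(t) - psi(s))|^2 leaves an upper bound
    for E(t) - E(s) in which the test function is the value at the later time t, the point where the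
    quotient is taken. Adding Phi costs nothing: Phi is an indefinite integral, so the integral of
    m^2 that comes out of Fatou's lemma equals Phi(b) - Phi(a) exactly and cancels. The countable
    family is forced by the null set of Lebesgue differentiation, which depends on the test
    function, while the test function psi(t) moves with t. The H^2 estimate comes from integration
    by parts on test functions and density. With its constant C, lam = nu / C^2: half of the viscous
    term absorbs the forcing by Young's inequality, the other half dominates lam E. Elements of the
    function spaces are total functions determined only up to null sets, and weak derivatives are
    chosen representatives; hence every form is handled as a semi-inner product on a set of
    functions. *)

(** * Semi-inner products: Cauchy-Schwarz and approximation of weak limits *)

Record semi_inner (R : realType) (T : lmodType R) (S : set T) (B : T -> T -> R) : Prop :=
  SemiInner {
    sip_mem0 : S 0;
    sip_lin : forall (c : R) u v, S u -> S v -> S (c *: u + v);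
    sip_sym : forall u v, S u -> S v -> B u v = B v u;
    sip_addl : forall (c : R) u v w, S u -> S v -> S w ->
      B (c *: u + v) w = c * B u w + B v w;
    sip_ge0 : forall u, S u -> 0 <= B u u }.

Section SemiInnerTheory.
Variables (R : realType) (T : lmodType R) (S : set T) (B : T -> T -> R).
Hypothesis sB : semi_inner S B.
Implicit Types (u v w : T) (c : R).

Definition snorm u : R := Num.sqrt (B u u).

Lemma sip_memD u v : S u -> S v -> S (u + v).
Proof. by move=> Su Sv; rewrite -[u]scale1r; exact: (sip_lin sB). Qed.

Lemma sip_memZ c u : S u -> S (c *: u).
Proof. by move=> Su; rewrite -[_ *: _]addr0; apply: (sip_lin sB) => //; exact: (sip_mem0 sB). Qed.

Lemma sip_memB u v : S u -> S v -> S (u - v).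
Proof. by move=> Su Sv; rewrite addrC -scaleN1r; exact: (sip_lin sB). Qed.

Lemma sip0l w : S w -> B 0 w = 0.
Proof.
move=> Sw; have S0 := sip_mem0 sB.
by have := sip_addl sB 1 S0 S0 Sw; rewrite scaler0 addr0 => h; lra.
Qed.

Lemma sipDl u v w : S u -> S v -> S w -> B (u + v) w = B u w + B v w.
Proof. by move=> *; rewrite -{1}[u]scale1r (sip_addl sB)// mul1r. Qed.

Lemma sipZl c u w : S u -> S w -> B (c *: u) w = c * B u w.
Proof.
by move=> Su Sw; rewrite -[c *: u]addr0 (sip_addl sB)//; [rewrite sip0l// addr0|exact: (sip_mem0 sB)].
Qed.

Lemma sipBl u v w : S u -> S v -> S w -> B (u - v) w = B u w - B v w.
Proof.
move=> Su Sv Sw; rewrite [u - v]addrC -scaleN1r (sip_addl sB)//; lra.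
Qed.

Lemma sipDr u v w : S u -> S v -> S w -> B w (u + v) = B w u + B w v.
Proof.
move=> Su Sv Sw; rewrite (sip_sym sB)//; last exact: sip_memD.
by rewrite sipDl// ![B _ w](sip_sym sB).
Qed.

Lemma sipZr c u w : S u -> S w -> B w (c *: u) = c * B w u.
Proof.
by move=> Su Sw; rewrite (sip_sym sB) ?sipZl// 1?(sip_sym sB)//; exact: sip_memZ.
Qed.

Lemma sipBr u v w : S u -> S v -> S w -> B w (u - v) = B w u - B w v.
Proof.
move=> Su Sv Sw; rewrite (sip_sym sB)//; last exact: sip_memB.
by rewrite sipBl// ![B _ w](sip_sym sB).
Qed.

Lemma snorm_ge0 u : 0 <= snorm u. Proof. exact: sqrtr_ge0. Qed.

Lemma sqr_snorm u : S u -> snorm u ^+ 2 = B u u.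
Proof. by move=> Su; rewrite sqr_sqrtr// (sip_ge0 sB). Qed.

Lemma sip_sqrD u v : S u -> S v ->
  B (u + v) (u + v) = B u u + 2 * B u v + B v v.
Proof.
move=> Su Sv; have Suv := sip_memD Su Sv.
rewrite sipDl// !sipDr// (sip_sym sB Sv Su); ring.
Qed.

Lemma sip_sqrB u v : S u -> S v ->
  B (u - v) (u - v) = B u u - 2 * B u v + B v v.
Proof.
move=> Su Sv; have Suv := sip_memB Su Sv.
rewrite sipBl// !sipBr// (sip_sym sB Sv Su); ring.
Qed.

(* Expand B (t u - v) (t u - v) >= 0 at t = (|v| + e) / (|u| + e) and let e tend to 0;
   the shift by e covers the null vectors. *)
Lemma sip_le u v : S u -> S v -> B u v <= snorm u * snorm v.
Proof.
move=> Su Sv.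
have h (t : R) : 0 <= t ^+ 2 * B u u - 2 * t * B u v + B v v.
  have := sip_ge0 sB (sip_memB (sip_memZ t Su) Sv).
  rewrite sip_sqrB//; last exact: sip_memZ.
  rewrite !sipZl//; last exact: sip_memZ.
  rewrite sipZr//; lra.
rewrite -!sqr_snorm// in h.
have nu := snorm_ge0 u; have nv := snorm_ge0 v.
move: (snorm u) (snorm v) nu nv h => a b a0 b0 h.
apply/ler_addgt0Pr => e e0.
pose d := Num.min 1 (e / (a + b + 1)).
have ab : 0 < a + b + 1 by lra.
have d0 : 0 < d by rewrite lt_min ltr01 divr_gt0.
have de : d * (a + b + 1) <= e by rewrite -ler_pdivlMr// ge_min lexx orbT.
have d1 : d <= 1 by rewrite ge_min lexx.
have := h ((b + d) / (a + d)).
set t := _ / _ => ht.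
have ad : 0 < a + d by lra.
have tE : t * (a + d) = b + d by rewrite /t divfK// gt_eqF.
have t0 : 0 < t by rewrite divr_gt0//; lra.
have : 2 * t * B u v <= t * (a + d) * (b + d) * 2.
  have ta : t * a <= b + d by rewrite -tE ler_pM2l//; lra.
  have ta0 : 0 <= t * a by rewrite mulr_ge0// ltW.
  have : (t * a) ^+ 2 <= (b + d) ^+ 2 by rewrite ler_sqr ?nnegrE//; lra.
  rewrite tE exprMn; nra.
move=> hB0; have hB : 2 * B u v <= (a + d) * ((b + d) * 2).
  by rewrite -(ler_pM2l t0); lra.
have dd : d * d <= d by rewrite -[leRHS]mulr1 ler_pM2l.
by lra.
Qed.

Lemma sip_normr_le u v : S u -> S v -> `|B u v| <= snorm u * snorm v.
Proof.
move=> Su Sv; rewrite ler_norml sip_le// andbT.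
have SNu := sip_memZ (-1) Su.
have := sip_le SNu Sv.
by rewrite /snorm !sipZl// sipZr// !mulN1r opprK => ?; rewrite lerNl.
Qed.

Lemma snormZ c u : S u -> snorm (c *: u) = `|c| * snorm u.
Proof.
move=> Su; rewrite /snorm sipZl//; last exact: sip_memZ.
by rewrite sipZr// mulrA -expr2 sqrtrM ?sqr_ge0// sqrtr_sqr.
Qed.

Lemma snormD u v : S u -> S v -> snorm (u + v) <= snorm u + snorm v.
Proof.
move=> Su Sv.
rewrite -ler_sqr ?nnegrE ?addr_ge0 ?snorm_ge0//.
rewrite sqr_snorm; last exact: sip_memD.
rewrite sip_sqrD// sqrrD !sqr_snorm//.
have := sip_le Su Sv; lra.
Qed.

Lemma snormB u v : S u -> S v -> snorm (u - v) <= snorm u + snorm v.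
Proof.
move=> Su Sv; have := snormD Su (sip_memZ (-1) Sv).
by rewrite snormZ// scaleN1r normrN normr1 mul1r.
Qed.

Lemma snormBC u v : S u -> S v -> snorm (u - v) = snorm (v - u).
Proof.
move=> Su Sv; rewrite -[u - v]opprB -[- (v - u)]scaleN1r snormZ ?normrN ?normr1 ?mul1r//.
exact: sip_memB.
Qed.

(* The near-minimizer w of the distance from u to X is nearly orthogonal to X,
   so |u - w|^2, which is the limit of B (u - w) (uk n - w), is small. *)
Lemma weak_limit_approx (X : set T) (u : T) (uk : nat -> T) (C : R) :
  X `<=` S -> X 0 -> (forall c v w, X v -> X w -> X (c *: v + w)) ->
  S u -> (forall n, X (uk n)) -> (forall n, snorm (uk n) <= C) ->
  (forall v, S v -> B (uk n) v @[n --> \oo] --> B u v) ->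
  forall e : R, 0 < e -> exists2 w, X w & snorm (u - w) < e.
Proof.
move=> XS X0 Xlin Su Xuk ukC cvuk e e0.
pose D := [set B (u - w) (u - w) | w in X].
have D0 : D !=set0 by exists (B (u - 0) (u - 0)), 0.
have SB w : X w -> S (u - w) by move=> Xw; apply: sip_memB => //; exact: XS.
have Dlb : lbound D 0 by move=> _ [w Xw <-]; exact/(sip_ge0 sB)/SB.
have hiD : has_inf D by split=> //; exists 0.
suff D_le0 : inf D <= 0.
  have [_ [w Xw <-] hw] := @inf_adherent _ D (e ^+ 2) (exprn_gt0 _ e0) hiD.
  exists w => //; rewrite -ltr_sqr ?nnegrE ?snorm_ge0 ?(ltW e0)//.
  rewrite sqr_snorm; last exact: SB.
  by move: hw D_le0 => /=; lra.
have infle w : X w -> inf D <= B (u - w) (u - w).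
  by move=> Xw; apply: ge_inf; [exists 0|exists w].
(* The competitor [t *: uk n + (1 - t) *: w] lies in [X]. In the expansion of its squared distance
   to [u], the cross term tends to 0 as n grows, by weak convergence, and the last term is bounded
   uniformly in n. *)
have key (t : R) w n : X w -> 0 < t -> t < 1 ->
    inf D <= (1 - t) ^+ 2 * B (u - w) (u - w)
             + 2 * t * (1 - t) * B (u - w) (u - uk n) + t ^+ 2 * (snorm u + C) ^+ 2.
  move=> Xw t0 t1.
  have Xw' : X (t *: uk n + (1 - t) *: w).
    by apply: (Xlin) => //; rewrite -[_ *: w]addr0; exact: (Xlin).
  apply: (le_trans (infle _ Xw')).
  have -> : u - (t *: uk n + (1 - t) *: w) = (1 - t) *: (u - w) + t *: (u - uk n).
    rewrite !scalerBr addrACA -scalerDl subrK scale1r opprD; congr (_ + _).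
    by rewrite addrC.
  have Sw := SB _ Xw; have Sk := SB _ (Xuk n).
  have Sw' := sip_memZ (1 - t) Sw; have Sk' := sip_memZ t Sk.
  rewrite (sip_sqrD Sw' Sk') (sipZl _ Sw Sw') (sipZr _ Sw Sw) (sipZl _ Sw Sk').
  rewrite (sipZr _ Sk Sw) (sipZl _ Sk Sk') (sipZr _ Sk Sk).
  have : B (u - uk n) (u - uk n) <= (snorm u + C) ^+ 2.
    rewrite -sqr_snorm// ler_sqr ?nnegrE ?snorm_ge0//.
      by rewrite (le_trans (snormB _ _))// ?lerD2l//; exact: XS.
    by rewrite addr_ge0 ?snorm_ge0// (le_trans (snorm_ge0 (uk 0%N))).
  nra.
have inf0 : 0 <= inf D by apply: lb_le_inf.
pose K := (snorm u + C) ^+ 2.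
have key2 (t : R) : 0 < t -> t < 1 -> inf D <= (1 - t) ^+ 2 * inf D + t ^+ 2 * K.
  move=> t0 t1; apply/ler_addgt0Pr => d d0.
  have d3 : 0 < d / 3 by rewrite divr_gt0.
  have [_ [w Xw <-] hw] := @inf_adherent _ D _ d3 hiD.
  have cv0 : B (u - w) (uk n) @[n --> \oo] --> B (u - w) u.
    rewrite (sip_sym sB (SB _ Xw) Su).
    have -> : (fun n => B (u - w) (uk n)) = (fun n => B (uk n) (u - w)).
      by apply/funext => n; rewrite (sip_sym sB (SB _ Xw) (XS _ (Xuk n))).
    by apply: cvuk; exact: SB.
  have /cvgrPdist_lt/(_ _ d3)[N _ /(_ N (leqnn N))/= hN] := cv0.
  have := key t w N Xw t0 t1.
  rewrite (sipBr Su (XS _ (Xuk N)) (SB _ Xw)).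
  have := ltW (le_lt_trans (ler_norm _) hN).
  move: hw (infle _ Xw); rewrite -/K.
  move: (B (u - w) (u - w)) (B (u - w) u - B _ (uk N)) => a b b3 a3 Ia.
  have p1 : (1 - t) ^+ 2 * (a - inf D) <= d / 3.
    have t2 : (1 - t) ^+ 2 <= 1 by nra.
    have aI : 0 <= a - inf D by rewrite subr_ge0.
    have aI2 : a - inf D <= d / 3 by rewrite lerBlDl ltW.
    by rewrite -[leRHS]mul1r ler_pM ?sqr_ge0.
  have q1 : 2 * t * (1 - t) * b <= d / 3.
    rewrite (@le_trans _ _ (2 * t * (1 - t) * (d / 3)))//.
      by rewrite ler_wpM2l// mulr_ge0//; lra.
    rewrite -[leRHS]mul1r ler_pM2r//; have := sqr_ge0 (2 * t - 1); nra.
  lra.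
(* Dividing [key2] by t gives (2 - t) inf D <= t K, which forces inf D <= 0 as t tends to 0. *)
suff tK (t : R) : 0 < t -> t < 1 -> inf D <= t * K.
  apply/ler_addgt0Pr => d d0; rewrite add0r.
  have K0 : 0 <= K by exact: sqr_ge0.
  have dK : 0 < d / (K + d + 1) by rewrite divr_gt0//; lra.
  apply: (le_trans (tK (d / (K + d + 1)) dK _)).
    by rewrite ltr_pdivrMr; lra.
  rewrite mulrAC ler_pdivrMr; [nra|lra].
move=> t0 t1; have kt := key2 t t0 t1.
have : (2 - t) * inf D <= t * K by rewrite -(ler_pM2l t0); lra.
have : 0 <= (1 - t) * inf D by rewrite mulr_ge0//; lra.
lra.
Qed.

End SemiInnerTheory.

(** * Measurability and finite measure of bounded open sets of the plane *)

Lemma rat_enclosure (R : realType) (x e : R) : 0 < e -> exists a b : rat,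
  [/\ ratr a < x, x < ratr b, x - e < ratr a & ratr b < x + e].
Proof.
move=> e0; have [|a] := @rat_in_itvoo R (x - e) x; first lra.
rewrite in_itv => /= /andP[a1 a2].
have [|b] := @rat_in_itvoo R x (x + e); first lra.
rewrite in_itv => /= /andP[b1 b2].
by exists a, b.
Qed.

Section PlaneMeasure.
Variable R : realType.
Notation mR := (measurableTypeR R).

(** The plane carries the product sigma-algebra, so openness has to be traded for products of
    intervals: an open set is the countable union of the rational boxes it contains. *)
Lemma open_measurable_plane (U : set (R * R)) :
  open U -> measurable (U : set (mR * mR)).
Proof.
move=> oU.
pose box (q : (rat * rat) * (rat * rat)) : set (mR * mR) :=
  `]ratr q.1.1, ratr q.1.2[ `*` `]ratr q.2.1, ratr q.2.2[.
have -> : U = \bigcup_q (if `[< box q `<=` U >] then box q else set0).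
  apply/seteqP; split=> [z Uz|z [q _]]; last by case: ifPn => // /asboolP; apply.
  have /nbhs_ballP[e /= e0 eU] : nbhs z U by exact: open_nbhs_nbhs.
  have [a [b [a1 b1 a2 b2]]] := rat_enclosure z.1 e0.
  have [c [d [c1 d1 c2 d2]]] := rat_enclosure z.2 e0.
  exists ((a, b), (c, d)) => //; case: ifPn => [_|/asboolPn[]].
    by split; rewrite /= in_itv/= ?a1 ?b1 ?c1 ?d1.
  move=> w [/=]; rewrite !in_itv/= => /andP[w1 w2] /andP[w3 w4].
  by apply: eU; split; rewrite /ball/= ltr_norml; apply/andP; split; lra.
apply: countable_bigcupT_measurable => // q; case: ifPn => // _.
by apply: measurableX; exact: measurable_itv.
Qed.

Lemma continuous_measurable_plane (f : R * R -> R) :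
  continuous f -> measurable_fun setT (f : mR * mR -> R).
Proof.
move=> /continuousP cf.
apply: (measurability _ (RGenOInfty.measurableE R)) => _ [_ [x ->] <-].
rewrite setTI; apply: open_measurable_plane; apply: cf.
by rewrite set_itvE; exact: open_gt.
Qed.

Definition square (L : R) : set (R * R) := `]-L, L[ `*` `]-L, L[.

Lemma bounded_sub_square (A : set (R * R)) : bounded_set A ->
  exists2 L, 0 < L & A `<=` square L.
Proof.
move=> [M [_ AM]]; pose L := `|M| + 2.
have ML : M < `|M| + 1 by rewrite (le_lt_trans (ler_norm M)) ?ltrDl.
exists L => [|z Az]; first by rewrite ltr_wpDl.
have /= := AM _ ML _ Az; rewrite prod_normE ge_max => /andP[z1 z2].
have L1 : `|M| + 1 < L by rewrite ltrD2l ltr1n.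
by split; rewrite /= in_itv/= -ltr_norml; [exact: le_lt_trans z1 L1|exact: le_lt_trans z2 L1].
Qed.

Lemma measurable_square L : measurable (square L : set (mR * mR)).
Proof. by apply: measurableX; exact: measurable_itv. Qed.

Lemma leb2_square L : (leb2 R (square L) < +oo)%E.
Proof.
pose I : set R := `]-L, L[%classic.
have hL : (@lebesgue_measure R I < +oo)%E.
  by rewrite /I lebesgue_measure_itv; case: ifPn => _; rewrite -?EFinB ltry.
rewrite /leb2 /= product_measure1E; [|exact: measurable_itv..].
by apply: lte_mul_pinfty => //; rewrite ge0_fin_numE.
Qed.

Lemma leb2_open_bounded_lty (A : set (R * R)) : open A -> bounded_set A ->
  (leb2 R A < +oo)%E.
Proof.
move=> oA /bounded_sub_square[L _ AL].
apply: le_lt_trans (leb2_square L); apply: le_measure; rewrite ?inE//.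
  exact: open_measurable_plane.
exact: measurable_square.
Qed.

End PlaneMeasure.

(** * The L2 inner product on a measurable set *)

Section L2theory.
Variables (R : realType) (Om : set (R * R)).
Notation mR := (measurableTypeR R).
Hypothesis mOm : measurable (Om : set (mR * mR)).
Implicit Types (u v w : R * R -> R) (c : R).

Lemma restrict_lin c u v : (c *: u + v) \_ Om = c *: (u \_ Om) + v \_ Om.
Proof.
apply/funext => z; rewrite /= !fctE /patch; case: ifPn => // _.
by rewrite scaler0 addr0.
Qed.

Lemma restrict_mul u v : (fun z => u z * v z) \_ Om = u \_ Om \* v \_ Om.
Proof. by apply/funext => z; rewrite /= /patch; case: ifPn => // _; rewrite mulr0. Qed.

Lemma ipE u v : ip Om u v = (\int[leb2 R]_z ((u \_ Om) z * (v \_ Om) z))%R.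
Proof. by rewrite /ip Rintegral_mkcond restrict_mul. Qed.

Lemma L2_0 : L2 Om 0.
Proof.
rewrite /L2/=; have -> : (0 : R * R -> R) \_ Om = 0.
  by apply/funext => z; rewrite /patch; case: ifPn.
have := (Lfun_submod_closed (leb2 R) (_ : (1 <= 2%:E)%E)).1.
by apply; rewrite lee_fin ler1n.
Qed.

Lemma L2_lin c u v : L2 Om u -> L2 Om v -> L2 Om (c *: u + v).
Proof.
rewrite /L2/= restrict_lin => hu hv.
have := (Lfun_submod_closed (leb2 R) (_ : (1 <= 2%:E)%E)).2.
by apply => //; rewrite lee_fin ler1n.
Qed.

Lemma L2_integrable u v : L2 Om u -> L2 Om v ->
  (leb2 R).-integrable setT (EFin \o (fun z => (u \_ Om) z * (v \_ Om) z)).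
Proof. by move=> hu hv; apply/Lfun1_integrable; exact: Lfun2_mul_Lfun1. Qed.

Lemma L2_integrable_mul u v : L2 Om u -> L2 Om v ->
  (leb2 R).-integrable (Om : set (mR * mR)) (EFin \o (fun z => u z * v z)).
Proof.
move=> hu hv; rewrite integrable_mkcond// restrict_EFin restrict_mul.
exact: L2_integrable.
Qed.

Lemma bounded_L2 u (C : R) : (leb2 R Om < +oo)%E ->
  measurable_fun (Om : set (mR * mR)) (u : mR * mR -> R) ->
  (forall z, Om z -> `|u z| <= C) -> L2 Om u.
Proof.
move=> Omoo mu uC; rewrite /L2/= inE.
have mu' : measurable_fun setT (u \_ Om : mR * mR -> R) by apply/(measurable_restrictT _ mOm).
apply/andP; split; rewrite inE//= /finite_norm.
rewrite unlock; apply: poweR_lty.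
have bu : [bounded u z ^+ 2 | z in Om].
  exists (C ^+ 2); split; first exact: num_real.
  move=> M CM z Oz /=; rewrite normrX (le_trans _ (ltW CM))// lerXn2r ?nnegrE ?uC//.
  exact: le_trans (normr_ge0 (u z)) (uC _ Oz).
have /integrableP[_] := measurable_bounded_integrable mOm Omoo (measurable_funX 2 mu) bu.
rewrite integral_mkcond; congr (_ < _)%E; apply: eq_integral => z _ /=.
rewrite /patch; case: ifPn => _ /=; last by rewrite normr0 powR0.
by rewrite normrX powR_mulrn.
Qed.

Lemma ip_semi_inner : semi_inner (L2 Om) (ip Om).
Proof.
split.
- exact: L2_0.
- exact: L2_lin.
- by move=> u v _ _; rewrite /ip; apply: eq_Rintegral => z _; rewrite mulrC.
- move=> c u v w hu hv hw.
  have iu := L2_integrable_mul hu hw; have iv := L2_integrable_mul hv hw.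
  rewrite /ip -RintegralZl// -RintegralD//; last exact: integrableZl iu.
  by apply: eq_Rintegral => z _; rewrite /= mulrDl mulrA.
- by move=> u _; rewrite /ip; apply: Rintegral_ge0 => z _; rewrite -expr2 sqr_ge0.
Qed.

Lemma eq_ip_ae u u' v : L2 Om u -> L2 Om u' -> L2 Om v ->
  u = u' %[ae leb2 R in Om] -> ip Om u v = ip Om u' v.
Proof.
move=> hu hu' hv uu'; rewrite /ip /Rintegral; congr fine.
apply: ae_eq_integral => //.
- by have /integrableP[] := L2_integrable_mul hu hv.
- by have /integrableP[] := L2_integrable_mul hu' hv.
- by apply: (@filterS _ _ (ae_filter_ringOfSetsType (leb2 R)) _ _ _ uu') => z + Oz => /(_ Oz) ->.
Qed.

End L2theory.

(** * Directional derivatives and symmetry of second derivatives *)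

Section Directional.
Variable R : realType.
Implicit Types (f g : R * R -> R) (z w e : R * R).

Lemma derive1_line f z e (t : R) :
  derive1 (fun h : R => f (z + h *: e)) t = 'D_e f (z + t *: e).
Proof.
rewrite /derive1 /derive; set u := (X in lim (X @ _)).
set v := (X in _ = lim (X @ _)); suff -> : u = v by [].
apply/funext => h; rewrite /u /v /=; by congr (_ *: (f _ - _)); rewrite scalerDl addrCA.
Qed.

Lemma derivable_line f z e (t : R) : derivable f (z + t *: e) e ->
  derivable (fun h : R => f (z + h *: e)) t 1.
Proof.
rewrite /derivable; set u := (X in cvg (X @ _)) => cu.
set v := (X in cvg (X @ _)); suff -> : v = u by [].
apply/funext => h; rewrite /u /v /=.
by congr (_ *: (f _ - _)); rewrite [_ *: (1 : R)]mulr1 scalerDl addrCA.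
Qed.

Lemma MVT_line f z e (h : R) : (forall w, derivable f w e) -> 0 < h ->
  exists2 c, 0 < c < h & f (z + h *: e) - f z = h * 'D_e f (z + c *: e).
Proof.
move=> df h0.
have [||c] := @MVT R (fun t : R => f (z + t *: e)) (fun t => 'D_e f (z + t *: e)) 0 h h0.
- move=> x _; split; first exact: derivable_line.
  by rewrite -derive1E derive1_line.
- by apply: derivable_within_continuous => x _; exact: derivable_line.
rewrite in_itv/= => hc; rewrite scale0r addr0 subr0 => ->.
by exists c => //; rewrite mulrC.
Qed.

Lemma derive_translate f w v e : 'D_e (fun z => f (z + v)) w = 'D_e f (w + v).
Proof.
rewrite /derive; set u := (X in lim (X @ _)).
set u' := (X in _ = lim (X @ _)); suff -> : u = u' by [].
by apply/funext => h; rewrite /u /u' /= addrA.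
Qed.

Lemma derivable_translate f w v e :
  derivable f (w + v) e -> derivable (fun z => f (z + v)) w e.
Proof.
rewrite /derivable; set u := (X in cvg (X @ _)) => cu.
set u' := (X in cvg (X @ _)); suff -> : u' = u by [].
by apply/funext => h; rewrite /u /u' /= addrA.
Qed.

(** The mean value theorem is applied twice: along [a] to the increment w |-> f(w + h b) - f(w),
    then along [b] to the derivative of f along [a]. *)
Lemma second_difference f z a b (h : R) : (forall w, derivable f w a) ->
  (forall w, derivable ('D_a f) w b) -> 0 < h ->
  exists c d : R, [/\ 0 < c < h, 0 < d < h &
    (f (z + h *: a + h *: b) - f (z + h *: a)) - (f (z + h *: b) - f z) =
    h * (h * 'D_b ('D_a f) (z + c *: a + d *: b))].
Proof.
move=> da dba h0.
pose F := (fun w => f (w + h *: b)) - f.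
have FE w : F w = f (w + h *: b) - f w by [].
have dF w : derivable F w a.
  by apply: derivableB => //; exact: derivable_translate.
have [c hc E] := MVT_line z dF h0.
have DF : 'D_a F (z + c *: a) = 'D_a f (z + c *: a + h *: b) - 'D_a f (z + c *: a).
  by rewrite deriveB ?derive_translate//; exact: derivable_translate.
have [d hd Ed] := MVT_line (z + c *: a) dba h0.
exists c, d; split; [exact: hc|exact: hd|].
by rewrite -Ed -DF -E !FE.
Qed.

Lemma dist_le_split (x y v e : R) :
  `|x - v| < e / 2 -> `|y - v| < e / 2 -> `|x - y| <= e.
Proof.
rewrite !ltr_norml ler_norml => /andP[? ?] /andP[? ?].
by apply/andP; split; lra.
Qed.

(** The second difference is symmetric in [a] and [b], so the two mixed derivatives take a common
    value at two points close to z; continuity at z concludes. *)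
Lemma schwarz f z a b : (forall w, derivable f w a) -> (forall w, derivable f w b) ->
  (forall w, derivable ('D_a f) w b) -> (forall w, derivable ('D_b f) w a) ->
  {for z, continuous ('D_a ('D_b f))} -> {for z, continuous ('D_b ('D_a f))} ->
  'D_a ('D_b f) z = 'D_b ('D_a f) z.
Proof.
move=> da db dba dab cab cba.
apply/eqP; rewrite -subr_eq0 -normr_le0; apply/ler_addgt0Pr => e e0; rewrite add0r.
have e2 : 0 < e / 2 by rewrite divr_gt0.
move/cvgrPdist_lt/(_ _ e2): cab => /nbhs_ballP[r1 /= r10 hab].
move/cvgrPdist_lt/(_ _ e2): cba => /nbhs_ballP[r2 /= r20 hba].
pose r := Num.min r1 r2.
(* With this h every z + c a + d b with 0 < c, d < h stays within distance r of z; the summand 1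
   covers null directions. *)
pose h := r / (`|a| + `|b| + 1).
have r0 : 0 < r by rewrite lt_min r10.
have n0 : 0 < `|a| + `|b| + 1 by have := normr_ge0 a; have := normr_ge0 b; lra.
have h0 : 0 < h by rewrite divr_gt0.
have rr1 : r <= r1 by rewrite ge_min lexx.
have rr2 : r <= r2 by rewrite ge_min lexx orbT.
have ba : `|b| + `|a| + 1 = `|a| + `|b| + 1 by rewrite (addrC `|b|).
have inball x y (c d : R) : `|x| + `|y| + 1 = `|a| + `|b| + 1 -> 0 < c < h -> 0 < d < h ->
    ball z r (z + c *: x + d *: y).
  move=> xy /andP[c0 ch] /andP[d0 dh].
  rewrite -ball_normE /ball_ /= -addrA opprD addrA subrr add0r normrN.
  rewrite (le_lt_trans (ler_normD _ _))// !normrZ !gtr0_norm//.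
  have hE : h * (`|x| + `|y| + 1) = r by rewrite xy divfK ?gt_eqF.
  have := normr_ge0 x; have := normr_ge0 y; nra.
have [c [d [hc hd]]] := second_difference z da dba h0.
have [c' [d' [hc' hd']]] := second_difference z db dab h0.
set w := z + c *: a + d *: b; set w' := z + c' *: b + d' *: a => E' E.
have {E E'} : h * (h * 'D_a ('D_b f) w') = h * (h * 'D_b ('D_a f) w).
  apply: etrans (esym E') (etrans _ E); rewrite (addrAC z).
  by move: (f (z + h *: a + h *: b)) (f (z + h *: a)) (f (z + h *: b)) (f z) => ? ? ? ?; ring.
move=> /(mulfI (lt0r_neq0 h0))/(mulfI (lt0r_neq0 h0)) E.
have Hw : `|'D_b ('D_a f) z - 'D_b ('D_a f) w| < e / 2.
  by apply: hba; exact: (le_ball rr2 (inball _ _ _ _ erefl hc hd)).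
have Hw' : `|'D_a ('D_b f) z - 'D_a ('D_b f) w'| < e / 2.
  by apply: hab; exact: (le_ball rr1 (inball _ _ _ _ ba hc' hd')).
rewrite E in Hw'; exact: dist_le_split Hw' Hw.
Qed.

End Directional.

(** * Derivatives of functions vanishing outside a square integrate to zero *)

Section IntegralDerivative.
Variable R : realType.
Implicit Types (f g : R * R -> R) (z w e : R * R).
Notation mR := (measurableTypeR R).

(** The fundamental theorem on [-L, L]; the vanishing hypothesis includes the two endpoints, so both
    boundary terms are 0. *)
Lemma integral_derive_line f z e (L : R) : 0 < L ->
  (forall w, derivable f w e) -> continuous ('D_e f) ->
  (forall t : R, ~~ (- L < t < L) -> f (z + t *: e) = 0 /\ 'D_e f (z + t *: e) = 0) ->
  (\int[@lebesgue_measure R]_t ('D_e f (z + t *: e))%:E)%E = 0%E.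
Proof.
move=> L0 df cDf f0.
pose g (t : R) := f (z + t *: e); pose g' (t : R) := 'D_e f (z + t *: e).
have dg t : derivable g t 1 by exact: derivable_line.
have cg : continuous g.
  by move=> t; exact/differentiable_continuous/derivable1_diffP.
have cg' : continuous g'.
  move=> t; apply: (@continuous_comp _ _ _ (fun t : R => z + t *: e) ('D_e f)); last exact: cDf.
  by apply: cvgD; [exact: cvg_cst|apply: cvgZl; exact: cvg_id].
have -> : (fun t => ('D_e f (z + t *: e))%:E) = (fun t => (g' t)%:E) \_ `[-L, L].
  apply/funext => t; rewrite /patch; case: ifPn => //; rewrite notin_setE/= in_itv/= => Lt.
  rewrite (f0 t _).2//; apply/negP => /andP[t1 t2]; apply: Lt.
  by rewrite (ltW t1) (ltW t2).
rewrite -integral_mkcond (@continuous_FTC2 _ _ g).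
- rewrite /g (f0 L _).1 ?(f0 (- L) _).1 ?subee// ?ltxx ?andbF//.
- by lra.
- exact: continuous_subspaceT.
- split => [t _||]; first exact: dg.
  + by apply: cvg_at_right_filter; exact: cg.
  + by apply: cvg_at_left_filter; exact: cg.
- by move=> t _; rewrite derive1_line.
Qed.

Lemma continuous_bounded_square g (L : R) : continuous g ->
  exists2 C, 0 < C & forall z, square L z -> `|g z| <= C.
Proof.
move=> cg.
have cK : compact (`[-L, L] `*` `[-L, L] : set (R * R)).
  by apply: compact_setX; exact: segment_compact.
have /compact_bounded[M [_ hM]] : compact (g @` (`[-L, L] `*` `[-L, L])).
  by apply: continuous_compact => //; exact: continuous_subspaceT.
exists (`|M| + 1); first by rewrite ltr_wpDl.
move=> z [/=]; rewrite !in_itv/= => /andP[z1 z2] /andP[z3 z4].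
apply: hM; first by rewrite (le_lt_trans (ler_norm M)) ?ltrDl.
by exists z => //; split; rewrite /= in_itv/= !ltW.
Qed.

Lemma integrable_square g (L : R) : continuous g -> (forall z, ~ square L z -> g z = 0) ->
  (leb2 R).-integrable setT (EFin \o (g : mR * mR -> R)).
Proof.
move=> cg g0; have mS := @measurable_square R L.
have -> : EFin \o g = (EFin \o g) \_ (square L).
  by apply/funext => z; rewrite /patch; case: ifPn => //; rewrite notin_setE => /g0 /= ->.
apply/(integrable_mkcond _ mS); apply: measurable_bounded_integrable => //.
- exact: leb2_square.
- by apply: measurable_funS (continuous_measurable_plane cg).
- have [C _ hC] := continuous_bounded_square L cg.
  exists C; split; first exact: num_real.
  by move=> M CM z /hC /le_trans; apply; exact: ltW.
Qed.

(** By Fubini with x as the inner variable, every inner integral is taken along a horizontal line,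
    where it is 0. *)
Lemma Rintegral_derive_x f (L : R) : 0 < L ->
  (forall w, derivable f w (1, 0)) -> continuous ('D_(1, 0) f) ->
  (forall z, ~ square L z -> f z = 0 /\ 'D_(1, 0) f z = 0) ->
  (\int[leb2 R]_z ('D_(1, 0) f z))%R = 0.
Proof.
move=> L0 df cDf f0.
have iD : (leb2 R).-integrable setT (EFin \o ('D_(1, 0) f : mR * mR -> R)).
  by apply: (integrable_square (L := L)) => // z /f0[].
rewrite /Rintegral -(integral21_prod_meas1 iD).
rewrite (_ : (fun y => _) = cst 0%E) ?integral0//; apply/funext => y /=.
rewrite -[RHS](@integral_derive_line f (0, y) (1, 0) L L0 df cDf).
  have lx (x : R) : ((0, y) + x *: (1, 0) : R * R) = (x, y).
    by congr pair; rewrite /= ?add0r ?[_ *: (1 : R)]mulr1 ?scaler0 ?addr0.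
  by congr (integral _ _ _); apply/funext => x; rewrite lx.
move=> t Lt; apply: f0 => -[/=]; rewrite in_itv/= add0r [_ *: (1 : R)]mulr1.
by rewrite (negbTE Lt).
Qed.

Lemma Rintegral_derive_y f (L : R) : 0 < L ->
  (forall w, derivable f w (0, 1)) -> continuous ('D_(0, 1) f) ->
  (forall z, ~ square L z -> f z = 0 /\ 'D_(0, 1) f z = 0) ->
  (\int[leb2 R]_z ('D_(0, 1) f z))%R = 0.
Proof.
move=> L0 df cDf f0.
have iD : (leb2 R).-integrable setT (EFin \o ('D_(0, 1) f : mR * mR -> R)).
  by apply: (integrable_square (L := L)) => // z /f0[].
rewrite /Rintegral -(integral12_prod_meas1 iD).
rewrite (_ : (fun y => _) = cst 0%E) ?integral0//; apply/funext => x /=.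
rewrite -[RHS](@integral_derive_line f (x, 0) (0, 1) L L0 df cDf).
  have ly (y : R) : ((x, 0) + y *: (0, 1) : R * R) = (x, y).
    by congr pair; rewrite /= ?add0r ?[_ *: (1 : R)]mulr1 ?scaler0 ?addr0.
  by congr (integral _ _ _); apply/funext => y; rewrite ly.
move=> t Lt; apply: f0 => -[_ /=]; rewrite in_itv/= add0r [_ *: (1 : R)]mulr1.
by rewrite (negbTE Lt).
Qed.

End IntegralDerivative.

Opaque derive.

(** * Smooth functions and their iterated derivatives *)

Section Smooth.
Variable R : realType.
Implicit Types (u v : R * R -> R) (z w e a b : R * R) (s : seq (R * R)).

Lemma smooth_derivable u z e : smooth u -> derivable u z e.
Proof. by move=> su; apply: diff_derivable; exact: (su [::]). Qed.

Arguments smooth_derivable {u} z e _.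

Lemma smooth_continuous u : smooth u -> continuous u.
Proof. by move=> su z; apply: differentiable_continuous; exact: (su [::]). Qed.

Lemma iterD_cons e s u : Defs.iterD (e :: s) u = 'D_e (Defs.iterD s u).
Proof. by []. Qed.

Lemma iterD_cat s1 s2 u : Defs.iterD (s1 ++ s2) u = Defs.iterD s1 (Defs.iterD s2 u).
Proof. by rewrite /Defs.iterD foldr_cat. Qed.

Lemma smooth_iterD s u : smooth u -> smooth (Defs.iterD s u).
Proof. by move=> su s' z; rewrite -iterD_cat; exact: su. Qed.

Lemma smoothD u e : smooth u -> smooth ('D_e u).
Proof. exact: (@smooth_iterD [:: e]). Qed.

Lemma derive_lin (c : R) u v e : smooth u -> smooth v ->
  'D_e (c *: u + v) = c *: 'D_e u + 'D_e v.
Proof.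
move=> su sv; apply/funext => z.
have du := smooth_derivable z e su; have dv := smooth_derivable z e sv.
have dcu : derivable (c *: u) z e by exact: derivableZ.
rewrite (deriveD dcu dv).
by congr (_ + _); exact: deriveZ.
Qed.

Lemma iterD_lin s (c : R) u v : smooth u -> smooth v ->
  Defs.iterD s (c *: u + v) = c *: Defs.iterD s u + Defs.iterD s v.
Proof.
move=> su sv; elim: s => [|e s IH]; first by [].
by rewrite !iterD_cons IH; apply: derive_lin; exact: smooth_iterD.
Qed.

Lemma smooth_lin (c : R) u v : smooth u -> smooth v -> smooth (c *: u + v).
Proof.
move=> su sv s z; rewrite (iterD_lin _ _ su sv).
by apply: differentiableD; [apply: differentiableZ; exact: su|exact: sv].
Qed.

Lemma smooth_swap u a b : smooth u -> 'D_a ('D_b u) = 'D_b ('D_a u).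
Proof.
move=> su; apply/funext => z; apply: schwarz.
- by move=> w; exact: smooth_derivable.
- by move=> w; exact: smooth_derivable.
- by move=> w; apply: smooth_derivable; exact: smoothD.
- by move=> w; apply: smooth_derivable; exact: smoothD.
- by apply: smooth_continuous; do 2 apply: smoothD.
- by apply: smooth_continuous; do 2 apply: smoothD.
Qed.

Lemma iterD_nseq_swap i a b u : smooth u ->
  Defs.iterD (nseq i a) ('D_b u) = 'D_b (Defs.iterD (nseq i a) u).
Proof.
move=> su; elim: i => [|i IH]; first by [].
by rewrite !iterD_cons IH; apply: smooth_swap; exact: smooth_iterD.
Qed.

(** Repeated integration by parts transfers a list of derivatives in reverse order; this restores
    the order used in [pd]. *)
Lemma pd_swap i j u : smooth u ->
  pd i j u = Defs.iterD (nseq j ((0, 1) : R * R) ++ nseq i ((1, 0) : R * R)) u.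
Proof.
rewrite /pd => su; elim: j => [|j IH]; first by rewrite cats0.
rewrite cat_cons iterD_cons -IH !iterD_cat iterD_cons.
by apply: iterD_nseq_swap; exact: smooth_iterD.
Qed.

Lemma pd10E u : pd 1 0 u = 'D_(1, 0) u. Proof. by []. Qed.

Lemma pd20E u : pd 2 0 u = 'D_(1, 0) (pd 1 0 u). Proof. by []. Qed.

Lemma pd11E u : pd 1 1 u = 'D_(1, 0) (pd 0 1 u). Proof. by []. Qed.

End Smooth.

(** * Test functions and integration by parts *)

Section TestFunctions.
Variables (R : realType) (Om : set (R * R)).
Implicit Types (u v phi eta : R * R -> R) (z w e a b : R * R) (s : seq (R * R)).
Notation mR := (measurableTypeR R).

Lemma derive_near0 u z e : (\forall w \near z, u w = 0) -> 'D_e u z = 0.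
Proof.
by move=> u0; rewrite (@near_eq_derive _ _ _ u (cst 0) z e)// derive_cst.
Qed.

Lemma support_near0 u z : ~ closure [set w | u w != 0] z -> \forall w \near z, u w = 0.
Proof.
move=> cz; have : nbhs z (~` closure [set w | u w != 0]).
  by apply: open_nbhs_nbhs; split => //; apply: closed_openC; exact: closed_closure.
by apply: filterS => w cw; apply/eqP/negPn/negP => uw; apply: cw; exact: subset_closure.
Qed.

Lemma support_derive u e :
  closure [set w | 'D_e u w != 0] `<=` closure [set w | u w != 0].
Proof.
rewrite [X in _ `<=` X](closure_id _).1; last exact: closed_closure.
apply: closureS.
move=> z /= Dz; apply: contrapT => cz; move/eqP: Dz; apply.
exact/derive_near0/support_near0.
Qed.

Lemma test_smooth phi : test_function Om phi -> smooth phi. Proof. by case. Qed.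

Lemma test_derive phi e : test_function Om phi -> test_function Om ('D_e phi).
Proof.
move=> [sp cp pO]; split; first exact: smoothD.
- by apply: subclosed_compact cp (@support_derive _ _); exact: closed_closure.
- exact: subset_trans (@support_derive _ _) pO.
Qed.

Lemma test_iterD s phi : test_function Om phi -> test_function Om (Defs.iterD s phi).
Proof. by move=> tp; elim: s => [|e s IH]; [|exact: test_derive]. Qed.

Lemma test_pd i j phi : test_function Om phi -> test_function Om (pd i j phi).
Proof. exact: test_iterD. Qed.

Lemma test_lin (c : R) phi eta : test_function Om phi -> test_function Om eta ->
  test_function Om (c *: phi + eta).
Proof.
move=> [sp cp pO] [se ce eO].
have sub : closure [set w | (c *: phi + eta) w != 0] `<=`
    closure [set w | phi w != 0] `|` closure [set w | eta w != 0].
  rewrite -closureU; apply: closureS.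
  move=> w /= hw; have [p0|p0] := eqVneq (phi w) 0; last by left.
  right => /=; apply: contra_neq hw => e0.
  by rewrite !fctE p0 e0 scaler0 addr0.
split; first exact: smooth_lin.
- by apply: subclosed_compact (compactU cp ce) sub; exact: closed_closure.
- by move=> w /sub[/pO|/eO].
Qed.

Lemma test_near0 phi z : test_function Om phi -> ~ Om z -> \forall w \near z, phi w = 0.
Proof. by move=> [_ _ pO] Oz; apply: support_near0 => /pO. Qed.

Lemma test_eq0 phi z : test_function Om phi -> ~ Om z -> phi z = 0.
Proof. by move=> tp Oz; exact: nbhs_singleton (test_near0 tp Oz). Qed.

Hypotheses (oOm : open Om) (bOm : bounded_set Om).

Let mOm : measurable (Om : set (mR * mR)). Proof. exact: open_measurable_plane. Qed.

Lemma continuous_L2 u : continuous u -> L2 Om u.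
Proof.
move=> cu; have [L L0 OL] := bounded_sub_square bOm.
have [C _ hC] := continuous_bounded_square L cu.
apply: (bounded_L2 mOm (leb2_open_bounded_lty oOm bOm) (C := C)).
  by apply: measurable_funS (continuous_measurable_plane cu).
by move=> z /OL/hC.
Qed.

Lemma smooth_L2 u : smooth u -> L2 Om u.
Proof. by move=> /smooth_continuous; exact: continuous_L2. Qed.

Lemma test_L2 phi : test_function Om phi -> L2 Om phi.
Proof. by move=> /test_smooth; exact: smooth_L2. Qed.

Lemma Rintegral_test0 u : (forall z, ~ Om z -> u z = 0) ->
  (\int[leb2 R]_(z in Om) u z)%R = (\int[leb2 R]_z u z)%R.
Proof.
move=> u0; rewrite Rintegral_mkcond; congr (Rintegral _ _ _).
by apply/funext => z; rewrite /patch; case: ifPn => //; rewrite notin_setE => /u0 ->.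
Qed.

(** Vanishing in a neighbourhood of each point outside Om makes the derivative vanish there as well,
    so the integral extends to the plane. *)
Lemma Rintegral_derive_test u (e : R * R) : e = (1, 0) \/ e = (0, 1) ->
  (forall w, derivable u w e) -> continuous ('D_e u) ->
  (forall z, ~ Om z -> \forall w \near z, u w = 0) ->
  (\int[leb2 R]_(z in Om) 'D_e u z)%R = 0.
Proof.
move=> he du cDu u0.
rewrite Rintegral_test0; last by move=> z /u0; exact: derive_near0.
have [L L0 OL] := bounded_sub_square bOm.
have u0' z : ~ square L z -> u z = 0 /\ 'D_e u z = 0.
  move=> Lz; have /u0 uz : ~ Om z by move=> /OL.
  by split; [exact: nbhs_singleton uz|exact: derive_near0].
case: he u0' cDu du => -> h1 h2 h3.
- exact: Rintegral_derive_x L0 h3 h2 h1.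
- exact: Rintegral_derive_y L0 h3 h2 h1.
Qed.

Lemma ibp phi eta (e : R * R) : e = (1, 0) \/ e = (0, 1) ->
  test_function Om phi -> test_function Om eta ->
  ip Om ('D_e phi) eta = - ip Om phi ('D_e eta).
Proof.
move=> he tp te.
have sp := test_smooth tp; have se := test_smooth te.
have dp z : derivable phi z e by exact: smooth_derivable.
have de z : derivable eta z e by exact: smooth_derivable.
have DM : 'D_e (phi * eta) = (fun z => phi z * 'D_e eta z + 'D_e phi z * eta z).
  by apply/funext => z; rewrite deriveM//= [eta z *: _]mulrC.
have h : (\int[leb2 R]_(z in Om) 'D_e (phi * eta) z)%R = 0.
  apply: (Rintegral_derive_test he).
  - by move=> w; exact: derivableM.
  - rewrite DM => z; apply: cvgD; apply: cvgM.
    + exact: (smooth_continuous sp).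
    + exact: (smooth_continuous (smoothD e se)).
    + exact: (smooth_continuous (smoothD e sp)).
    + exact: (smooth_continuous se).
  - by move=> z /(test_near0 tp); apply: filterS => w /= pw; rewrite !fctE pw mul0r.
apply/eqP; rewrite -addr_eq0 addrC; apply/eqP; rewrite -[RHS]h DM /ip.
rewrite -RintegralD//.
- by apply: L2_integrable_mul => //; [exact: test_L2|apply: test_L2; exact: test_derive].
- by apply: L2_integrable_mul => //; [apply: test_L2; exact: test_derive|exact: test_L2].
Qed.

End TestFunctions.

(** * Poincare inequality and second derivatives of test functions *)

Section TestEstimates.
Variables (R : realType) (Om : set (R * R)).
Implicit Types (u v phi eta : R * R -> R) (z w e a b : R * R) (s : seq (R * R)).
Notation mR := (measurableTypeR R).
Hypotheses (oOm : open Om) (bOm : bounded_set Om).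

Let mOm : measurable (Om : set (mR * mR)). Proof. exact: open_measurable_plane. Qed.
Let sip := ip_semi_inner mOm.

Lemma cvg_fst_slope z : (fun h : R => h^-1 *: ((@fst R R \o shift z) (h *: ((1, 0) : R * R)) - z.1))
  @ 0^' --> (1 : R).
Proof.
apply: cvg_near_cst; near=> h; have h0 : h != 0 by near: h; exact: nbhs_dnbhs_neq.
rewrite /= addrK [h *: (1 : R)]mulr1; exact: mulVf.
Unshelve. all: by end_near. Qed.

Lemma derivable_fst z : derivable (@fst R R) z (1, 0).
Proof. by apply/cvg_ex; exists 1; exact: cvg_fst_slope. Qed.

Lemma derive_fst z : 'D_(1, 0) (@fst R R) z = 1.
Proof. by apply: cvg_lim => //; exact: cvg_fst_slope. Qed.

Lemma L2norm_fst_mul (L : R) u : Om `<=` square L -> 0 < L -> continuous u ->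
  L2norm Om ((@fst R R) * u) <= L * L2norm Om u.
Proof.
move=> OL L0 cu.
have cf : continuous ((@fst R R) * u).
  by move=> z; apply: cvgM; [exact: cvg_fst|exact: cu].
have hu := continuous_L2 oOm bOm cu; have hf := continuous_L2 oOm bOm cf.
rewrite -[L in leRHS]ger0_norm ?(ltW L0)// -(snormZ sip L hu).
rewrite /L2norm /snorm ler_wsqrtr// /ip.
have hLu : L2 Om (L *: u) by exact: sip_memZ sip _ _ hu.
apply: le_Rintegral => //; [exact: L2_integrable_mul|exact: L2_integrable_mul|].
move=> z /OL[/=]; rewrite in_itv/= => /andP[z1 z2] _.
rewrite !fctE -!expr2 [leRHS]exprMn exprMn ler_wpM2r ?sqr_ge0//.
by move: z1 z2; move: z.1 => x z1 z2; nra.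
Qed.

(** The derivative of x phi^2 in x integrates to 0, so |phi|^2 = - 2 (x phi, phi_x) <= 2 L |phi|
    |phi_x|, since |x| < L on Om; then |phi| is divided out. *)
Lemma poincare_test (L : R) phi : Om `<=` square L -> 0 < L -> test_function Om phi ->
  L2norm Om phi <= 2 * L * L2norm Om ('D_(1, 0) phi).
Proof.
move=> OL L0 tp; have sp := test_smooth tp.
have tD := test_derive (1, 0) tp; have sD := test_smooth tD.
have hp := test_L2 oOm bOm tp; have hD := test_L2 oOm bOm tD.
pose x := @fst R R.
have cx : continuous x by move=> z; exact: cvg_fst.
have cxp : continuous (x * phi).
  by move=> z; apply: cvgM; [exact: cx|exact: smooth_continuous sp z].
have dp z : derivable phi z (1, 0) by exact: smooth_derivable.
have dxp z : derivable (x * phi) z (1, 0) by apply: derivableM; [exact: derivable_fst|].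
have DM : 'D_(1, 0) (x * phi * phi) =
    (fun z => 2 * ((x * phi) z * 'D_(1, 0) phi z) + phi z * phi z).
  apply/funext => z; rewrite (deriveM (dxp z) (dp z)) (deriveM (@derivable_fst z) (dp z)).
  rewrite derive_fst /x /= !fctE; set d := 'D_(1, 0) phi z.
  rewrite /GRing.scale/=; ring.
have hxp := continuous_L2 oOm bOm cxp.
have h : (\int[leb2 R]_(z in Om) 'D_(1, 0) (x * phi * phi) z)%R = 0.
  apply: (Rintegral_derive_test bOm (u := x * phi * phi) (e := (1, 0))).
  - by left.
  - by move=> w; apply: derivableM; [exact: dxp|exact: dp].
  - rewrite DM => z; apply: cvgD; [apply: cvgM; first exact: cvg_cst|]; apply: cvgM.
    + exact: cxp.
    + exact: (smooth_continuous sD).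
    + exact: (smooth_continuous sp).
    + exact: (smooth_continuous sp).
  - by move=> z /(test_near0 tp); apply: filterS => w /= pw; rewrite !fctE pw mulr0.
have i1 := L2_integrable_mul mOm hxp hD; have i2 := L2_integrable_mul mOm hp hp.
have E : 2 * ip Om (x * phi) ('D_(1, 0) phi) + ip Om phi phi = 0.
  rewrite -[RHS]h DM.
  have -> := RintegralD mOm (integrableZl mOm 2 i1) i2.
  by have -> := RintegralZl 2 mOm i1.
have := sip_normr_le sip hxp hD; rewrite ler_norml => /andP[hC _].
have := sqr_snorm sip hp; rewrite -/(L2norm Om phi) => hN.
have := L2norm_fst_mul OL L0 (smooth_continuous sp).
move: hC; rewrite /snorm -/(L2norm Om (x * phi)) -/(L2norm Om ('D_(1, 0) phi)) -/x.
have : snorm (ip Om) phi ^+ 2 = ip Om phi phi by [].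
rewrite /snorm -/(L2norm Om phi).
have : 0 <= L2norm Om phi by exact: sqrtr_ge0.
have : 0 <= L2norm Om ('D_(1, 0) phi) by exact: sqrtr_ge0.
have : 0 <= L2norm Om (x * phi) by exact: sqrtr_ge0.
move: E; move: (L2norm Om phi) (L2norm Om ('D_(1, 0) phi)) (L2norm Om (x * phi)).
move: (ip Om phi phi) (ip Om (x * phi) _) => p q a d c E c0 d0 a0 ap hC hca.
have [->|an0] := eqVneq a 0; first by rewrite mulr_ge0// mulr_ge0// ltW.
have {an0}a1 : 0 < a by rewrite lt_neqAle eq_sym an0.
have : a * a <= a * (2 * L * d).
  have : c * d <= L * a * d by rewrite ler_wpM2r.
  rewrite -expr2 ap; lra.
by rewrite ler_pM2l.
Qed.

Lemma ibp_iter s phi eta : (forall e, e \in s -> e = (1, 0) \/ e = (0, 1)) ->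
  test_function Om phi -> test_function Om eta ->
  ip Om phi (Defs.iterD s eta) = (-1) ^+ size s * ip Om (Defs.iterD (rev s) phi) eta.
Proof.
elim: s phi => [|e s IH] phi hs tp te; first by rewrite expr0 mul1r.
have he := hs e (mem_head _ _).
have tsE := test_iterD s te.
rewrite iterD_cons -[LHS]opprK -(ibp oOm bOm he tp tsE) IH//.
- by rewrite rev_cons -cats1 iterD_cat exprS mulN1r mulNr.
- by move=> e' es; apply: hs; rewrite inE es orbT.
- exact: test_derive.
Qed.

Lemma test_is_wpd i j phi : test_function Om phi -> is_wpd Om i j phi (pd i j phi).
Proof.
move=> tp eta te; rewrite (pd_swap _ _ (test_smooth tp)) /pd ibp_iter//.
  by rewrite rev_cat !rev_nseq size_cat !size_nseq.
by move=> e; rewrite mem_cat !mem_nseq => /orP[] /andP[_ /eqP]; [left|right].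
Qed.

Lemma snorm_ip : snorm (ip Om) = L2norm Om. Proof. by []. Qed.

Opaque ip L2norm.

(** One derivative along [a] goes to the right factor and one along [b] comes back to the left; the
    two signs cancel. For [a] and [b] the coordinate directions, this makes the cross term in |lap
    phi|^2 nonnegative. *)
Lemma ip_second_derivatives phi a b : a = (1, 0) \/ a = (0, 1) -> b = (1, 0) \/ b = (0, 1) ->
  test_function Om phi ->
  ip Om ('D_a ('D_a phi)) ('D_b ('D_b phi)) = ip Om ('D_a ('D_b phi)) ('D_a ('D_b phi)).
Proof.
move=> ha hb tp; have sp := test_smooth tp.
have ta := test_derive a tp; have tb := test_derive b tp.
have E1 := ibp oOm bOm ha ta (test_derive b tb).
have E2 := congr1 (fun f : R * R -> R => - ip Om ('D_a phi) f) (smooth_swap a b (test_smooth tb)).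
have E3 := ibp oOm bOm hb ta (test_derive a tb).
have E4 := congr1 (fun f : R * R -> R => ip Om f ('D_a ('D_b phi))) (smooth_swap b a sp).
exact: etrans E1 (etrans E2 (etrans (esym E3) E4)).
Qed.

Lemma ip_pd_xx_yy phi : test_function Om phi ->
  ip Om (pd 2 0 phi) (pd 0 2 phi) = ip Om (pd 1 1 phi) (pd 1 1 phi).
Proof. exact: ip_second_derivatives (or_introl erefl) (or_intror erefl). Qed.

End TestEstimates.

Transparent derive.

(** * The flat exponential *)

Section FlatExponential.
Variable R : realType.
Implicit Types (x c h : R) (k : nat).

(** The function x^(-k) exp(- c / x), extended by 0 to x <= 0. The power k is there to close the
    family under differentiation: a derivative is a combination of the members k + 1 and k + 2. *)
Definition rho c k x : R := if 0 < x then x^-1 ^+ k * expR (- (c / x)) else 0.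

(** From exp y >= (y / (k + 2))^(k + 2) with y = c / x. A quadratic bound is what makes the
    derivative at 0 exist and vanish. *)
Lemma rho_le c k x : 0 < c -> `|rho c k x| <= (k.+2%:R / c) ^+ k.+2 * x ^+ 2.
Proof.
move=> c0; rewrite /rho; case: ifPn => [x0|_]; last first.
  by rewrite normr0 mulr_ge0 ?sqr_ge0 ?exprn_ge0 ?divr_ge0 ?ler0n ?ltW.
have n0 : 0 < (k.+2%:R : R) by rewrite ltr0n.
have e0 : 0 <= expR (- (c / x)) by exact: expR_ge0.
rewrite ger0_norm; last by rewrite mulr_ge0// exprn_ge0// invr_ge0 ltW.
have h1 : (c / (x * k.+2%:R)) ^+ k.+2 <= expR (c / x).
  have -> : c / x = (c / (x * k.+2%:R)) *+ k.+2.
    by rewrite -mulr_natr; field; rewrite !gt_eqF.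
  rewrite -[X in expR X]mulr_natl expRM_natl lerXn2r ?nnegrE ?expR_ge0//.
    by rewrite divr_ge0 ?mulr_ge0 ?ltW.
  by rewrite (le_trans _ (expR_ge1Dx _))// lerDr.
have cx0 : 0 < c / (x * k.+2%:R) by rewrite divr_gt0// mulr_gt0.
have h2 : expR (- (c / x)) <= (x * k.+2%:R / c) ^+ k.+2.
  rewrite expRN -[leRHS]invrK lef_pV2 ?posrE ?expR_gt0 ?invr_gt0 ?exprn_gt0 ?divr_gt0 ?mulr_gt0//.
  by rewrite -exprVn invf_div.
apply: (le_trans (ler_wpM2l _ h2)); first by rewrite exprn_ge0// invr_ge0 ltW.
rewrite le_eqVlt; apply/orP; left; apply/eqP.
rewrite !exprMn !exprVn -[in x ^+ k.+2]addn2 exprD.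
have xk : x ^+ k != 0 by rewrite expf_neq0 ?gt_eqF.
have ck : c ^+ k.+2 != 0 by rewrite expf_neq0 ?gt_eqF.
by field; rewrite xk ck.
Qed.

Lemma near_is_derive (f g : R -> R) x (d : R) : (\forall y \near x, f y = g y) ->
  is_derive x 1 f d -> is_derive x 1 g d.
Proof.
move=> fg [df fd]; split; first exact: near_eq_derivable fg df.
by rewrite -fd; apply/esym; exact: near_eq_derive.
Qed.

Lemma is_derive_rho_gt0 c k x : 0 < x ->
  is_derive x 1 (rho c k) (- k%:R * rho c k.+1 x + c * rho c k.+2 x).
Proof.
move=> x0; have xn0 : x != 0 by rewrite gt_eqF.
have dV : is_derive x 1 (fun y : R => y^-1) (- x ^- 2 *: (1 : R)).
  exact: (@is_deriveV _ id x 1 1 xn0 (is_derive_id x 1)).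
have dVk := is_deriveX k dV.
have dE := is_derive1_comp (is_derive_expR _) (is_deriveZ (- c) dV).
have := is_deriveM dVk dE.
set f := (X in is_derive _ _ X) => df.
apply: (@near_is_derive f).
  near=> y; have y0 : 0 < y by near: y; exact: lt_nbhsr.
  by rewrite /f /rho y0 /= !fctE /= [- c *: _]mulNr.
apply: is_derive_eq df _.
rewrite /rho x0 /= !fctE /= /GRing.scale /= [- c / x]mulNr.
move: (expR _) => E.
case: k {dVk f} => [|k]; rewrite /= ?expr0 ?exprVn.
  by field.
by rewrite !exprS; field; rewrite xn0 expf_neq0.
Unshelve. all: by end_near. Qed.

Lemma is_derive_rho c k x : 0 < c ->
  is_derive x 1 (rho c k) (- k%:R * rho c k.+1 x + c * rho c k.+2 x).
Proof.
move=> c0; have [x0|x0|x0] := ltgtP x 0; last first.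
- rewrite x0 {2 3}/rho ltxx !mulr0 addr0.
  pose K := (k.+2%:R / c) ^+ k.+2.
  have K0 : 0 <= K by rewrite exprn_ge0// divr_ge0 ?ler0n ?ltW.
  have cv : (fun h : R => h^-1 *: ((rho c k \o shift 0) (h *: (1 : R)) - rho c k 0)) @ 0^' --> (0 : R).
    apply/cvgrPdist_le => e e0; near=> h.
    have h0 : h != 0 by near: h; exact: nbhs_dnbhs_neq.
    rewrite sub0r normrN /= addr0 [h *: (1 : R)]mulr1 {2}/rho ltxx subr0.
    rewrite [_ *: _]/(_ * _) normrM normfV.
    rewrite ler_pdivrMl ?normr_gt0//.
    apply: (le_trans (rho_le k h c0)); rewrite -/K -[h ^+ 2]ger0_norm ?sqr_ge0// normrX.
    rewrite expr2 mulrCA ler_wpM2l//.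
    have : `|h| < e / (K + 1).
      near: h; apply: dnbhs0_lt; rewrite divr_gt0//; lra.
    rewrite ltr_pdivlMr; [have := normr_ge0 h; nra|lra].
  by split; [apply/cvg_ex; exists 0|apply: cvg_lim].
- exact: is_derive_rho_gt0.
- apply: (@near_is_derive (cst 0)).
    near=> y; have y0 : y < 0 by near: y; exact: lt_nbhsl.
    by rewrite /rho ltNge (ltW y0).
  by rewrite /rho ltNge (ltW x0)/= !mulr0 addr0; exact: is_derive_cst.
Unshelve. all: by end_near. Qed.

End FlatExponential.

(** * A class of smooth functions closed under differentiation *)

Section Bumps.
Variable R : realType.
Implicit Types (f g : R * R -> R) (z e : R * R) (c p q r : R) (k : nat).

Definition affine p q r (z : R * R) : R := p * z.1 + q * z.2 + r.

(** Smoothness asks for differentiability of all iterated directional derivatives. It follows for a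
    whole class at once if the class consists of differentiable functions and is stable under every
    ['D_e]; affine arguments contribute only constant factors. *)
Inductive bump_class : (R * R -> R) -> Prop :=
| bump_rho c k p q r : 0 < c -> bump_class (fun z => rho c k (affine p q r z))
| bump_cst (a : R) : bump_class (cst a)
| bump_add f g : bump_class f -> bump_class g -> bump_class (f + g)
| bump_mul f g : bump_class f -> bump_class g -> bump_class (f * g).

Lemma differentiable_affine p q r z : differentiable (affine p q r) z.
Proof.
have d1 : differentiable (@fst R R) z by apply: linear_differentiable => w; exact: cvg_fst.
have d2 : differentiable (@snd R R) z by apply: linear_differentiable => w; exact: cvg_snd.
have := differentiableD (differentiableD (differentiableZ p d1) (differentiableZ q d2)) (differentiable_cst r z).
exact.
Qed.

Lemma derive_affine p q r z e : 'D_e (affine p q r) z = p * e.1 + q * e.2.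
Proof.
apply: cvg_lim => //; apply: cvg_near_cst; near=> h.
have h0 : h != 0 by near: h; exact: nbhs_dnbhs_neq.
rewrite /affine /= /GRing.scale /=.
by field.
Unshelve. all: by end_near. Qed.

Lemma is_derive_rho_affine c k p q r z e : 0 < c ->
  differentiable (fun z => rho c k (affine p q r z)) z /\
  'D_e (fun z => rho c k (affine p q r z)) z =
    (p * e.1 + q * e.2) * (- k%:R * rho c k.+1 (affine p q r z) + c * rho c k.+2 (affine p q r z)).
Proof.
move=> c0; have dr := is_derive_rho k (affine p q r z) c0.
have da := differentiable_affine p q r z.
have dr' : differentiable (rho c k) (affine p q r z).
  by apply/derivable1_diffP; case: dr.
have dc := differentiable_comp da dr'; split; first exact: dc.
rewrite deriveE// diff_comp//= -(deriveE e da) derive_affine.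
rewrite (diff1E dr') derive1E; case: dr => _ ->.
by [].
Qed.

Lemma bump_differentiable f : bump_class f -> forall z, differentiable f z.
Proof.
elim=> {f} [c k p q r c0 z|a z|f g _ IHf _ IHg z|f g _ IHf _ IHg z].
- by have [] := is_derive_rho_affine k p q r z 0 c0.
- exact: differentiable_cst.
- by apply: differentiableD.
- by apply: differentiableM.
Qed.

Lemma bump_derive f e : bump_class f -> bump_class ('D_e f).
Proof.
elim=> {f} [c k p q r c0|a|f g bf IHf bg IHg|f g bf IHf bg IHg].
- have -> : 'D_e (fun z => rho c k (affine p q r z)) =
    cst (p * e.1 + q * e.2) * (cst (- k%:R) * (fun z => rho c k.+1 (affine p q r z)) +
      cst c * (fun z => rho c k.+2 (affine p q r z))).
    by apply/funext => z; have [_ ->] := is_derive_rho_affine k p q r z e c0.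
  apply: bump_mul; first exact: bump_cst.
  by apply: bump_add; apply: bump_mul; [exact: bump_cst|exact: bump_rho|exact: bump_cst|exact: bump_rho].
- have -> : 'D_e (cst a : R * R -> R) = cst 0 by apply/funext => z; rewrite derive_cst.
  exact: bump_cst.
- have -> : 'D_e (f + g) = 'D_e f + 'D_e g.
    apply/funext => z; rewrite deriveD//; apply: diff_derivable; exact: bump_differentiable.
  exact: bump_add.
- have -> : 'D_e (f * g) = f * 'D_e g + g * 'D_e f.
    apply/funext => z; rewrite deriveM//; apply: diff_derivable; exact: bump_differentiable.
  by apply: bump_add; apply: bump_mul.
Qed.

Lemma bump_smooth f : bump_class f -> smooth f.
Proof.
move=> bf s; have : bump_class (Defs.iterD s f).
  by elim: s => [//|e s IH]; exact: bump_derive.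
exact: bump_differentiable.
Qed.

End Bumps.

(** * Boxes as a generating family; functions with vanishing integrals *)

Section Boxes.
Variable R : realType.
Notation mR := (measurableTypeR R).

Definition box (a b c d : R) : set (R * R) := `]a, b[ `*` `]c, d[.

Definition cbox (a b c d : R) : set (R * R) := `[a, b] `*` `[c, d].

Definition boxes : set (set (R * R)) :=
  [set A | exists a b c d, A = box a b c d].

Lemma measurable_box a b c d : measurable (box a b c d : set (mR * mR)).
Proof. by apply: measurableX; exact: measurable_itv. Qed.

Lemma box_setI a b c d a' b' c' d' : box a b c d `&` box a' b' c' d' =
  box (Num.max a a') (Num.min b b') (Num.max c c') (Num.min d d').
Proof.
apply/seteqP; split=> z; rewrite /box/= !in_itv/= !gt_max !lt_min.
  move=> [[/andP[-> ->] /andP[-> ->]] [/andP[-> ->] /andP[-> ->]]]; split => //.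
by move=> [/andP[/andP[-> ->] /andP[-> ->]] /andP[/andP[-> ->] /andP[-> ->]]].
Qed.

Lemma boxes_setI : setI_closed boxes.
Proof.
move=> A B [a [b [c [d ->]]]] [a' [b' [c' [d' ->]]]].
by rewrite box_setI; do 4 eexists.
Qed.

(** Both projections are measurable for the generated sigma-algebra, a strip being the union of
    boxes whose other side is ]-n, n[; hence so is the identity, their pairing. *)
Lemma boxes_generate (A : set (mR * mR)) : measurable A -> <<s boxes >> A.
Proof.
move=> mA.
pose T' := g_sigma_algebraType boxes.
have bigbox (F : nat -> set (R * R)) : (forall n, boxes (F n)) ->
    measurable (\bigcup_n F n : set T').
  by move=> hF; apply: bigcupT_measurable => n; apply: sub_sigma_algebra.
have itvcover (x : R) : exists n : nat, `]- n%:R, n%:R[%classic x.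
  exists (Num.bound `|x|); rewrite /= in_itv/= -ltr_norml.
  by rewrite archi_boundP.
have m1 : measurable_fun setT (fst : T' -> mR).
  apply: (measurability _ (RGenOpens.measurableE R)) => _ [_ [a [b ->]] <-].
  rewrite setTI.
  have -> : fst @^-1` `]a, b[%classic = \bigcup_n box a b (- n%:R) n%:R.
    apply/seteqP; split => z /=; last by case=> n _ [].
    by move=> z1; have [n zn] := itvcover z.2; exists n.
  by apply: bigbox => n; do 4 eexists.
have m2 : measurable_fun setT (snd : T' -> mR).
  apply: (measurability _ (RGenOpens.measurableE R)) => _ [_ [a [b ->]] <-].
  rewrite setTI.
  have -> : snd @^-1` `]a, b[%classic = \bigcup_n box (- n%:R) n%:R a b.
    apply/seteqP; split => z /=; last by case=> n _ [].
    by move=> z1; have [n zn] := itvcover z.1; exists n.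
  by apply: bigbox => n; do 4 eexists.
have := measurable_fun_pair m1 m2 measurableT mA.
rewrite setTI; set X := _ @^-1` _; have -> : X = A by apply/seteqP; split; case.
by [].
Qed.

(** The measurable sets on which the integral vanishes form a Dynkin system, and the boxes are
    closed under intersection. *)
Lemma integral0_measurable (f : mR * mR -> R) (Q : set (mR * mR)) :
  measurable Q -> (leb2 R).-integrable Q (EFin \o f) ->
  (\int[leb2 R]_(z in Q) (f z)%:E = 0)%E ->
  (forall a b c d, (\int[leb2 R]_(z in Q `&` box a b c d) (f z)%:E = 0)%E) ->
  forall A : set (mR * mR), measurable A -> (\int[leb2 R]_(z in Q `&` A) (f z)%:E = 0)%E.
Proof.
move=> mQ iQ fQ fbox A mA.
pose D : set (set (mR * mR)) := [set B | measurable B /\ (\int[leb2 R]_(z in Q `&` B) (f z)%:E = 0)%E].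
have mf : measurable_fun Q (EFin \o f) by exact: measurable_int iQ.
suff /(_ _ (boxes_generate mA))[] : <<s boxes >> `<=` D by [].
apply: lambda_system_subset => //; first exact: boxes_setI.
- apply/dynkin_lambda_system; split.
  + by split; rewrite ?setIT.
  + move=> B [mB fB]; split; first exact: measurableC.
    have mQB : measurable (Q `&` B) by exact: measurableI.
    have mQB' : measurable (Q `&` ~` B) by apply: measurableI => //; exact: measurableC.
    have QE : (Q `&` B) `|` (Q `&` ~` B) = Q by rewrite -setIUr setUv setIT.
    have := @integral_setU _ _ _ (leb2 R) _ _ (EFin \o f) mQB mQB'.
    rewrite QE => /(_ mf); rewrite fQ fB add0e => ->//.
    apply/disj_setPS => z [[_ Bz] [_ nBz]]; exact: nBz.
  + move=> F tF DF; split; first by apply: bigcupT_measurable => n; have [] := DF n.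
    have mQF n : measurable (Q `&` F n) by apply: measurableI => //; have [] := DF n.
    rewrite setI_bigcupr integral_bigcup//.
    * by apply: eseries0 => n _ _; have [] := DF n.
    * exact: trivIset_setIl.
    * by rewrite -setI_bigcupr; apply: integrableS iQ => //; rewrite ?setI_bigcupr; exact: bigcupT_measurable.
- move=> _ [a [b [c [d ->]]]]; split; first exact: measurable_box.
  exact: fbox.
Qed.

(** Taking for [A] the part of [Q] where f >= 0 and its complement shows that |f| has integral 0. *)
Lemma ae_eq0_integral0 (f : mR * mR -> R) (Q : set (mR * mR)) :
  measurable Q -> (leb2 R).-integrable Q (EFin \o f) ->
  (forall A : set (mR * mR), measurable A -> (\int[leb2 R]_(z in Q `&` A) (f z)%:E = 0)%E) ->
  f = cst 0 %[ae leb2 R in Q].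
Proof.
move=> mQ iQ f0.
have mf : measurable_fun Q (EFin \o f) by exact: measurable_int iQ.
have mf' : measurable_fun Q f by exact/measurable_EFinP.
pose P := Q `&` f @^-1` `[0, +oo[%classic.
have mP : measurable P by apply: mf' => //; exact: measurable_itv.
have mN : measurable (Q `&` ~` P) by apply: measurableI => //; exact: measurableC.
have QE : P `|` (Q `&` ~` P) = Q.
  by rewrite /P setCI setIUr setICr set0U -setIUr setUv setIT.
have habs : (\int[leb2 R]_(z in Q) `|(EFin \o f) z| = 0)%E.
  have mabs : measurable_fun Q (fun z => `|(EFin \o f) z|)%E by exact: measurableT_comp.
  have disj : [disjoint P & Q `&` ~` P] by apply/disj_setPS => z [Pz [_]].
  have := @ge0_integral_setU _ _ _ (leb2 R) _ _ mP mN (fun z => `|(EFin \o f) z|)%E.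
  rewrite QE => ->//.
  rewrite [X in (X + _)%E](_ : _ = 0%E) ?add0e.
    transitivity (- \int[leb2 R]_(z in Q `&` ~` P) (f z)%:E)%E; last by rewrite f0 ?oppe0//; exact: measurableC.
    rewrite -integralN; last first.
      apply: integrable_add_def => //; apply: integrableS iQ => //.
    apply: eq_integral => z; rewrite inE => -[Qz Pz] /=.
    rewrite ltr0_norm ?EFinN// ltNge; apply/negP => fz; apply: Pz.
    by split => //=; rewrite in_itv/= fz.
  transitivity (\int[leb2 R]_(z in Q `&` P) (f z)%:E)%E; last exact: f0.
  rewrite (_ : Q `&` P = P); last by rewrite /P setIA setIid.
  apply: eq_integral => z; rewrite inE => -[Qz] /=; rewrite in_itv/= andbT => fz.
  by rewrite ger0_norm.
move/(ae_eq_integral_abs (leb2 R) mQ mf): habs.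
apply: (@filterS _ _ (ae_filter_ringOfSetsType (leb2 R))) => z /= h Qz.
by have [] := h Qz.
Qed.

End Boxes.

(** * The fundamental lemma of the calculus of variations *)

Section FundamentalLemma.
Variables (R : realType) (Om : set (R * R)).
Notation mR := (measurableTypeR R).
Implicit Types (h phi : R * R -> R) (a b c d : R).

(** A product of four factors exp(- k / distance to a side) with k = 1 / (n + 1). As k tends to 0
    each factor tends to 1 inside the box and stays 0 outside, so the limit is the indicator of the
    open box. *)
Definition box_bump (n : nat) a b c d : R * R -> R :=
  let k : R := n.+1%:R^-1 in
  (fun z => rho k 0 (affine 1 0 (- a) z)) * (fun z => rho k 0 (affine (-1) 0 b z)) *
  ((fun z => rho k 0 (affine 0 1 (- c) z)) * (fun z => rho k 0 (affine 0 (-1) d z))).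

Lemma box_bumpE n a b c d z : let k : R := n.+1%:R^-1 in
  box_bump n a b c d z =
    rho k 0 (z.1 - a) * rho k 0 (b - z.1) * (rho k 0 (z.2 - c) * rho k 0 (d - z.2)).
Proof.
rewrite /box_bump !fctE /affine !mul1r !mulN1r !mul0r !addr0 !add0r.
by rewrite ![- _ + _]addrC.
Qed.

Lemma rho0_ge0 (k x : R) : 0 <= rho k 0 x.
Proof. by rewrite /rho; case: ifPn => // _; rewrite expr0 mul1r expR_ge0. Qed.

Lemma rho0_le1 (k x : R) : 0 < k -> rho k 0 x <= 1.
Proof.
move=> k0; rewrite /rho; case: ifPn => // x0; rewrite expr0 mul1r -expR0 ler_expR.
by rewrite oppr_le0 divr_ge0 ?ltW.
Qed.

Lemma rho0_eq0 (k x : R) : x <= 0 -> rho k 0 x = 0.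
Proof. by rewrite /rho leNgt; case: ifPn. Qed.

Lemma rho0_cvg (x : R) : 0 < x -> rho n.+1%:R^-1 0 x @[n --> \oo] --> (1 : R).
Proof.
move=> x0; rewrite /rho x0.
have -> : (fun n : nat => x^-1 ^+ 0 * expR (- (n.+1%:R^-1 / x))) =
    expR \o (fun n => - (harmonic n / x)).
  by apply/funext => n; rewrite /= expr0 mul1r.
rewrite -expR0; apply: continuous_cvg; first exact: continuous_expR.
rewrite -[X in _ --> X]oppr0; apply: cvgN.
rewrite -[X in _ --> X](mul0r x^-1); apply: cvgMl; exact: cvg_harmonic.
Qed.

Lemma box_bump_ge0 n a b c d z : 0 <= box_bump n a b c d z.
Proof. by rewrite box_bumpE; do 3 ?apply: mulr_ge0; exact: rho0_ge0. Qed.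

Lemma box_bump_le1 n a b c d z : box_bump n a b c d z <= 1.
Proof.
have k0 : 0 < (n.+1%:R^-1 : R) by rewrite invr_gt0.
by rewrite box_bumpE !mulr_ile1 ?mulr_ge0 ?rho0_ge0 ?rho0_le1.
Qed.

Lemma box_bump_eq0 n a b c d z : ~ box a b c d z -> box_bump n a b c d z = 0.
Proof.
rewrite box_bumpE /box /= !in_itv/= => hz.
have [za|za] := leP (z.1 - a) 0; first by rewrite rho0_eq0// !mul0r.
have [zb|zb] := leP (b - z.1) 0; first by rewrite [rho _ _ (b - _)]rho0_eq0// mulr0 mul0r.
have [zc|zc] := leP (z.2 - c) 0; first by rewrite [rho _ _ (z.2 - _)]rho0_eq0// mul0r mulr0.
have [zd|zd] := leP (d - z.2) 0; first by rewrite [rho _ _ (d - _)]rho0_eq0// !mulr0.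
by case: hz; move: za zb zc zd; rewrite !subr_gt0 => -> -> -> ->.
Qed.

Lemma box_bump_cvg a b c d z : box_bump n a b c d z @[n --> \oo] --> (\1_(box a b c d) z : R).
Proof.
rewrite indicE; have [|] := boolP (z \in box a b c d).
  rewrite inE /box /= !in_itv/= => -[/andP[z1 z2] /andP[z3 z4]].
  under eq_fun do rewrite box_bumpE.
  rewrite -[1%:R](mulr1 1) -[X in X * _](mulr1 1) -[X in _ * X](mulr1 1).
  by apply: cvgM; apply: cvgM; apply: rho0_cvg; rewrite subr_gt0.
rewrite notin_setE => hz; under eq_fun do rewrite box_bump_eq0//.
exact: cvg_cst.
Qed.

Lemma box_bump_test n a b c d : cbox a b c d `<=` Om ->
  test_function Om (box_bump n a b c d).
Proof.
move=> cO; have k0 : 0 < (n.+1%:R^-1 : R) by rewrite invr_gt0.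
have cc : compact (cbox a b c d) by apply: compact_setX; exact: segment_compact.
have sub : closure [set z | box_bump n a b c d z != 0] `<=` cbox a b c d.
  have cl : closed (cbox a b c d) by apply: compact_closed => //; exact: norm_hausdorff.
  rewrite [X in _ `<=` X](closure_id _).1//; apply: closureS => z /= /eqP hz.
  have : box a b c d z by apply: contrapT => /(box_bump_eq0 n).
  rewrite /box /cbox /= !in_itv/= => -[/andP[? ?] /andP[? ?]].
  by rewrite !ltW.
split; last exact: subset_trans sub cO.
- by apply: bump_smooth; apply: bump_mul; apply: bump_mul; exact: bump_rho.
- by apply: subclosed_compact cc sub; exact: closed_closure.
Qed.

Hypotheses (oOm : open Om) (bOm : bounded_set Om).

Let mOm : measurable (Om : set (mR * mR)). Proof. exact: open_measurable_plane. Qed.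

Variable h : R * R -> R.
Hypotheses (hL2 : L2 Om h) (h_ortho : forall phi, test_function Om phi -> ip Om h phi = 0).

Let H : mR * mR -> R := h \_ Om.

Let iH : (leb2 R).-integrable setT (EFin \o H).
Proof.
have L1 : L2 Om (cst 1) by apply: continuous_L2 => // z; exact: cvg_cst.
have := L2_integrable hL2 L1; apply: eq_integrable => // z _ /=.
by rewrite /H /patch; case: ifPn; rewrite ?mulr1 ?mul0r.
Qed.

Let mH : measurable_fun setT H.
Proof. by apply/measurable_EFinP; exact: measurable_int iH. Qed.

Let integral_box a b c d : cbox a b c d `<=` Om ->
  (\int[leb2 R]_(z in box a b c d) (H z)%:E = 0)%E.
Proof.
move=> cO; have mB := @measurable_box R a b c d.
pose f n (z : mR * mR) := (H z * box_bump n a b c d z)%:E.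
have mphi n : measurable_fun setT (box_bump n a b c d : mR * mR -> R).
  apply: continuous_measurable_plane; apply: smooth_continuous.
  exact: test_smooth (box_bump_test n cO).
have f0 n : (\int[leb2 R]_z f n z = 0)%E.
  have tn := box_bump_test n cO.
  have /(integral_fune_fin_num measurableT) fin := L2_integrable hL2 (test_L2 oOm bOm tn).
  have E := h_ortho tn; rewrite ipE /Rintegral in E.
  have {}E := congr1 (@EFin R) E; rewrite fineK// in E.
  apply: etrans E; apply: eq_integral => z _; rewrite /f; congr (_ * _)%:E.
  by rewrite /patch; case: ifPn => //; rewrite notin_setE => /(test_eq0 tn).
have mf n : measurable_fun setT (f n).
  by apply/measurable_EFinP; apply: measurable_funM.
have mlim : measurable_fun setT (fun z => (H z * \1_(box a b c d) z)%:E : \bar R).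
  by apply/measurable_EFinP; apply: measurable_funM => //; exact: measurable_indic.
have fcv : {ae leb2 R, forall z, setT z -> f ^~ z @ \oo --> (H z * \1_(box a b c d) z)%:E}.
  apply: aeW => z _; apply/cvg_EFin; first by near=> n.
  by apply: cvgM; [exact: cvg_cst|exact: box_bump_cvg].
(* The bumps take values in [0, 1], so |H| is an integrable majorant. *)
have fg : {ae leb2 R, forall z n, setT z -> (`|f n z| <= `|(EFin \o H) z|)%E}.
  apply: aeW => z n _; rewrite /f /= lee_fin normrM ler_piMr//.
  by rewrite ger0_norm ?box_bump_ge0 ?box_bump_le1.
have [_ _] := dominated_convergence measurableT mf mlim fcv (integrable_abse iH) fg.
rewrite (_ : [sequence _]_n = cst 0%E); last by apply/funext => n; exact: f0.
move=> /(cvg_lim (@ereal_hausdorff R)); rewrite lim_cst; last exact: ereal_hausdorff.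
move=> E; apply: etrans (esym E); rewrite [LHS]integral_mkcond.
congr (integral _ _ _); apply/funext => z.
rewrite /patch indicE; case: (z \in box a b c d); rewrite ?mulr1 ?mulr0//.
Unshelve. all: by end_near. Qed.

(** On each box with closure in Om, h integrates to 0 over every subbox, hence h = 0 almost
    everywhere on it. Om is covered by countably many such boxes with rational corners, so the
    exceptional sets add up to a null set. *)
Lemma ip_eq0_of_ortho : ip Om h h = 0.
Proof.
have hQ a b c d : cbox a b c d `<=` Om -> H = cst 0 %[ae leb2 R in box a b c d].
  move=> cO; have mB := @measurable_box R a b c d.
  have iB : (leb2 R).-integrable (box a b c d : set (mR * mR)) (EFin \o H).
    by apply: integrableS iH.
  apply: ae_eq0_integral0 => // A mA; apply: integral0_measurable => //.
    exact: integral_box.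
  move=> a' b' c' d'; rewrite box_setI; apply: integral_box.
  apply: subset_trans cO => z; rewrite /cbox /= !in_itv/= !ge_max !le_min.
  by move=> [/andP[/andP[-> _] /andP[-> _]] /andP[/andP[-> _] /andP[-> _]]].
pose B (q : (rat * rat) * (rat * rat)) : set (mR * mR) :=
  box (ratr q.1.1) (ratr q.1.2) (ratr q.2.1) (ratr q.2.2).
pose C (q : (rat * rat) * (rat * rat)) : set (mR * mR) :=
  cbox (ratr q.1.1) (ratr q.1.2) (ratr q.2.1) (ratr q.2.2).
have neg : (leb2 R).-negligible [set z | H z != 0].
  have : (leb2 R).-negligible (\bigcup_n
      (if @unpickle ((rat * rat) * (rat * rat))%type n is Some q then
         if `[< C q `<=` Om >] then [set z | B q z /\ H z != 0] else set0 else set0)).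
    apply: negligible_bigcup => n; case: unpickle => [q|]; last exact: negligible_set0.
    case: ifPn => [/asboolP/hQ|_]; last exact: negligible_set0.
    rewrite /almost_everywhere; apply: negligibleS => z [Bz Hz] /= h0.
    by move/eqP: Hz; apply; exact: h0.
  apply: negligibleS => z /= Hz.
  have Oz : Om z.
    by apply: contrapT => Oz; move/eqP: Hz; apply; rewrite /H /patch memNset.
  have /nbhs_ballP[e /= e0 eU] : nbhs (z : R * R) Om by exact: open_nbhs_nbhs.
  have [a [b [a1 b1 a2 b2]]] := rat_enclosure z.1 e0.
  have [c [d [c1 d1 c2 d2]]] := rat_enclosure z.2 e0.
  exists (pickle ((a, b), (c, d))); [exact: I|rewrite pickleK]; case: ifPn => [_|/asboolPn[]].
    by split => //; split; rewrite /= in_itv/= ?a1 ?b1 ?c1 ?d1.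
  move=> w [/=]; rewrite !in_itv/= => /andP[w1 w2] /andP[w3 w4].
  by apply: eU; split; rewrite /ball/= ltr_norml; apply/andP; split; lra.
rewrite ipE /Rintegral (_ : integral _ _ _ = 0%E)//.
rewrite (@ae_eq_integral _ _ _ (leb2 R) setT (cst 0%E))//; first exact: integral0.
- by apply/measurable_EFinP; apply: measurable_funM.
- apply: negligibleS neg => z /= hz; apply/negP => /eqP Hz; apply: hz => _.
  by rewrite -/H Hz mul0r.
Qed.

End FundamentalLemma.

Opaque derive ip L2norm pd.

(** * Weak derivatives and the spaces H^k *)

Section WeakDerivatives.
Variables (R : realType) (Om : set (R * R)).
Notation mR := (measurableTypeR R).
Hypotheses (oOm : open Om) (bOm : bounded_set Om).
Implicit Types (u v g w phi eta : R * R -> R) (i j k : nat) (c : R).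

Let sip : semi_inner (L2 Om) (ip Om).
Proof. exact: ip_semi_inner (open_measurable_plane oOm). Qed.

Lemma L2norm_ge0 u : 0 <= L2norm Om u.
Proof. by rewrite -snorm_ip snorm_ge0. Qed.

Lemma ip_L2normB0 u v w : L2 Om u -> L2 Om v -> L2 Om w ->
  L2norm Om (u - v) = 0 -> ip Om u w = ip Om v w.
Proof.
move=> hu hv hw h0.
have := sip_normr_le sip (sip_memB sip hu hv) hw.
rewrite snorm_ip h0 mul0r normr_le0 (sipBl sip hu hv hw) subr_eq0.
by move/eqP.
Qed.

Lemma L2norm_congr u v : L2 Om u -> L2 Om v -> L2norm Om (u - v) = 0 ->
  L2norm Om u = L2norm Om v.
Proof.
move=> hu hv h0; rewrite -!snorm_ip /snorm; congr Num.sqrt.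
rewrite (ip_L2normB0 hu hv hu h0) (sip_sym sip hv hu).
exact: ip_L2normB0.
Qed.

Lemma is_wpd_unique i j u g g' : L2 Om g -> L2 Om g' ->
  is_wpd Om i j u g -> is_wpd Om i j u g' -> L2norm Om (g - g') = 0.
Proof.
move=> hg hg' w w'; rewrite -snorm_ip /snorm.
rewrite ip_eq0_of_ortho ?sqrtr0//; first exact: (sip_memB sip).
move=> phi tp; rewrite (sipBl sip hg hg' (test_L2 oOm bOm tp)).
have := w _ tp; rewrite (w' _ tp) => /(mulfI _) ->; first by rewrite subrr.
by rewrite expf_neq0// oppr_eq0 oner_eq0.
Qed.

Lemma wpdP k i j u : Hk Om k u -> (i + j <= k)%N ->
  L2 Om (wpd Om i j u) /\ is_wpd Om i j u (wpd Om i j u).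
Proof.
move=> [_ hu] ijk; have [g g1 g2] := hu _ _ ijk.
rewrite /wpd; case: xgetP => [_ _ []//|/(_ g)]; by case.
Qed.

Lemma wpd_L2 k i j u : Hk Om k u -> (i + j <= k)%N -> L2 Om (wpd Om i j u).
Proof. by move=> hu ijk; have [] := wpdP hu ijk. Qed.

Lemma is_wpd_lin i j c u v g g' : L2 Om u -> L2 Om v -> L2 Om g -> L2 Om g' ->
  is_wpd Om i j u g -> is_wpd Om i j v g' ->
  is_wpd Om i j (c *: u + v) (c *: g + g').
Proof.
move=> hu hv hg hg' wu wv phi tp.
have hp := test_L2 oOm bOm tp; have hpd := test_L2 oOm bOm (test_pd i j tp).
rewrite (sip_addl sip c hu hv hpd) (sip_addl sip c hg hg' hp) (wu _ tp) (wv _ tp).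
by rewrite mulrDr mulrCA.
Qed.

Lemma Hk_L2 k u : Hk Om k u -> L2 Om u. Proof. by case. Qed.

Lemma Hk_lin k c u v : Hk Om k u -> Hk Om k v -> Hk Om k (c *: u + v).
Proof.
move=> hu hv; split; first exact: (sip_lin sip c (Hk_L2 hu) (Hk_L2 hv)).
move=> i j ijk; have [lu wu] := wpdP hu ijk; have [lv wv] := wpdP hv ijk.
exists (c *: wpd Om i j u + wpd Om i j v); first exact: (sip_lin sip).
exact: is_wpd_lin (Hk_L2 hu) (Hk_L2 hv) lu lv wu wv.
Qed.

(** The derivative is a chosen representative, so linearity holds only up to a function of L2 norm
    zero; inner products do not see the difference. *)
Lemma wpd_lin k i j c u v : Hk Om k u -> Hk Om k v -> (i + j <= k)%N ->
  L2norm Om (wpd Om i j (c *: u + v) - (c *: wpd Om i j u + wpd Om i j v)) = 0.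
Proof.
move=> hu hv ijk; have [lu wu] := wpdP hu ijk; have [lv wv] := wpdP hv ijk.
have [l w] := wpdP (Hk_lin c hu hv) ijk.
apply: is_wpd_unique l _ w _; first exact: (sip_lin sip).
exact: is_wpd_lin (Hk_L2 hu) (Hk_L2 hv) lu lv wu wv.
Qed.

Lemma ip_wpd_lin k i j c u v w : Hk Om k u -> Hk Om k v -> (i + j <= k)%N -> L2 Om w ->
  ip Om (wpd Om i j (c *: u + v)) w =
  c * ip Om (wpd Om i j u) w + ip Om (wpd Om i j v) w.
Proof.
move=> hu hv ijk hw; have lu := wpd_L2 hu ijk; have lv := wpd_L2 hv ijk.
apply: etrans (sip_addl sip c lu lv hw); apply: (ip_L2normB0 _ _ hw).
- exact: wpd_L2 (Hk_lin c hu hv) ijk.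
- exact: (sip_lin sip).
- exact: wpd_lin hu hv ijk.
Qed.

(** The two sets from which [xget] chooses are equal, so the chosen functions are literally equal.
    This serves the initial condition, which is given only almost everywhere. *)
Lemma wpd_ae_eq i j u v : L2 Om u -> L2 Om v -> u = v %[ae leb2 R in Om] ->
  wpd Om i j u = wpd Om i j v.
Proof.
move=> hu hv uv; rewrite /wpd; congr xget; apply/seteqP.
have E phi : test_function Om phi -> ip Om u (pd i j phi) = ip Om v (pd i j phi).
  move=> tp; have hp := test_L2 oOm bOm (test_pd i j tp).
  by have := eq_ip_ae (open_measurable_plane oOm) hu hv hp uv.
by split => g [hg wg]; split => // phi tp; [rewrite -E//|rewrite E//]; exact: wg.
Qed.

Lemma test_Hk k phi : test_function Om phi -> Hk Om k phi.
Proof.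
move=> tp; split; first exact: test_L2.
by move=> i j _; exists (pd i j phi); [exact/test_L2/test_pd|exact: test_is_wpd].
Qed.

Lemma wpd_test i j phi : test_function Om phi ->
  L2norm Om (wpd Om i j phi - pd i j phi) = 0.
Proof.
move=> tp; have [l w] := wpdP (test_Hk (i + j) tp) (leqnn _).
apply: is_wpd_unique l _ w _; first exact/test_L2/test_pd.
exact: test_is_wpd.
Qed.

Lemma L2norm_wpd_test i j phi : test_function Om phi ->
  L2norm Om (wpd Om i j phi) = L2norm Om (pd i j phi).
Proof.
move=> tp; apply: L2norm_congr; last exact: wpd_test.
- exact: wpd_L2 (test_Hk (i + j) tp) (leqnn _).
- exact/test_L2/test_pd.
Qed.

Lemma wpd00 k u : Hk Om k u -> L2norm Om (wpd Om 0 0 u - u) = 0.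
Proof.
move=> hu; have [l w] := @wpdP k 0 0 u hu (leq0n k).
apply: is_wpd_unique l (Hk_L2 hu) w _ => phi _.
by rewrite expr0 mul1r.
Qed.

Definition hip k u v : R :=
  \sum_(i < k.+1) \sum_(j < k.+1 | (i + j <= k)%N) ip Om (wpd Om i j u) (wpd Om i j v).

Lemma hip_semi_inner k : semi_inner (Hk Om k) (hip k).
Proof.
split.
- apply: (@test_Hk k (cst 0)); split.
  + move=> s z; suff -> : Defs.iterD s (cst 0) = cst 0 by exact: differentiable_cst.
    by elim: s => //= e s ->; apply/funext => y; rewrite derive_cst.
  + have -> : [set z | (cst 0 : R * R -> R) z != 0] = set0.
      by apply/seteqP; split => z //=; rewrite eqxx.
    by rewrite closure0; exact: compact0.
  + have -> : [set z | (cst 0 : R * R -> R) z != 0] = set0.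
      by apply/seteqP; split => z //=; rewrite eqxx.
    by rewrite closure0.
- exact: Hk_lin.
- move=> u v hu hv; apply: eq_bigr => i _; apply: eq_bigr => j ijk.
  exact: (sip_sym sip (wpd_L2 hu ijk) (wpd_L2 hv ijk)).
- move=> c u v w hu hv hw; rewrite /hip mulr_sumr -big_split /=.
  apply: eq_bigr => i _; rewrite mulr_sumr -big_split /=.
  apply: eq_bigr => j ijk; exact: ip_wpd_lin hu hv ijk (wpd_L2 hw ijk).
- move=> u hu; apply: sumr_ge0 => i _; apply: sumr_ge0 => j ijk.
  exact: (sip_ge0 sip (wpd_L2 hu ijk)).
Qed.

Lemma snorm_hip k u : Hk Om k u -> snorm (hip k) u = Hk_norm Om k u.
Proof.
move=> hu; rewrite /snorm /Hk_norm /hip; congr Num.sqrt.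
apply: eq_bigr => i _; apply: eq_bigr => j ijk.
by rewrite -snorm_ip (sqr_snorm sip (wpd_L2 hu ijk)).
Qed.

Lemma L2norm_wpd_le k i j u : Hk Om k u -> (i + j <= k)%N ->
  L2norm Om (wpd Om i j u) <= Hk_norm Om k u.
Proof.
move=> hu ijk.
have ik : (i < k.+1)%N by rewrite ltnS (leq_trans (leq_addr _ _) ijk).
have jk : (j < k.+1)%N by rewrite ltnS (leq_trans (leq_addl _ _) ijk).
rewrite -[leLHS]ger0_norm ?L2norm_ge0// -sqrtr_sqr ler_wsqrtr//.
rewrite (bigD1 (Ordinal ik))//= (bigD1 (Ordinal jk))//= -addrA lerDl.
rewrite addr_ge0// sumr_ge0// => a _; rewrite ?sqr_ge0// sumr_ge0// => b _.
exact: sqr_ge0.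
Qed.

End WeakDerivatives.

Opaque wpd.

(* Stated on real variables because comparing two different integrals by
   conversion is very expensive. *)
Section Arithmetic.
Variable R : realDomainType.
Implicit Types a b c d e f : R.

Lemma eq_add2 a b c d : c = a -> d = b -> a + b = c + d.
Proof. by move=> -> ->. Qed.

Lemma drop_le2 a b c : 0 <= c -> a + b <= c + b + a.
Proof. by move=> ?; lra. Qed.

Lemma drop_le3 a b c d e f : 0 <= c -> 0 <= e -> 0 <= f ->
  a + b + d <= a + b + c + d + e + f.
Proof. by move=> ? ? ?; lra. Qed.

Lemma poincare_limit (L u p d dp g e : R) : 0 < L -> u <= p + d -> p <= 2 * L * dp ->
  dp <= g + d -> d * (2 * L + 1) <= e -> u <= 2 * L * g + e.
Proof.
move=> L0 h1 h2 h3 h4.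
have : 2 * L * dp <= 2 * L * (g + d) by rewrite ler_wpM2l//; lra.
lra.
Qed.

End Arithmetic.

(** * The spaces H^k_0 and the Poincare inequality *)

Section SobolevZero.
Variables (R : realType) (Om : set (R * R)).
Notation mR := (measurableTypeR R).
Hypotheses (oOm : open Om) (bOm : bounded_set Om).
Implicit Types (u v g w phi eta : R * R -> R) (i j k : nat) (c : R).

Let sip : semi_inner (L2 Om) (ip Om).
Proof. exact: ip_semi_inner (open_measurable_plane oOm). Qed.

Let sH k : semi_inner (Hk Om k) (hip Om k).
Proof. exact: hip_semi_inner. Qed.

Lemma semi_inner_sub (S S' : set (R * R -> R)) B : S' `<=` S -> S' 0 ->
  (forall c u v, S' u -> S' v -> S' (c *: u + v)) ->
  semi_inner S B -> semi_inner S' B.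
Proof.
move=> SS S0 Sl sB; split => //.
- by move=> u v /SS hu /SS hv; exact: (sip_sym sB).
- by move=> c u v w /SS hu /SS hv /SS hw; exact: (sip_addl sB).
- by move=> u /SS; exact: (sip_ge0 sB).
Qed.

Lemma semi_innerD (S : set (R * R -> R)) B B' :
  semi_inner S B -> semi_inner S B' -> semi_inner S (fun u v => B u v + B' u v).
Proof.
move=> sB sB'; split.
- exact: (sip_mem0 sB).
- exact: (sip_lin sB).
- by move=> u v hu hv; rewrite (sip_sym sB)// (sip_sym sB').
- move=> c u v w hu hv hw; rewrite (sip_addl sB)// (sip_addl sB')//; ring.
- by move=> u hu; rewrite addr_ge0 ?(sip_ge0 sB) ?(sip_ge0 sB').
Qed.

Lemma L2norm_sqr g : L2 Om g -> L2norm Om g ^+ 2 = ip Om g g.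
Proof. by move=> hg; rewrite -(sqr_snorm sip hg) snorm_ip. Qed.

Lemma Hk_norm_ge0 k u : 0 <= Hk_norm Om k u. Proof. exact: sqrtr_ge0. Qed.

Lemma Hk_normD k u v : Hk Om k u -> Hk Om k v ->
  Hk_norm Om k (u + v) <= Hk_norm Om k u + Hk_norm Om k v.
Proof.
move=> hu hv; have := snormD (sH k) hu hv.
by rewrite !snorm_hip//; exact: (sip_memD (sH k)).
Qed.

Lemma Hk_normZ k c u : Hk Om k u -> Hk_norm Om k (c *: u) = `|c| * Hk_norm Om k u.
Proof.
move=> hu; have := snormZ (sH k) c hu.
by rewrite !snorm_hip//; exact: (sip_memZ (sH k)).
Qed.

Lemma Hk_norm0 k : Hk_norm Om k 0 = 0.
Proof. by rewrite -(scale0r (0 : R * R -> R)) Hk_normZ ?normr0 ?mul0r//; exact: (sip_mem0 (sH k)). Qed.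

Lemma Hk0_Hk k u : Hk0 Om k u -> Hk Om k u. Proof. by case. Qed.

Lemma Hk0_approx k u (e : R) : Hk0 Om k u -> 0 < e ->
  exists2 phi, test_function Om phi & Hk_norm Om k (phi - u) < e.
Proof.
move=> [_ [phi tp /cvgrPdist_lt cv]] e0.
have [n _ /(_ n (leqnn n))] := cv _ e0; rewrite /= sub0r normrN => hn.
by exists (phi n) => //; exact: le_lt_trans (ler_norm _) hn.
Qed.

Lemma test_Hk0 k phi : test_function Om phi -> Hk0 Om k phi.
Proof.
move=> tp; split; first exact: test_Hk.
exists (fun=> phi) => //; rewrite (_ : (fun n => _) = cst 0); first exact: cvg_cst.
by apply/funext => n; rewrite subrr Hk_norm0.
Qed.

Lemma Hk0_lin k c u v : Hk0 Om k u -> Hk0 Om k v -> Hk0 Om k (c *: u + v).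
Proof.
move=> [hu [f tf cf]] [hv [g tg cg]]; split; first exact: Hk_lin.
exists (fun n => c *: f n + g n); first by move=> n; exact: test_lin.
apply: (@squeeze_cvgr _ _ _ _ (cst 0)
  (fun n => `|c| * Hk_norm Om k (f n - u) + Hk_norm Om k (g n - v))).
- apply: nearW => n; rewrite Hk_norm_ge0 /=.
  have hf : Hk Om k (f n - u) by apply: (sip_memB (sH k)) hu; exact: test_Hk.
  have hg : Hk Om k (g n - v) by apply: (sip_memB (sH k)) hv; exact: test_Hk.
  have -> : c *: f n + g n - (c *: u + v) = c *: (f n - u) + (g n - v).
    by rewrite scalerBr opprD addrACA.
  by rewrite -Hk_normZ//; apply: Hk_normD => //; exact: (sip_memZ (sH k)).
- exact: cvg_cst.
- rewrite -[X in _ --> X]addr0 -[X in _ --> X + _](mulr0 `|c|).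
  by apply: cvgD cg; apply: cvgMr.
Qed.

Lemma Hk0_0 k : Hk0 Om k 0.
Proof.
split; first exact: (sip_mem0 (sH k)).
have t0 : test_function Om (0 : R * R -> R).
  have E : [set z | (0 : R * R -> R) z != 0] = set0.
    by apply/seteqP; split => z //=; rewrite eqxx.
  split; rewrite ?E ?closure0//; last exact: compact0.
  move=> s z; suff -> : Defs.iterD s (0 : R * R -> R) = cst 0 by exact: differentiable_cst.
  by elim: s => //= e s ->; apply/funext => y; rewrite derive_cst.
by have [] := test_Hk0 k t0.
Qed.

Lemma hip_Hk0_semi_inner k : semi_inner (Hk0 Om k) (hip Om k).
Proof. exact: semi_inner_sub (@Hk0_Hk k) (Hk0_0 k) (@Hk0_lin k) (sH k). Qed.

Lemma triangle_sum1 (F : nat -> nat -> R) :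
  \sum_(i < 2) \sum_(j < 2 | (i + j <= 1)%N) F i j = F 0%N 0%N + F 0%N 1%N + F 1%N 0%N.
Proof.
under eq_bigr do rewrite big_mkcond.
by rewrite !(big_ord_recl, big_ord0) /bump /= !(addr0, add0r).
Qed.

Lemma triangle_sum2 (F : nat -> nat -> R) :
  \sum_(i < 3) \sum_(j < 3 | (i + j <= 2)%N) F i j =
  F 0%N 0%N + F 0%N 1%N + F 0%N 2%N + F 1%N 0%N + F 1%N 1%N + F 2%N 0%N.
Proof.
under eq_bigr do rewrite big_mkcond.
by rewrite !(big_ord_recl, big_ord0) /bump /= !(addr0, add0r) !addrA.
Qed.

Lemma Hk_norm1E u : Hk_norm Om 1 u = Num.sqrt (L2norm Om (wpd Om 0 0 u) ^+ 2 +
  L2norm Om (wpd Om 0 1 u) ^+ 2 + L2norm Om (wpd Om 1 0 u) ^+ 2).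
Proof.
by rewrite /Hk_norm (triangle_sum1 (fun i j => L2norm Om (wpd Om i j u) ^+ 2)).
Qed.

Lemma Hk_norm2E u : Hk_norm Om 2 u = Num.sqrt (L2norm Om (wpd Om 0 0 u) ^+ 2 +
  L2norm Om (wpd Om 0 1 u) ^+ 2 + L2norm Om (wpd Om 0 2 u) ^+ 2 +
  L2norm Om (wpd Om 1 0 u) ^+ 2 + L2norm Om (wpd Om 1 1 u) ^+ 2 +
  L2norm Om (wpd Om 2 0 u) ^+ 2).
Proof.
by rewrite /Hk_norm (triangle_sum2 (fun i j => L2norm Om (wpd Om i j u) ^+ 2)).
Qed.

Lemma Hk_norm12 u : Hk_norm Om 1 u <= Hk_norm Om 2 u.
Proof.
rewrite Hk_norm1E Hk_norm2E ler_wsqrtr//.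
by apply: drop_le3; exact: sqr_ge0.
Qed.

Lemma Hk2_Hk1 u : Hk Om 2 u -> Hk Om 1 u.
Proof. by move=> [hu wu]; split => // i j ij; apply: wu; exact: leq_trans ij _. Qed.

Lemma Hk02_Hk01 u : Hk0 Om 2 u -> Hk0 Om 1 u.
Proof.
move=> [hu [f tf cf]]; split; first exact: Hk2_Hk1.
exists f => //; apply: squeeze_cvgr cf; last exact: cvg_cst.
by apply: nearW => n; rewrite Hk_norm_ge0 Hk_norm12.
Qed.

Lemma ip_wpd_semi_inner k i j : (i + j <= k)%N ->
  semi_inner (Hk Om k) (fun u v => ip Om (wpd Om i j u) (wpd Om i j v)).
Proof.
move=> ijk; split.
- exact: (sip_mem0 (sH k)).
- exact: Hk_lin.
- by move=> u v hu hv; exact: (sip_sym sip (wpd_L2 hu ijk) (wpd_L2 hv ijk)).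
- by move=> c u v w hu hv hw; exact: (ip_wpd_lin oOm bOm c hu hv ijk (wpd_L2 hw ijk)).
- by move=> u hu; exact: (sip_ge0 sip (wpd_L2 hu ijk)).
Qed.

Lemma ip_grad_semi_inner : semi_inner (Hk Om 1) (ip_grad Om).
Proof. by apply: semi_innerD; exact: ip_wpd_semi_inner. Qed.

Lemma snorm_ip_grad : snorm (ip_grad Om) = grad_norm Om. Proof. by []. Qed.

Lemma grad_norm_le u : Hk Om 1 u -> grad_norm Om u <= Hk_norm Om 1 u.
Proof.
move=> hu; rewrite Hk_norm1E /grad_norm; apply: ler_wsqrtr.
have e1 := L2norm_sqr (@wpd_L2 _ _ _ 1 0 u hu isT).
have e2 := L2norm_sqr (@wpd_L2 _ _ _ 0 1 u hu isT).
have -> : ip_grad Om u u = L2norm Om (wpd Om 1 0 u) ^+ 2 + L2norm Om (wpd Om 0 1 u) ^+ 2.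
  by rewrite /ip_grad; apply: eq_add2; [exact: e1|exact: e2].
by apply: drop_le2; exact: sqr_ge0.
Qed.

Lemma L2norm_wpd10_le u : Hk Om 1 u -> L2norm Om (wpd Om 1 0 u) <= grad_norm Om u.
Proof.
move=> hu; rewrite -snorm_ip /snorm /grad_norm /ip_grad ler_wsqrtr// lerDl.
by apply: (sip_ge0 sip); exact: wpd_L2 hu _.
Qed.

(** Both sides are controlled by the H^1 norm, so the inequality for test functions passes to their
    closure. *)
Lemma poincare : exists2 C : R, 0 < C & forall u, Hk0 Om 1 u ->
  L2norm Om u <= C * grad_norm Om u.
Proof.
have [L L0 OL] := bounded_sub_square bOm.
exists (2 * L) => [|u hu]; first lra.
have hu1 := Hk0_Hk hu.
apply/ler_addgt0Pr => e e0.
(* An approximation error d costs d on the left and 2 L d through the gradient on the right. *)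
have d0 : 0 < e / (2 * L + 1) by rewrite divr_gt0//; lra.
have [phi tp hp] := Hk0_approx hu d0.
have hf := test_Hk oOm bOm 1 tp; have hfu := sip_memB (sH 1) hf hu1.
have P : L2norm Om phi <= 2 * L * L2norm Om (wpd Om 1 0 phi).
  rewrite (L2norm_wpd_test oOm bOm 1 0 tp) pd10E.
  by have Q := poincare_test oOm bOm OL L0 tp.
have h1 : L2norm Om (phi - u) <= Hk_norm Om 1 (phi - u).
  have Q := @L2norm_wpd_le _ _ 1 0 0 _ hfu isT.
  have E := L2norm_congr oOm (@wpd_L2 _ _ 1 0 0 _ hfu isT) (Hk_L2 hfu) (wpd00 oOm bOm hfu).
  by rewrite -E.
have h2 : L2norm Om u <= L2norm Om phi + Hk_norm Om 1 (phi - u).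
  have := snormB sip (Hk_L2 hf) (Hk_L2 hfu).
  by rewrite subKr snorm_ip => /le_trans; apply; rewrite lerD2l.
have h3 : L2norm Om (wpd Om 1 0 phi) <= grad_norm Om u + Hk_norm Om 1 (phi - u).
  apply: (le_trans (L2norm_wpd10_le hf)).
  have := snormD ip_grad_semi_inner hu1 hfu; rewrite addrC subrK snorm_ip_grad.
  by move=> /le_trans; apply; rewrite lerD2l; exact: grad_norm_le.
have h5 : Hk_norm Om 1 (phi - u) * (2 * L + 1) <= e.
  by rewrite -ler_pdivlMr ?ltW// addr_gt0// mulr_gt0.
exact: poincare_limit L0 h2 P h3 h5.
Qed.

End SobolevZero.

(** * Real arithmetic for the H^2 estimate *)

Section LaplacianArithmetic.
Variable R : rcfType.
Implicit Types a b c d e f p q r l u : R.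

Lemma lin_combine (x y z c u1 u2 v1 v2 a b : R) : x = a + b -> a = c * u1 + v1 ->
  b = c * u2 + v2 -> y = u1 + u2 -> z = v1 + v2 -> x = c * y + z.
Proof. by move=> -> -> -> -> ->; rewrite mulrDr addrACA. Qed.

Lemma le0_add2 (n a b : R) : n <= a + b -> a = 0 -> b = 0 -> n <= 0.
Proof. by move=> h e1 e2; rewrite e1 e2 addr0 in h. Qed.

Lemma eq_add_trans (x y a b c d : R) : x = a + b -> c = a -> d = b -> y = c + d -> x = y.
Proof. by move=> -> -> -> ->. Qed.

Lemma sqr_add_trans (x l p q r x' y p' r' : R) : x = l -> l = p' + 2 * x' + r' ->
  p = p' -> r = r' -> x' = y -> q = y -> x = p + 2 * q + r.
Proof. by move=> -> -> -> -> -> ->. Qed.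

Lemma le_add2 a b c : a <= c -> b <= c -> a + b <= 2 * c.
Proof. by move=> ? ?; lra. Qed.

Lemma sqr_polar p r q l : l = p + 2 * q + r -> 0 <= q -> 0 <= p -> 0 <= r ->
  [/\ p <= l, q <= l & r <= l].
Proof. by move=> -> ? ? ?; split; lra. Qed.

(** Here a, bx, by' stand for the norms of phi, phi_x, phi_y, then p, q, r for those of phi_xx,
    phi_xy, phi_yy, and l for that of the Laplacian. The Poincare inequality in x bounds the squares
    by 16 L^4, 4 L^2 and 4 L^2 times l^2, and the second derivatives add 3. The sum is C l^2 <= C^2
    l^2 because C >= 1. *)
Lemma elliptic_bound (L a bx by' p q r l : R) : 0 < L -> 0 <= l -> 0 <= p -> 0 <= q ->
  0 <= a -> 0 <= bx -> 0 <= by' ->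
  p ^+ 2 <= l ^+ 2 -> q ^+ 2 <= l ^+ 2 -> r ^+ 2 <= l ^+ 2 ->
  a <= 2 * L * bx -> bx <= 2 * L * p -> by' <= 2 * L * q ->
  Num.sqrt (a ^+ 2 + by' ^+ 2 + r ^+ 2 + bx ^+ 2 + q ^+ 2 + p ^+ 2) <=
  (16 * L ^+ 4 + 8 * L ^+ 2 + 3) * l.
Proof.
move=> L0 l0 p0 q0 a0 bx0 by0 pl ql rl h1 h2 h3.
have L2 : 0 <= L ^+ 2 := sqr_ge0 L.
have sq (x y : R) : 0 <= x -> x <= y -> x ^+ 2 <= y ^+ 2.
  by move=> x0 xy; rewrite ler_sqr ?nnegrE// (le_trans x0).
have e1 : bx ^+ 2 <= 4 * L ^+ 2 * l ^+ 2.
  have : bx ^+ 2 <= (2 * L * p) ^+ 2 by exact: sq.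
  by move/le_trans; apply; rewrite !exprMn -natrX ler_wpM2l// mulr_ge0.
have e2 : by' ^+ 2 <= 4 * L ^+ 2 * l ^+ 2.
  have : by' ^+ 2 <= (2 * L * q) ^+ 2 by exact: sq.
  by move/le_trans; apply; rewrite !exprMn -natrX ler_wpM2l// mulr_ge0.
have e3 : a ^+ 2 <= 16 * L ^+ 4 * l ^+ 2.
  have : a ^+ 2 <= (2 * L * bx) ^+ 2 by exact: sq.
  move/le_trans; apply; rewrite !exprMn -natrX.
  have := ler_wpM2l (mulr_ge0 (ler0n R 4) L2) e1.
  by move/le_trans; apply; rewrite le_eqVlt; apply/orP; left; apply/eqP; ring.
pose C := 16 * L ^+ 4 + 8 * L ^+ 2 + 3.
have L4 : 0 <= L ^+ 4 by rewrite exprn_ge0 ?ltW.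
have C1 : 1 <= C by rewrite /C; lra.
rewrite -/C -[leRHS]ger0_norm -?sqrtr_sqr; last by rewrite mulr_ge0//; lra.
apply: ler_wsqrtr; rewrite exprMn.
have : C * l ^+ 2 <= C ^+ 2 * l ^+ 2.
  by rewrite ler_wpM2r ?sqr_ge0// expr2 -[leLHS]mulr1 ler_wpM2l//; lra.
apply: le_trans; rewrite /C; lra.
Qed.

(** Carries the bound from the classical derivatives of a test function to its weak ones, whose
    norms agree. *)
Lemma elliptic_bound_eq (L A BX BY P Q Z T a bx by' p q r l : R) :
  A = a -> BY = by' -> Z = r -> BX = bx -> Q = q -> P = p -> T = l ->
  Num.sqrt (a ^+ 2 + by' ^+ 2 + r ^+ 2 + bx ^+ 2 + q ^+ 2 + p ^+ 2) <=
  (16 * L ^+ 4 + 8 * L ^+ 2 + 3) * l ->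
  Num.sqrt (A ^+ 2 + BY ^+ 2 + Z ^+ 2 + BX ^+ 2 + Q ^+ 2 + P ^+ 2) <=
  (16 * L ^+ 4 + 8 * L ^+ 2 + 3) * T.
Proof. by move=> -> -> -> -> -> -> ->. Qed.

Lemma elliptic_limit (C u p d lp lu ld e : R) : 0 < C -> u <= p + d -> p <= C * lp ->
  lp <= lu + ld -> ld <= 2 * d -> d * (2 * C + 1) <= e -> u <= C * lu + e.
Proof.
move=> C0 h1 h2 h3 h4 h5.
have : C * lp <= C * (lu + 2 * d) by rewrite ler_wpM2l//; lra.
lra.
Qed.

End LaplacianArithmetic.

(** * The form a and the H^2 estimate by the Laplacian *)

Section Laplacian.
Variables (R : realType) (Om : set (R * R)).
Hypotheses (oOm : open Om) (bOm : bounded_set Om).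
Implicit Types (u v g w phi eta : R * R -> R) (c : R).

Let sip : semi_inner (L2 Om) (ip Om).
Proof. exact: ip_semi_inner (open_measurable_plane oOm). Qed.

Let sH k : semi_inner (Hk Om k) (hip Om k).
Proof. exact: hip_semi_inner. Qed.

Lemma lap_L2 u : Hk Om 2 u -> L2 Om (lap Om u).
Proof.
move=> hu; apply: (sip_memD sip).
- exact: (@wpd_L2 _ _ 2 2 0 _ hu isT).
- exact: (@wpd_L2 _ _ 2 0 2 _ hu isT).
Qed.

Lemma ip_lapE u w : Hk Om 2 u -> L2 Om w ->
  ip Om (lap Om u) w = ip Om (wpd Om 2 0 u) w + ip Om (wpd Om 0 2 u) w.
Proof.
move=> hu hw.
exact: (sipDl sip (@wpd_L2 _ _ 2 2 0 _ hu isT) (@wpd_L2 _ _ 2 0 2 _ hu isT) hw).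
Qed.

Lemma ip_lap_lin c u v w : Hk Om 2 u -> Hk Om 2 v -> L2 Om w ->
  ip Om (lap Om (c *: u + v)) w = c * ip Om (lap Om u) w + ip Om (lap Om v) w.
Proof.
move=> hu hv hw.
have E1 := @ip_wpd_lin _ _ oOm bOm 2 2 0 c _ _ _ hu hv isT hw.
have E2 := @ip_wpd_lin _ _ oOm bOm 2 0 2 c _ _ _ hu hv isT hw.
exact: lin_combine (ip_lapE (Hk_lin oOm bOm c hu hv) hw) E1 E2 (ip_lapE hu hw) (ip_lapE hv hw).
Qed.

Lemma form_a_semi_inner : semi_inner (Hk Om 2) (form_a Om).
Proof.
split.
- exact: (sip_mem0 (sH 2)).
- exact: Hk_lin.
- by move=> u v hu hv; exact: (sip_sym sip (lap_L2 hu) (lap_L2 hv)).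
- by move=> c u v w hu hv hw; exact: ip_lap_lin hu hv (lap_L2 hw).
- by move=> u hu; exact: (sip_ge0 sip (lap_L2 hu)).
Qed.

Lemma snorm_form_a u : snorm (form_a Om) u = L2norm Om (lap Om u).
Proof. by rewrite -snorm_ip. Qed.

Lemma lap_norm_le u : Hk Om 2 u -> L2norm Om (lap Om u) <= 2 * Hk_norm Om 2 u.
Proof.
move=> hu.
have := snormD sip (@wpd_L2 _ _ 2 2 0 _ hu isT) (@wpd_L2 _ _ 2 0 2 _ hu isT).
rewrite snorm_ip => /le_trans; apply; apply: le_add2.
- exact: (@L2norm_wpd_le _ _ 2 2 0 _ hu isT).
- exact: (@L2norm_wpd_le _ _ 2 0 2 _ hu isT).
Qed.

Definition plap phi : R * R -> R := pd 2 0 phi + pd 0 2 phi.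

Lemma test_plap phi : test_function Om phi -> test_function Om (plap phi).
Proof.
move=> tp; rewrite /plap -[pd 2 0 phi]scale1r; apply: test_lin; exact: test_pd.
Qed.

Lemma lap_test phi : test_function Om phi -> L2norm Om (lap Om phi - plap phi) = 0.
Proof.
move=> tp; apply/eqP; rewrite eq_le L2norm_ge0 andbT.
have l1 := @wpd_L2 _ _ 2 2 0 _ (test_Hk oOm bOm 2 tp) isT.
have l2 := @wpd_L2 _ _ 2 0 2 _ (test_Hk oOm bOm 2 tp) isT.
have l3 := test_L2 oOm bOm (test_pd 2 0 tp).
have l4 := test_L2 oOm bOm (test_pd 0 2 tp).
have -> : lap Om phi - plap phi =
    (wpd Om 2 0 phi - pd 2 0 phi) + (wpd Om 0 2 phi - pd 0 2 phi).
  by rewrite /lap /plap opprD addrACA.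
have T := snormD sip (sip_memB sip l1 l3) (sip_memB sip l2 l4).
by rewrite snorm_ip in T; exact: le0_add2 T (wpd_test oOm bOm 2 0 tp) (wpd_test oOm bOm 0 2 tp).
Qed.

Lemma L2norm_lap_test phi : test_function Om phi ->
  L2norm Om (lap Om phi) = L2norm Om (plap phi).
Proof.
move=> tp; apply: (L2norm_congr oOm _ _ (lap_test tp)).
- exact/lap_L2/test_Hk.
- exact/test_L2/test_plap.
Qed.

(** Both Laplacians are moved onto phi, so for a fixed test function the form is continuous in u for
    the L2 norm alone. This lets H^1 convergence act on a quantity of second order. *)
Lemma form_a_test u phi : Hk Om 2 u -> test_function Om phi ->
  form_a Om u phi = ip Om u (plap (plap phi)).
Proof.
move=> hu tp; have hp := test_Hk oOm bOm 2 tp; have tl := test_plap tp.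
have hl := test_L2 oOm bOm tl.
have E : form_a Om u phi = ip Om (lap Om u) (plap phi).
  apply: etrans (sip_sym sip (lap_L2 hu) (lap_L2 hp)) _.
  apply: etrans (sip_sym sip hl (lap_L2 hu)).
  exact: (ip_L2normB0 oOm (lap_L2 hp) hl (lap_L2 hu) (lap_test tp)).
have [_ w1] := @wpdP _ _ 2 2 0 _ hu isT; have [_ w2] := @wpdP _ _ 2 0 2 _ hu isT.
have hu2 := Hk_L2 hu.
have l3 := test_L2 oOm bOm (test_pd 2 0 tl); have l4 := test_L2 oOm bOm (test_pd 0 2 tl).
have e1 := w1 _ tl; have e2 := w2 _ tl.
rewrite sqrrN expr1n mul1r in e1; rewrite sqrrN expr1n mul1r in e2.
apply: etrans E _.
exact: eq_add_trans (ip_lapE hu hl) e1 e2 (sipDr sip l3 l4 hu2).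
Qed.

Lemma L2norm_plap_sqr phi : test_function Om phi ->
  L2norm Om (plap phi) ^+ 2 = L2norm Om (pd 2 0 phi) ^+ 2 +
    2 * L2norm Om (pd 1 1 phi) ^+ 2 + L2norm Om (pd 0 2 phi) ^+ 2.
Proof.
move=> tp; have l1 := test_L2 oOm bOm (test_pd 2 0 tp).
have l2 := test_L2 oOm bOm (test_pd 0 2 tp).
have l3 := test_L2 oOm bOm (test_pd 1 1 tp).
have e1 := L2norm_sqr oOm l1; have e2 := L2norm_sqr oOm l2.
exact: sqr_add_trans (L2norm_sqr oOm (test_L2 oOm bOm (test_plap tp)))
  (sip_sqrD sip l1 l2) e1 e2 (ip_pd_xx_yy oOm bOm tp) (L2norm_sqr oOm l3).
Qed.

(** For test functions |lap phi|^2 is a sum of squares of all second derivatives, and the Poincare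
    inequality recovers the lower orders; density extends the bound to H^2_0. *)
Lemma elliptic : exists2 C : R, 0 < C & forall u, Hk0 Om 2 u ->
  Hk_norm Om 2 u <= C * L2norm Om (lap Om u).
Proof.
have [L L0 OL] := bounded_sub_square bOm.
pose C := 16 * L ^+ 4 + 8 * L ^+ 2 + 3.
have C0 : 0 < C by rewrite ltr_wpDl// addr_ge0// mulr_ge0// exprn_ge0// ltW.
have P phi : test_function Om phi -> Hk_norm Om 2 phi <= C * L2norm Om (lap Om phi).
  move=> tp; rewrite Hk_norm2E.
  apply: (elliptic_bound_eq (L2norm_wpd_test oOm bOm 0 0 tp) (L2norm_wpd_test oOm bOm 0 1 tp)
    (L2norm_wpd_test oOm bOm 0 2 tp) (L2norm_wpd_test oOm bOm 1 0 tp)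
    (L2norm_wpd_test oOm bOm 1 1 tp) (L2norm_wpd_test oOm bOm 2 0 tp) (L2norm_lap_test tp)).
  have [h1 h2 h3] := sqr_polar (L2norm_plap_sqr tp) (sqr_ge0 _) (sqr_ge0 _) (sqr_ge0 _).
  have Q1 := poincare_test oOm bOm OL L0 tp.
  have Q2 := poincare_test oOm bOm OL L0 (test_pd 1 0 tp).
  have Q3 := poincare_test oOm bOm OL L0 (test_pd 0 1 tp).
  rewrite -pd20E in Q2; rewrite -pd11E in Q3; rewrite -pd10E in Q1.
  by apply: (elliptic_bound L0 _ _ _ _ _ _ h1 h2 h3 Q1 Q2 Q3); exact: L2norm_ge0.
exists C => // u hu; have hu2 := Hk0_Hk hu.
apply/ler_addgt0Pr => e e0.
have d0 : 0 < e / (2 * C + 1) by rewrite divr_gt0// addr_gt0// mulr_gt0.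
have [phi tp hp] := Hk0_approx hu d0.
have hf := test_Hk oOm bOm 2 tp; have hfu := sip_memB (sH 2) hf hu2.
have h1 : Hk_norm Om 2 u <= Hk_norm Om 2 phi + Hk_norm Om 2 (phi - u).
  have := snormB (sH 2) hf hfu.
  by rewrite subKr (snorm_hip oOm hu2) (snorm_hip oOm hf) (snorm_hip oOm hfu).
have h2 : L2norm Om (lap Om phi) <= L2norm Om (lap Om u) + L2norm Om (lap Om (phi - u)).
  have := snormD form_a_semi_inner hu2 hfu.
  by rewrite addrC subrK !snorm_form_a.
have h5 : Hk_norm Om 2 (phi - u) * (2 * C + 1) <= e.
  by rewrite -ler_pdivlMr ?ltW// addr_gt0// mulr_gt0.
exact: elliptic_limit C0 h1 (P _ tp) h2 (lap_norm_le hfu) h5.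
Qed.

End Laplacian.

(** * Backward difference quotients and Fatou's lemma *)

Lemma ae_imply d (T : ringOfSetsType d) (R : realFieldType) (mu : {measure set T -> \bar R})
    (P Q : T -> Prop) : (forall x, P x -> Q x) ->
  {ae mu, forall x, P x} -> {ae mu, forall x, Q x}.
Proof. exact: (@filterS _ _ (ae_filter_ringOfSetsType mu)). Qed.

Lemma ae_imply2 d (T : ringOfSetsType d) (R : realFieldType) (mu : {measure set T -> \bar R})
    (P P' Q : T -> Prop) : (forall x, P x -> P' x -> Q x) ->
  {ae mu, forall x, P x} -> {ae mu, forall x, P' x} -> {ae mu, forall x, Q x}.
Proof. exact: (@filterS2 _ _ (ae_filter_ringOfSetsType mu)). Qed.

Lemma ae_and d (T : ringOfSetsType d) (R : realFieldType) (mu : {measure set T -> \bar R})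
    (P Q : T -> Prop) :
  {ae mu, forall x, P x} -> {ae mu, forall x, Q x} -> {ae mu, forall x, P x /\ Q x}.
Proof. by apply: ae_imply2. Qed.

Section BackwardDifference.
Variable R : realType.
Notation mu := (@lebesgue_measure R).
Implicit Types (W Z k g : R -> R) (a b t : R).

Lemma backward_difference W t (l : R) : is_derive t 1 W l ->
  (W t - W (t - harmonic n)) / harmonic n @[n --> \oo] --> l.
Proof.
move=> [dW <-].
have cv : (fun n => - harmonic n : R) @ \oo --> (0 : R)^'.
  have c0 : (fun n => - harmonic n : R) @ \oo --> (0 : R).
    by rewrite -oppr0; apply: cvgN; exact: cvg_harmonic.
  move=> P hP; have [N _ hN] := c0 _ hP; exists N => // n Nn; apply: (hN n Nn).
  by rewrite /= oppr_eq0 invr_eq0 pnatr_eq0.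
have E (h : R) : h != 0 -> (- h)^-1 *: ((W \o shift t) (- h *: (1 : R)) - W t) =
    (W t - W (t - h)) / h.
  by move=> h0; rewrite /= [_ *: (1 : R)]mulr1 [- h + t]addrC /GRing.scale /=; field.
have := cvg_comp _ _ cv dW; apply: cvg_trans; apply: near_eq_cvg; near=> n.
by rewrite /= -E// invr_eq0 pnatr_eq0.
Unshelve. all: by end_near. Qed.

Lemma integrable_continuous Z a b : continuous Z -> mu.-integrable `[a, b] (EFin \o Z).
Proof.
move=> cZ; apply: continuous_compact_integrable; first exact: segment_compact.
exact: continuous_subspaceT.
Qed.

Lemma continuous_primitive Z a b : continuous Z ->
  exists W, forall t, a < t < b -> is_derive t 1 W (Z t).
Proof.
move=> cZ; exists (fun x => \int[mu]_(t in `[a, x]) Z t)%R => t /andP[at0 tb].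
have [dW W'] := @continuous_FTC1_closed _ Z a t b tb (integrable_continuous a b cZ) at0 (cZ t).
split; first exact: dW.
by rewrite -derive1E; exact: W'.
Qed.

Lemma is_derive_translate W (t h l : R) : is_derive (t - h) 1 W l ->
  is_derive t 1 (fun s => W (s - h)) l.
Proof.
move=> dW.
have d1 : is_derive t 1 (fun s : R => s - h) 1.
  by have := is_deriveB (is_derive_id t 1) (is_derive_cst h t 1); rewrite subr0.
by have := is_derive1_comp (f := W) (g := fun s => s - h) dW d1; rewrite mulr1.
Qed.

Lemma continuous_difference_quotient Z (h : R) :
  continuous Z -> continuous (fun t => (Z t - Z (t - h)) / h).
Proof.
move=> cZ t; apply: cvgMl; apply: cvgB; first exact: cZ.
apply: (@continuous_comp _ _ _ (fun s => s - h) Z); last exact: cZ.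
by apply: cvgB; [exact: cvg_id|exact: cvg_cst].
Qed.

(** If W' = Z, then the mean (W(t) - W(t - h)) / h is a primitive of the difference quotient of
    Z. *)
Lemma integral_backward_difference Z W a b (h : R) : a < b -> 0 < h -> continuous Z ->
  (forall t, a - h <= t <= b -> is_derive t 1 W (Z t)) ->
  (\int[mu]_(t in `[a, b]) ((Z t - Z (t - h)) / h)%:E =
   ((W b - W (b - h)) / h - (W a - W (a - h)) / h)%:E)%E.
Proof.
move=> ab h0 cZ dW.
pose P t := (W t - W (t - h)) / h.
have dP t : a <= t <= b -> is_derive t 1 P ((Z t - Z (t - h)) / h).
  move=> /andP[ta tb].
  have d1 : is_derive t 1 W (Z t) by apply: dW; apply/andP; split; lra.
  have d2 : is_derive t 1 (fun s => W (s - h)) (Z (t - h)).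
    by apply: is_derive_translate; apply: dW; apply/andP; split; lra.
  have := is_deriveZ h^-1 (is_deriveB d1 d2); rewrite [_ *: _]mulrC.
  suff -> : h^-1 \*: (W - (fun s => W (s - h))) = P by [].
  by apply/funext => s; rewrite /P /= !fctE; exact: mulrC.
have cP t : a <= t <= b -> {for t, continuous P}.
  by move=> /dP[dPt _]; exact/differentiable_continuous/derivable1_diffP.
have cq := continuous_difference_quotient (h := h) cZ.
rewrite (@continuous_FTC2 _ _ P)//.
- exact: continuous_subspaceT.
- split => [t||].
  + by rewrite in_itv/= => /andP[t1 t2]; have [] := dP t _; rewrite ?ltW.
  + by apply: cvg_at_right_filter; apply: cP; rewrite lexx ltW.
  + by apply: cvg_at_left_filter; apply: cP; rewrite lexx ltW.
- move=> t; rewrite in_itv/= => /andP[t1 t2]; rewrite derive1E.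
  by have [|_ ->] := dP t _; rewrite ?ltW.
Qed.

Lemma limn_einf_ge (u : (\bar R)^nat) (c : R) :
  (forall e : R, 0 < e -> \forall n \near \oo, ((c - e)%:E <= u n)%E) ->
  (c%:E <= limn_einf u)%E.
Proof.
move=> hu; rewrite limn_einf_lim.
apply/lee_addgt0Pr => e e0.
rewrite -leeBlDr// -EFinB.
have [N _ hN] := hu e e0.
have h1 : ((c - e)%:E <= einfs u N)%E.
  by apply: le_ereal_inf_tmp => _ [m /= Nm <-]; exact: hN.
apply: le_trans h1 _.
have /cvg_lim -> // := @cvg_einfs_sup _ u.
by apply: ereal_sup_ubound; exists N.
Qed.

(** The integrals of the backward quotients of Z converge to Z(b) - Z(a) by continuity alone. Adding
    the integrable [k] makes the quotients nonnegative almost everywhere, so Fatou's lemma bounds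
    the integral of their lower limit, which is at least g + k. Only an inequality results, which is
    all that is wanted. *)
Lemma fatou_growth Z k g a b : a < b -> continuous Z -> (forall t, 0 <= k t) ->
  mu.-integrable `[a, b] (EFin \o k) -> mu.-integrable `[a, b] (EFin \o g) ->
  {ae mu, forall t, a < t -> forall h, 0 < h -> - (h * k t) <= Z t - Z (t - h)} ->
  {ae mu, forall t, a < t -> forall e, 0 < e ->
    \forall n \near \oo, g t - e <= (Z t - Z (t - harmonic n)) / harmonic n} ->
  (\int[mu]_(t in `[a, b]) g t)%R <= Z b - Z a.
Proof.
move=> ab cZ k0 ik ig hlow hlim.
have mI : measurable (`[a, b]%classic : set (measurableTypeR R)) by exact: measurable_itv.
pose q (n : nat) t := (Z t - Z (t - harmonic n)) / harmonic n.
(* The maximum with 0 gives nonnegativity at every point, while [hlow] gives it only almost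
   everywhere. *)
pose f (n : nat) t : \bar R := (Num.max 0 (q n t + k t))%:E.
have h0 n : 0 < harmonic n :> R by rewrite invr_gt0 ltr0n.
have mk : measurable_fun `[a, b] k by apply/measurable_EFinP; exact: measurable_int ik.
have mg : measurable_fun `[a, b] g by apply/measurable_EFinP; exact: measurable_int ig.
have cq n : continuous (q n) by exact: continuous_difference_quotient.
have mq n : measurable_fun `[a, b] (q n).
  by apply: measurable_funS (continuous_measurable_fun (cq n)).
have mqk n : measurable_fun `[a, b] (fun t => q n t + k t) by exact: measurable_funD.
have mf n : measurable_fun `[a, b] (f n).
  by apply/measurable_EFinP; apply: measurable_maxr => //; exact: measurable_cst.
have f0 n t : `[a, b]%classic t -> (0 <= f n t)%E by rewrite lee_fin le_max lexx.
have iq n : mu.-integrable `[a, b] (EFin \o q n) by exact: integrable_continuous.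
(* The hypotheses speak of t > a, whereas the integrals are over the closed interval. *)
have nea : {ae mu, forall t, t != a}.
  exists [set a]; split => //; first exact: lebesgue_measure_set1.
  by move=> t /= /negP; rewrite negbK => /eqP.
(* The primitive must be differentiable on [a - harmonic n, b]; as [harmonic n] is at most 1, the
   open interval ]a - 2, b + 1[ contains it for all n. *)
have [W dW] := continuous_primitive (a - 2) (b + 1) cZ.
have h1 n : harmonic n <= 1 :> R by rewrite invf_le1 ?ltr0n// ler1n.
have hW n t : a - harmonic n <= t <= b -> is_derive t 1 W (Z t).
  by move=> /andP[t1 t2]; apply: dW; apply/andP; have := h1 n; split; lra.
have Wb n := integral_backward_difference ab (h0 n) cZ (hW n).
have intf n : (\int[mu]_(t in `[a, b]) f n t =
    ((W b - W (b - harmonic n)) / harmonic n - (W a - W (a - harmonic n)) / harmonic n)%:E +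
     \int[mu]_(t in `[a, b]) (k t)%:E)%E.
  rewrite -Wb; apply: etrans (integralD mI (iq n) ik); apply: ae_eq_integral => //.
  - exact: mf.
  - by apply: emeasurable_funD; [exact: measurable_int (iq n)|exact: measurable_int ik].
  - apply: ae_imply2 hlow nea => t hl ta; rewrite /= in_itv/= => /andP[t1 t2].
    have {}t1 : a < t by rewrite lt_neqAle eq_sym ta.
    have qk : 0 <= q n t + k t.
      by rewrite -lerBlDr sub0r /q ler_pdivlMr// mulNr mulrC; exact: hl.
    by rewrite /f max_r.
have cvf : (fun n => \int[mu]_(t in `[a, b]) f n t)%E @ \oo -->
    ((Z b - Z a)%:E + \int[mu]_(t in `[a, b]) (k t)%:E)%E.
  rewrite (_ : (fun n => _) = (fun n => ((W b - W (b - harmonic n)) / harmonic n -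
     (W a - W (a - harmonic n)) / harmonic n)%:E + \int[mu]_(t in `[a, b]) (k t)%:E)%E);
    last by apply/funext.
  have kfin : (\int[mu]_(t in `[a, b]) (k t)%:E \is a fin_num)%E.
    by have := integrable_fin_num mI ik.
  apply: cvgeD; [by rewrite fin_num_adde_defl| |exact: cvg_cst].
  apply/cvg_EFin; first by near=> n.
  by apply: cvgB; apply: backward_difference; apply: dW; apply/andP; split; lra.
have := fatou mu mI mf f0; rewrite (cvg_limn_einf_sup cvf).1 => hfatou.
have kfin : (\int[mu]_(t in `[a, b]) (k t)%:E \is a fin_num)%E.
  by have := integrable_fin_num mI ik.
have gfin : (\int[mu]_(t in `[a, b]) (g t)%:E \is a fin_num)%E.
  by have := integrable_fin_num mI ig.
rewrite -lee_fin /Rintegral fineK// -(leeD2rE _ _ kfin); apply: le_trans hfatou.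
rewrite -integralD//.
have igk : mu.-integrable `[a, b] (fun t => (g t)%:E + (k t)%:E)%E by exact: integrableD.
apply: (@le_trans _ _ (\int[mu]_(t in `[a, b]) (Num.max 0 (g t + k t))%:E)%E).
  apply: le_integral => //.
    apply: eq_integrable (integrable_funepos mI igk) => // t _.
    by rewrite funeposE -EFinD EFin_max maxC.
  by move=> t _; rewrite -EFinD lee_fin le_max lexx orbT.
apply: ae_ge0_le_integral => //.
- by move=> t _; rewrite lee_fin le_max lexx.
- apply/measurable_EFinP; apply: measurable_maxr; first exact: measurable_cst.
  exact: measurable_funD.
- move=> t tab; apply: limn_einf_ge => e e0; near=> n.
  by apply: le_trans (f0 n t tab); rewrite lee_fin; lra.
- rewrite /limn_einf; apply: measurableT_comp => //.
  apply: measurable_fun_limn_esup => n; apply: measurableT_comp (mf n); exact: oppe_measurable.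
- apply: ae_imply2 hlim nea => t hl ta; rewrite /= in_itv/= => /andP[t1 t2].
  have {}t1 : a < t by rewrite lt_neqAle eq_sym ta.
  apply: limn_einf_ge => e e0; have := hl t1 e e0; apply: filterS => n hn.
  rewrite /f lee_fin; move: hn; rewrite -/(q n t) => hn.
  by rewrite /Num.max; do 2 case: ifPn => //; rewrite -?leNgt; lra.
Unshelve. all: by end_near. Qed.

End BackwardDifference.

(** * Absorption from an integral inequality *)

Section Absorption.
Variable R : realType.
Notation mu := (@lebesgue_measure R).

(** Where E >= 2 K / lam, the integrand K - lam E is at most - K. The factor 2 buys a definite rate
    of decrease, hence a finite entry time. *)
Lemma decrease_above (E : R -> R) (K lam a b : R) : 0 < K -> 0 < lam -> a < b -> continuous E ->
  E b - E a <= (\int[mu]_(t in `[a, b]) (K - lam * E t))%R ->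
  (forall t, a < t <= b -> 2 * K / lam <= E t) -> E b <= E a - K * (b - a).
Proof.
move=> K0 lam0 ab cE hE hM.
have cf : continuous (fun t => K - lam * E t).
  by move=> t; apply: cvgB; [exact: cvg_cst|apply: cvgMr; exact: cE].
have ic : mu.-integrable `[a, b] (EFin \o (fun t => K - lam * E t)).
  exact: integrable_continuous.
have ik : mu.-integrable `[a, b] (EFin \o (cst (- K) : R -> R)).
  by apply: integrable_continuous => t; exact: cvg_cst.
(* The lower bound on E excludes the left endpoint, so that a may be a time at which E is not above
   the level. *)
have sub : `]a, b] `<=` (`[a, b] : set R) by apply: subset_itvr; rewrite bnd_simp.
have : (\int[mu]_(t in `[a, b]) (K - lam * E t) <= \int[mu]_(t in `]a, b]) (- K))%R.
  rewrite -Rintegral_itv_obnd_cbnd; last first.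
    by apply: integrableS ic.
  apply: le_Rintegral => //.
  - by apply: integrableS ic.
  - by apply: integrableS ik.
  - move=> t; rewrite /= in_itv/= => /hM; rewrite ler_pdivrMr// mulrC; lra.
have mI : lebesgue_measure (`]a, b]%classic : set R) = (b - a)%:E.
  by rewrite lebesgue_measure_itv/= lte_fin ab EFinB.
rewrite Rintegral_cst; last exact: measurable_itv.
rewrite [X in fine X]mI /=; lra.
Qed.

(** If E stayed above M on all of [0, t], it would have fallen by K t >= rho + K, below 0. Otherwise
    take the last time c <= t with E(c) <= M: after c the energy only decreases, so it cannot exceed
    M at t. *)
Lemma absorbing_level (E : R -> R) (K M rho : R) : 0 < K -> continuous E ->
  (forall t, 0 <= E t) -> E 0 <= rho ->
  (forall a b, 0 <= a -> a < b -> (forall t, a < t <= b -> M <= E t) ->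
    E b <= E a - K * (b - a)) ->
  forall t, rho / K + 1 <= t -> E t <= M.
Proof.
move=> K0 cE E0 Erho dec t Tt.
have rho0 : 0 <= rho by exact: le_trans (E0 0) Erho.
have rK : 0 <= rho / K by rewrite divr_ge0// ltW.
rewrite leNgt; apply/negP => tM.
pose S := [set r | 0 <= r <= t /\ E r <= M].
have [S0|Ss] := pselect (S !=set0); last first.
  have t0 : 0 < t by lra.
  have h r : 0 < r <= t -> M <= E r.
    move=> /andP[r0 rt]; rewrite leNgt; apply/negP => Er.
    by apply: Ss; exists r; split; rewrite ?(ltW r0)// ltW.
  have h1 := E0 t; have := dec 0 t (lexx _) t0 h; rewrite subr0 => h2.
  have : K * (rho / K + 1) <= K * t by rewrite ler_pM2l.
  by rewrite mulrDr mulrCA divff ?gt_eqF// !mulr1; lra.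
have hS : has_sup S by split => //; exists t => r [/andP[]].
pose c := sup S.
have ct : c <= t by apply: ge_sup => // r [/andP[]].
have c0 : 0 <= c.
  have [r [/andP[r0 rt] rM]] := S0.
  by apply: (le_trans r0); apply: ub_le_sup; [case: hS|split; rewrite ?r0].
have Ec : E c <= M.
  rewrite leNgt; apply/negP => cM.
  have /cvgrPdist_lt/(_ (E c - M)) : E @ c --> E c by exact: cE.
  rewrite subr_gt0 => /(_ cM) /nbhs_ballP[d /= d0 hd].
  have [r [/andP[r0 rt] rM] cr] := sup_adherent d0 hS.
  have rc : r <= c by apply: ub_le_sup; [case: hS|split; rewrite ?r0].
  have : `|E c - E r| < E c - M.
    by apply: hd; rewrite /ball /= ger0_norm; rewrite /c in rc cr *; lra.
  rewrite ltr_norml => /andP[]; lra.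
have {}ct : c < t by rewrite lt_neqAle ct andbT; apply/eqP => ct'; move: Ec; rewrite ct'; lra.
have h r : c < r <= t -> M <= E r.
  move=> /andP[cr rt]; rewrite leNgt; apply/negP => Er.
  have : r <= c.
    by apply: ub_le_sup; [case: hS|split; rewrite ?rt ?andbT; [exact: le_trans c0 (ltW cr)|exact: ltW]].
  by rewrite leNgt cr.
have := dec c t c0 ct h.
have : 0 < K * (t - c) by rewrite mulr_gt0// subr_gt0.
lra.
Qed.

End Absorption.

(** * Primitives on the half-line and Lebesgue differentiation *)

Section Primitives.
Variable R : realType.
Notation mu := (@lebesgue_measure R).
Implicit Types (f : R -> R) (s t : R).

(** For t <= 0 the value is 0, so the primitive is defined and continuous on the whole line and
    backward quotients never leave its domain. *)
Definition primitive f t : R := (\int[mu]_(r in `[0, t]) f r)%R.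

Lemma primitive_le0 f t : t <= 0 -> primitive f t = 0.
Proof.
rewrite le_eqVlt => /predU1P[->|t0]; first by rewrite /primitive set_itv1 Rintegral_set1.
by rewrite /primitive set_itv_ge ?Rintegral_set0// -leNgt bnd_simp.
Qed.

Lemma primitiveB f s t : mu.-integrable `[0, t] (EFin \o f) -> 0 <= s -> s <= t ->
  primitive f t - primitive f s = (\int[mu]_(r in `[s, t]) f r)%R.
Proof.
move=> it s0 st; rewrite /primitive Rintegral_itvB ?bnd_simp//.
rewrite Rintegral_itv_obnd_cbnd//; apply: integrableS it => //.
by apply: subset_itvr; rewrite bnd_simp.
Qed.

Lemma continuous_primitive0 f : (forall T, 0 < T -> mu.-integrable `[0, T] (EFin \o f)) ->
  continuous (primitive f).
Proof.
move=> fi t; change (primitive f @ t --> primitive f t); have [t0|t0|->] := ltgtP t 0.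
- have -> : primitive f t = 0 by rewrite primitive_le0// ltW.
  apply: cvg_near_cst; near=> y.
  by rewrite primitive_le0// ltW//; near: y; exact: lt_nbhsl.
- have t1 : 0 < t + 1 by rewrite addr_gt0.
  have := parameterized_integral_continuous (ltW t1) (fi _ t1).
  move=> /(continuous_within_itvP _ t1)[+ _ _]; apply.
  by rewrite in_itv/= t0 ltrDl ltr01.
- apply/left_right_continuousP; split.
    have -> : primitive f 0 = 0 by rewrite primitive_le0.
    apply: cvg_near_cst; near=> y.
    by rewrite primitive_le0//; near: y; exact: nbhs_left_le.
  have := parameterized_integral_continuous ler01 (fi _ ltr01).
  by move=> /(continuous_within_itvP _ ltr01)[].
Unshelve. all: by end_near. Qed.

(** Since f is integrable only on bounded intervals, Lebesgue differentiation is applied to the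
    truncations to [0, k + 1]; countably many null sets are discarded. *)
Lemma ae_backward_primitive f : (forall T, 0 < T -> mu.-integrable `[0, T] (EFin \o f)) ->
  {ae mu, forall t, 0 < t ->
    (primitive f t - primitive f (t - harmonic n)) / harmonic n @[n --> \oo] --> f t}.
Proof.
move=> fi.
pose g (k : nat) := f \_ `[0, k.+1%:R]%classic.
have mI (k : nat) : measurable (`[0, k.+1%:R]%classic : set R) by exact: measurable_itv.
have ig k y : mu.-integrable `[0, y] (EFin \o g k).
  have : mu.-integrable setT (EFin \o g k).
    by rewrite /g -restrict_EFin -integrable_mkcond//; apply: fi; rewrite ltr0n.
  by apply: integrableS => //; exact: measurable_itv.
have /ae_foralln : forall k, {ae mu, forall t, 0 < t -> is_derive t 1 (primitive (g k)) (g k t)}.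
  move=> k; have := @FTC1 R (g k) (BLeft 0) (ig k) (integrable_locally (mI k) (fi k.+1%:R (ltr0Sn _ k))).
  apply: ae_imply => t ht t0; have [d1 d2] := ht t0.
  by split; [exact: d1|rewrite -derive1E; exact: d2].
apply: ae_imply => t ht t0.
have [k tk] : exists k : nat, t < k.+1%:R.
  by exists (Num.bound t); rewrite (lt_le_trans (archi_boundP (ltW t0)))// ler_nat.
have gt y : 0 <= y <= k.+1%:R -> g k y = f y.
  by move=> hy; rewrite /g patchE ifT// inE /= in_itv/=.
have gP y : y <= k.+1%:R -> primitive (g k) y = primitive f y.
  move=> yk; apply: eq_Rintegral => r; rewrite inE /= in_itv/= => /andP[r0 ry].
  by rewrite gt// r0 (le_trans ry).
have gtt : g k t = f t by apply: gt; rewrite !ltW.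
have dP : is_derive t 1 (primitive f) (f t).
  rewrite -gtt; apply: near_is_derive (ht k t0).
  by near=> y; apply: gP; apply: ltW; near: y; exact: lt_nbhsl.
exact: backward_difference dP.
Unshelve. all: by end_near. Qed.

End Primitives.

(** * Real arithmetic for the energy inequality *)

Section EnergyArithmetic.
Variable R : realFieldType.
Implicit Types (m n x : R).

(** A bound linear in n, the norm of the test function: it becomes small with the test function, as
    closedness of the admissible set requires. *)
Lemma mul_le_1sqr m n : 0 <= n -> m * n <= n + n * m ^+ 2.
Proof.
move=> n0; have : m <= 1 + m ^+ 2 by have := sqr_ge0 (m - 2^-1); rewrite !expr2; lra.
by move=> h; have := ler_wpM2r n0 h; lra.
Qed.

(** Young's inequality with weight 1/2 on m^2, so that twice the integral is matched by one copy of
    Phi. *)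
Lemma mul_le_half_sqr m n : m * n <= 2^-1 * n ^+ 2 + 2^-1 * m ^+ 2.
Proof. have := sqr_ge0 (m - n); rewrite !expr2; lra. Qed.

Lemma norm_sub_le (a b d : R) : b <= a + d -> a <= b + d -> `|a - b| <= d.
Proof. by move=> ? ?; rewrite ler_norml; apply/andP; split; lra. Qed.

Lemma backward_le (et es pt ps n2 d h I : R) : et - es <= 2 * I ->
  `|I| <= 2^-1 * n2 * d + 2^-1 * (pt - ps) -> d <= h -> 0 <= n2 ->
  - (h * n2) <= (pt - et) - (ps - es).
Proof.
move=> h1 h2 h3 n0; have h4 := le_trans (ler_norm I) h2.
have : d * n2 <= h * n2 by rewrite ler_wpM2r.
lra.
Qed.

Lemma quotient_lin (c a b a1 a2 b1 b2 h : R) : a = c * a1 + a2 -> b = c * b1 + b2 ->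
  (a - b) / h = c * ((a1 - b1) / h) + (a2 - b2) / h.
Proof. by move=> -> ->; rewrite mulrA -mulrDl; congr (_ / _); ring. Qed.

Lemma quotient_le (x n p h t : R) : 0 < h -> `|x| <= n * (t - (t - h)) + n * p ->
  `|x / h| <= n * (1 + p / h).
Proof.
move=> h0; rewrite normrM normfV (gtr0_norm h0) ler_pdivrMr// => /le_trans; apply.
rewrite le_eqVlt; apply/orP; left; apply/eqP; field; exact: lt0r_neq0.
Qed.

(** Here n is the norm of chi - w; gd and d1 are the functional and the quotient at chi - w, g and
    d2 those at w, and p is the quotient of Phi. As p <= m^2 + 1, the part at chi - w costs at most
    n (|m| + m^2 + 2). *)
Lemma closed_bound (n e gd g d1 d2 m p : R) : 0 <= n -> n <= e / 2 / (`|m| + m ^+ 2 + 3) ->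
  `|gd| <= m * n -> `|d1| <= n * (1 + p) -> `|g - d2| <= e / 2 -> `|m ^+ 2 - p| <= 1 ->
  0 < e -> `|gd + g - (d1 + d2)| <= e.
Proof.
move=> n0 nC hgd hd1 h1 h2 e0.
have c0 : 0 < `|m| + m ^+ 2 + 3 by have := normr_ge0 m; have := sqr_ge0 m; lra.
rewrite ler_pdivlMr// in nC.
have p1 : n * (1 + p) <= n * (2 + m ^+ 2).
  by rewrite ler_wpM2l//; move: h2; rewrite ler_norml => /andP[]; lra.
have p2 : m * n <= n * `|m| by rewrite mulrC ler_wpM2l// ler_norm.
have -> : gd + g - (d1 + d2) = gd - d1 + (g - d2) by ring.
apply: (le_trans (ler_normD _ _)); have := ler_normB gd d1.
lra.
Qed.

(** With d = psi(q) - psi(t), the form a(d, v) splits as a(d, phi) - a(d, phi - v). The first term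
    is small because d is small in L2, the second because phi is close to v while d stays bounded in
    H^2. *)
Lemma weak_bound (C L e a at' aq fd g1 n1 l1 l2 k1 k2 gr nq nt N : R) :
  0 < C -> 0 <= L -> 0 <= e -> a = aq - at' -> g1 = fd - a ->
  `|fd| <= n1 * L -> `|g1| <= l1 * l2 -> l1 <= 2 * k1 -> l2 <= 2 * k2 -> n1 <= C * gr ->
  k1 <= nq + nt -> nq <= N -> k2 <= e / 2 / (4 * (nt + `|N| + 1)) ->
  gr <= e / 2 / (C * L + 1) -> 0 <= k1 -> 0 <= k2 -> 0 <= nt -> 0 <= l2 ->
  `|at' - aq| <= e.
Proof.
move=> C0 L0 e0 -> hg b1 b2 b3 b4 b5 b6 qN hk2 hgr k10 k20 nt0 l20.
have D0 : 0 < 4 * (nt + `|N| + 1) by have := normr_ge0 N; lra.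
rewrite ler_pdivlMr// in hk2.
have CL0 : 0 < C * L + 1 by rewrite ltr_wpDl// mulr_ge0// ltW.
rewrite ler_pdivlMr// in hgr.
have s1 : n1 * L <= C * gr * L by rewrite ler_wpM2r.
have s2 : n1 * L <= e / 2.
  have [gr0|gr0] := leP 0 gr; first by lra.
  have : C * gr * L <= 0 by rewrite mulr_le0_ge0// mulr_ge0_le0 ?ltW.
  lra.
have s3 : l1 * l2 <= 2 * k1 * (2 * k2).
  by apply: le_trans (ler_wpM2r l20 b3) _; rewrite ler_wpM2l//; lra.
have s4 : k1 * k2 <= (nt + `|N| + 1) * k2.
  by rewrite ler_wpM2r//; have := ler_norm N; lra.
have -> : at' - aq = g1 - fd by rewrite hg; ring.
apply: le_trans (ler_normB _ _) _; lra.
Qed.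

Lemma bracket_dist (p q r t h : R) : 0 < h -> t - h / 2 < p -> r < t + h / 2 ->
  p < q -> q < r -> p < t -> t < r -> `|t - q| < h.
Proof. by move=> ? ? ? ? ? ? ?; rewrite ltr_norml; apply/andP; split; lra. Qed.

(** The quotient of [ip0] counts twice, so two errors of e / 4 add up to 3 e / 4. *)
Lemma liminf_bound (m2 g pt ps et es h K lE e ip0 : R) : 0 < h ->
  `|m2 - (pt - ps) / h| <= e / 4 -> `|g - ip0 / h| <= e / 4 -> et - es <= 2 * ip0 ->
  2 * g <= K - lE ->
  m2 - (K - lE) - e <= ((pt - et) - (ps - es)) / h.
Proof.
move=> h0 h1; have e0 := le_trans (normr_ge0 _) h1; move: h1.
rewrite !ler_norml => /andP[_ a1] /andP[a2 _] a3 a4.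
have a5 : (et - es) / h <= 2 * (ip0 / h) by rewrite mulrA ler_wpM2r// invr_ge0 ltW.
have -> : ((pt - et) - (ps - es)) / h = (pt - ps) / h - (et - es) / h by rewrite -mulrBl; congr (_ / _); ring.
lra.
Qed.

Lemma sqr_le_sqr (a b : R) : 0 <= a -> a <= b -> a ^+ 2 <= b ^+ 2.
Proof. by move=> a0 ab; rewrite ler_sqr ?nnegrE// (le_trans a0). Qed.

Lemma energy_increment (a b c d : R) : 0 <= d -> d = a - 2 * b + c -> a - c <= 2 * (a - b).
Proof. by move=> d0 dE; rewrite dE in d0; lra. Qed.

End EnergyArithmetic.

(** * The energy inequality *)

Section EnergyBalance.
Variables (R : realType) (Om : set (R * R)).
Hypotheses (oOm : open Om) (bOm : bounded_set Om).
Notation mu := (@lebesgue_measure R).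
Variables (psi : R -> R * R -> R) (G : R -> (R * R -> R) -> R) (m : R -> R).
Implicit Types (chi : R * R -> R) (s t T : R).
Hypothesis psi_H10 : forall t, 0 <= t -> Hk0 Om 1 (psi t).
Hypothesis psi_cont : forall t, 0 <= t ->
  grad_norm Om (psi s - psi t) @[s --> within `[0, +oo[ (nbhs t)] --> (0 : R).
Hypothesis meas_G : forall chi, Hk0 Om 2 chi ->
  measurable_fun (`[0, +oo[ : set (measurableTypeR R)) (G^~ chi).
Hypothesis int_m : forall T, 0 < T -> mu.-integrable `[0, T] (fun t => (m t ^+ 2)%:E).
Hypothesis G_le : {ae mu, forall t, 0 < t ->
  forall chi, Hk0 Om 2 chi -> `|G t chi| <= m t * Hk_norm Om 2 chi}.
Hypothesis G_int : forall s t chi, 0 <= s -> s <= t -> Hk0 Om 2 chi ->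
  ip_grad Om (psi t) chi - ip_grad Om (psi s) chi = (\int[mu]_(r in `[s, t]) G r chi)%R.

Let sg : semi_inner (Hk Om 1) (ip_grad Om). Proof. exact: ip_grad_semi_inner. Qed.

(** Frozen at its initial value for negative times, so that it is continuous on the whole line. *)
Definition energy t : R := grad_norm Om (psi (Num.max t 0)) ^+ 2.

Definition Phi : R -> R := primitive (fun t => m t ^+ 2).

Let psi_H1 t : 0 <= t -> Hk Om 1 (psi t).
Proof. by move=> t0; exact/Hk0_Hk/psi_H10. Qed.

Lemma Phi_continuous : continuous Phi.
Proof. exact: continuous_primitive0. Qed.

Lemma cvg_max0 t : Num.max s 0 @[s --> t] --> within `[0, +oo[ (nbhs (Num.max t 0)).
Proof.
have c : continuous (fun s : R => Num.max s 0).
  by move=> s; apply: continuous_max; [exact: cvg_id|exact: cvg_cst].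
move=> P hP; have : \forall s \near t, `[0, +oo[%classic (Num.max s 0) -> P (Num.max s 0).
  exact: c t _ hP.
rewrite /nbhs /=; apply: filterS => s; apply.
by rewrite /= in_itv/= andbT le_max lexx orbT.
Qed.

Lemma grad_norm_continuous t :
  grad_norm Om (psi (Num.max s 0) - psi (Num.max t 0)) @[s --> t] --> (0 : R).
Proof.
have t0 : 0 <= Num.max t 0 by rewrite le_max lexx orbT.
exact: cvg_comp (@cvg_max0 t) (psi_cont t0).
Qed.

Lemma energy_continuous : continuous energy.
Proof.
move=> t; suff h : grad_norm Om (psi (Num.max s 0)) @[s --> t] --> grad_norm Om (psi (Num.max t 0)).
  by apply: (cvgM h h).
have pos s : 0 <= Num.max s 0 by rewrite le_max lexx orbT.
apply/cvgrPdist_le => e e0.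
have /cvgrPdist_le/(_ e e0) := @grad_norm_continuous t; apply: filterS => s.
rewrite sub0r normrN ger0_norm ?sqrtr_ge0// => /(le_trans _); apply.
have hs := psi_H1 (pos s); have ht := psi_H1 (pos t).
have h1 := snormD sg ht (sip_memB sg hs ht).
have h2 := snormD sg hs (sip_memB sg ht hs).
rewrite addrC subrK (snormBC sg ht hs) snorm_ip_grad in h2.
rewrite addrC subrK snorm_ip_grad in h1.
exact: norm_sub_le h1 h2.
Qed.

Lemma ae_G_le chi (c1 c2 : R) : Hk0 Om 2 chi ->
  (forall x, x * Hk_norm Om 2 chi <= c1 + c2 * x ^+ 2) ->
  {ae mu, forall t, 0 < t -> `|G t chi| <= c1 + c2 * m t ^+ 2}.
Proof.
move=> hchi hc; apply: ae_imply G_le => t h t0.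
exact: le_trans (h t0 _ hchi) (hc _).
Qed.

Let neq0 (a : R) : {ae mu, forall t, t != a}.
Proof.
exists [set a]; split => //; first exact: lebesgue_measure_set1.
by move=> t /= /negP; rewrite negbK => /eqP.
Qed.

(** The constants c1 and c2 are left free because the splitting of m(r) |chi| is needed in two
    forms, one linear and one quadratic in the norm of chi. *)
Lemma integral_G_le chi (c1 c2 s t : R) : Hk0 Om 2 chi -> 0 <= c1 -> 0 <= c2 ->
  (forall x, x * Hk_norm Om 2 chi <= c1 + c2 * x ^+ 2) -> 0 <= s -> s <= t ->
  mu.-integrable `[s, t] (EFin \o G^~ chi) /\
  `|\int[mu]_(r in `[s, t]) G r chi|%R <= c1 * (t - s) + c2 * (Phi t - Phi s).
Proof.
move=> hchi c10 c20 hc s0 st.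
have mI : measurable (`[s, t]%classic : set (measurableTypeR R)) by exact: measurable_itv.
have sub : `[s, t] `<=` (`[0, +oo[ : set R).
  by move=> r /=; rewrite !in_itv/= => /andP[sr _]; rewrite andbT (le_trans s0).
have mG : measurable_fun `[s, t] (G^~ chi).
  by apply: measurable_funS (meas_G hchi) => //; exact: measurable_itv.
have im0 : mu.-integrable `[0, t + 1] (EFin \o (fun r => m r ^+ 2)).
  by apply: int_m; rewrite ltr_wpDl// (le_trans s0).
have im : mu.-integrable `[s, t] (EFin \o (fun r => m r ^+ 2)).
  apply: integrableS im0 => //.
  move=> r /=; rewrite !in_itv/= => /andP[sr rt]; rewrite (le_trans s0)//=.
  by rewrite (le_trans rt)// lerDl.
have ic : mu.-integrable `[s, t] (EFin \o (cst c1 : R -> R)).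
  by apply: integrable_continuous => r; exact: cvg_cst.
have im2 : mu.-integrable `[s, t] (EFin \o (fun r => c2 * m r ^+ 2)).
  by have := integrableZl mI c2 im.
have ib : mu.-integrable `[s, t] (EFin \o (fun r => c1 + c2 * m r ^+ 2)).
  by have := integrableD mI ic im2.
have b0 r : 0 <= c1 + c2 * m r ^+ 2 by rewrite addr_ge0// mulr_ge0// sqr_ge0.
have le_abs : (\int[mu]_(r in `[s, t]) `|(EFin \o G^~ chi) r| <=
    \int[mu]_(r in `[s, t]) (c1 + c2 * m r ^+ 2)%:E)%E.
  apply: ae_ge0_le_integral => //.
  - by do 2 apply: measurableT_comp => //.
  - by move=> r _; rewrite lee_fin b0.
  - exact: measurable_int ib.
  (* The bound on [G] is available only at positive times, and s may be 0. *)
  - apply: ae_imply2 (ae_G_le hchi hc) (neq0 0) => r h r0.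
    rewrite /= in_itv/= => /andP[sr rt]; rewrite lee_fin; apply: h.
    by rewrite lt_neqAle eq_sym r0 (le_trans s0).
have iG : mu.-integrable `[s, t] (EFin \o G^~ chi).
  apply/integrableP; split; first exact/measurable_EFinP.
  apply: le_lt_trans le_abs _.
  by have := integrable_fin_num mI ib; rewrite fin_numElt => /andP[].
split => //.
apply: le_trans (le_normr_Rintegral mI iG) _.
have -> : c1 * (t - s) + c2 * (Phi t - Phi s) =
    (\int[mu]_(r in `[s, t]) (c1 + c2 * m r ^+ 2))%R.
  have -> := RintegralD mI ic im2; have -> := RintegralZl c2 mI im.
  congr (_ + _ * _); last first.
    rewrite /Phi primitiveB//; apply: integrableS im0 => //.
    by apply: subset_itvl; rewrite bnd_simp lerDl.
  have mE : mu (`[s, t]%classic : set R) = (t - s)%:E.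
    move: st; rewrite lebesgue_measure_itv/= lte_fin le_eqVlt => /predU1P[->|st].
      by rewrite ltxx subrr.
    by rewrite st EFinB.
  by rewrite [RHS]Rintegral_cst// [X in fine X]mE.
rewrite /Rintegral; apply: fine_le => //.
- by have := integrable_fin_num mI (integrable_abse iG).
- by have := integrable_fin_num mI ib.
Qed.

Definition dquot (n : nat) t chi : R :=
  (ip_grad Om (psi t) chi - ip_grad Om (psi (t - harmonic n)) chi) / harmonic n.

Let harmonic_gt0 n : 0 < harmonic n :> R. Proof. by rewrite invr_gt0 ltr0n. Qed.

Lemma near_backward_ge0 t : 0 < t -> \forall n \near \oo, 0 <= t - harmonic n.
Proof.
move=> t0; have /cvgrPdist_lt/(_ t t0) := @cvg_harmonic R.
apply: filterS => n; rewrite sub0r normrN ger0_norm; last exact: ltW (harmonic_gt0 n).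
by move=> hn; rewrite subr_ge0 ltW.
Qed.

Let one_sqr chi x : x * Hk_norm Om 2 chi <= Hk_norm Om 2 chi + Hk_norm Om 2 chi * x ^+ 2.
Proof. exact/mul_le_1sqr/Hk_norm_ge0. Qed.

Lemma ae_dquot chi : Hk0 Om 2 chi ->
  {ae mu, forall t, 0 < t -> dquot n t chi @[n --> \oo] --> G t chi}.
Proof.
move=> hchi; have n0 := Hk_norm_ge0 Om 2 chi.
have iG T : 0 < T -> mu.-integrable `[0, T] (EFin \o G^~ chi).
  by move=> T0; have [] := integral_G_le hchi n0 n0 (one_sqr chi) (lexx 0) (ltW T0).
have E t : 0 <= t -> primitive (G^~ chi) t = ip_grad Om (psi t) chi - ip_grad Om (psi 0) chi.
  by move=> t0; rewrite /primitive (G_int (lexx 0) t0 hchi).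
apply: ae_imply (ae_backward_primitive iG) => t ht t0.
apply: cvg_trans (ht t0); apply: near_eq_cvg.
apply: filterS (near_backward_ge0 t0) => n tn.
by rewrite /dquot (E _ (ltW t0)) (E _ tn) opprB addrA subrK.
Qed.

Lemma ae_Phi_dquot : {ae mu, forall t, 0 < t ->
  (Phi t - Phi (t - harmonic n)) / harmonic n @[n --> \oo] --> m t ^+ 2}.
Proof. exact: ae_backward_primitive. Qed.

Lemma energyE t : 0 <= t -> energy t = ip_grad Om (psi t) (psi t).
Proof.
move=> t0; rewrite /energy max_l//; exact: (sqr_snorm sg (psi_H1 t0)).
Qed.

(** The square of |grad (psi(t) - psi(s))| is nonnegative and is discarded. The surviving test
    function sits at the later time. *)
Lemma energy_le s t : 0 <= s -> s <= t ->
  energy t - energy s <= 2 * (ip_grad Om (psi t) (psi t) - ip_grad Om (psi s) (psi t)).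
Proof.
move=> s0 st; have t0 := le_trans s0 st.
have hs := psi_H1 s0; have ht := psi_H1 t0.
rewrite (energyE s0) (energyE t0).
have E := sip_sqrB sg ht hs; rewrite (sip_sym sg ht hs) in E.
exact: energy_increment (sip_ge0 sg (sip_memB sg ht hs)) E.
Qed.

(** Both Phi and the energy are constant on negative times, so t - h may be replaced by its positive
    part, which only shortens the step; Young's inequality then bounds the integral of [G]. *)
Lemma energy_backward_le t h : 0 < t -> 0 < h -> Hk0 Om 2 (psi t) ->
  - (h * Hk_norm Om 2 (psi t) ^+ 2) <=
    (Phi t - energy t) - (Phi (t - h) - energy (t - h)).
Proof.
move=> t0 h0 hV; pose s := Num.max (t - h) 0.
have s0 : 0 <= s by rewrite le_max lexx orbT.
have st : s <= t by rewrite ge_max (ltW t0) andbT gerBl ltW.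
have sh : t - s <= h by rewrite lerBlDl -lerBlDr le_max lexx.
have Es : energy (t - h) = energy s by rewrite /energy -/s (max_l s0).
have Ps : Phi (t - h) = Phi s.
  rewrite /s; case: (leP (t - h) 0) => [th|th]; last by [].
  by rewrite /Phi !primitive_le0.
have h2 : 0 <= 2^-1 :> R by rewrite invr_ge0.
have n2 := sqr_ge0 (Hk_norm Om 2 (psi t)).
have [_ hI] := integral_G_le hV (mulr_ge0 h2 n2) h2
  (fun x => mul_le_half_sqr x (Hk_norm Om 2 (psi t))) s0 st.
have hE := energy_le s0 st; rewrite (G_int s0 st hV) in hE.
by rewrite Es Ps; exact: backward_le hE hI sh n2.
Qed.

Lemma dquot_lin n t c chi eta : 0 <= t -> 0 <= t - harmonic n -> Hk Om 1 chi -> Hk Om 1 eta ->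
  dquot n t (c *: chi + eta) = c * dquot n t chi + dquot n t eta.
Proof.
move=> t0 tn hc he; have ht := psi_H1 t0; have htn := psi_H1 tn.
have hl := Hk_lin oOm bOm c hc he.
have E1 := sipDr sg (sip_memZ sg c hc) he ht; rewrite (sipZr sg c hc ht) in E1.
have E2 := sipDr sg (sip_memZ sg c hc) he htn; rewrite (sipZr sg c hc htn) in E2.
by rewrite /dquot; apply: quotient_lin E1 E2.
Qed.

Lemma dquot_le n t chi : 0 < t -> 0 <= t - harmonic n -> Hk0 Om 2 chi ->
  `|dquot n t chi| <= Hk_norm Om 2 chi * (1 + (Phi t - Phi (t - harmonic n)) / harmonic n).
Proof.
move=> t0 tn hchi; have n0 := Hk_norm_ge0 Om 2 chi.
have st : t - harmonic n <= t by rewrite gerBl ltW.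
have [_ hI] := integral_G_le hchi n0 n0 (one_sqr chi) tn st.
rewrite -(G_int tn st hchi) in hI.
rewrite /dquot; exact: quotient_le (harmonic_gt0 n) hI.
Qed.

(** At a fixed t the quotients are bounded by |chi| times 1 plus the quotient of Phi, which
    converges. This equicontinuity lets the convergence pass to limits in the H^2 norm. *)
Lemma dquot_closed t chi : 0 < t -> Hkdual Om 2 (G t) ->
  (forall eta, Hk0 Om 2 eta -> `|G t eta| <= m t * Hk_norm Om 2 eta) ->
  (Phi t - Phi (t - harmonic n)) / harmonic n @[n --> \oo] --> m t ^+ 2 ->
  Hk0 Om 2 chi ->
  (forall e : R, 0 < e -> exists w, [/\ Hk0 Om 2 w, Hk_norm Om 2 (chi - w) < e &
    dquot n t w @[n --> \oo] --> G t w]) ->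
  dquot n t chi @[n --> \oo] --> G t chi.
Proof.
move=> t0 [Glin _] Gle cPhi hchi happ.
apply/cvgrPdist_le => e e0.
pose C := `|m t| + m t ^+ 2 + 3.
have C0 : 0 < C by rewrite ltr_wpDl// addr_ge0// sqr_ge0.
have eC : 0 < e / 2 / C by rewrite !divr_gt0.
have [w [hw chiw cw]] := happ _ eC.
have e2 : 0 < e / 2 by rewrite divr_gt0.
have hd := sip_memB (hip_Hk0_semi_inner oOm bOm 2) hchi hw.
have Gd : G t chi = G t (chi - w) + G t w.
  have E : G t (1 *: (chi - w) + w) = 1 * G t (chi - w) + G t w by exact: Glin.
  by rewrite scale1r mul1r subrK in E.
near=> n.
have tn : 0 <= t - harmonic n by near: n; exact: near_backward_ge0.
have dn : dquot n t chi = dquot n t (chi - w) + dquot n t w.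
  have := dquot_lin 1 (ltW t0) tn (Hk2_Hk1 (Hk0_Hk hd)) (Hk2_Hk1 (Hk0_Hk hw)).
  by rewrite scale1r mul1r subrK.
have h1 : `|G t w - dquot n t w| <= e / 2 by near: n; move/cvgrPdist_le: cw; exact.
have h2 : `|m t ^+ 2 - (Phi t - Phi (t - harmonic n)) / harmonic n| <= 1.
  by near: n; move/cvgrPdist_le: cPhi => /(_ 1 ltr01).
rewrite Gd dn; exact: closed_bound (Hk_norm_ge0 _ _ _) (ltW chiw) (Gle _ hd) (dquot_le t0 tn hd) h1 h2 e0.
Unshelve. all: by end_near. Qed.

Hypothesis psi_H20 : {ae mu, forall t, 0 < t -> Hk0 Om 2 (psi t)}.
Hypothesis G_dual : {ae mu, forall t, 0 < t -> Hkdual Om 2 (G t)}.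

(* Countably many times that approximate, in H^1 and boundedly in H^2, every
   value of psi in H^2_0: a code (N, (p, r)) selects a time in ]p, r[ at which
   the H^2 norm is at most N, when there is one. *)
Definition code : Type := (nat * (rat * rat))%type.

Definition candidate (c : code) : set R := [set q | [/\ 0 < q, Hk0 Om 2 (psi q),
  Hk_norm Om 2 (psi q) <= c.1%:R & ratr c.2.1 < q < ratr c.2.2]].

(** When no time qualifies the value is 0, and psi(0) need not lie in H^2_0; this is why membership
    is tested again wherever a code is used. *)
Definition sel (c : code) : R := xget 0 (candidate c).

Lemma sel_seq t : 0 < t -> Hk0 Om 2 (psi t) ->
  exists (N : R) (c : nat -> code), forall k,
    [/\ 0 < sel (c k), Hk0 Om 2 (psi (sel (c k))), Hk_norm Om 2 (psi (sel (c k))) <= N &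
      `|t - sel (c k)| < harmonic k].
Proof.
move=> t0 ht.
pose N := Num.bound (Hk_norm Om 2 (psi t)).
have tN : Hk_norm Om 2 (psi t) <= N%:R by apply/ltW/archi_boundP/Hk_norm_ge0.
have /choice[c hc] : forall k, exists c : code, c.1 = N /\
    t - harmonic k / 2 < ratr c.2.1 < t /\ t < ratr c.2.2 < t + harmonic k / 2.
  move=> k; have h0 : 0 < harmonic k / 2 :> R by rewrite divr_gt0.
  have [|p] := @rat_in_itvoo R (t - harmonic k / 2) t; first by rewrite gtrBl.
  have [|r] := @rat_in_itvoo R t (t + harmonic k / 2); first by rewrite ltrDl.
  by rewrite !in_itv => /= hr hp; exists (N, (p, r)).
exists N%:R, c => k; have [cN [/andP[p1 p2] /andP[r1 r2]]] := hc k.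
have : candidate (c k) (sel (c k)).
  (* The time t itself is a candidate for each of these codes, so the selected times are genuine. *)
  by apply: (@xgetPex _ _ (candidate (c k))); exists t; split; rewrite ?cN ?p2 ?r1.
case=> q0 hq qN /andP[q1 q2]; rewrite cN in qN; split => //.
exact: bracket_dist (harmonic_gt0 k) p1 r2 q1 q2 p2 r1.
Qed.

Lemma ae_dquot_sel : {ae mu, forall t, 0 < t -> forall c, Hk0 Om 2 (psi (sel c)) ->
  dquot n t (psi (sel c)) @[n --> \oo] --> G t (psi (sel c))}.
Proof.
pose P (i : nat) t := 0 < t -> if @unpickle code i is Some c then
  Hk0 Om 2 (psi (sel c)) -> dquot n t (psi (sel c)) @[n --> \oo] --> G t (psi (sel c)) else True.
have /ae_foralln : forall i, {ae mu, forall t, P i t}.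
  move=> i; rewrite /P; case: unpickle => [c|]; last exact: aeW.
  have [hc|hc] := pselect (Hk0 Om 2 (psi (sel c))); last exact: aeW.
  by apply: ae_imply (ae_dquot hc) => t h t0 _; exact: h.
apply: ae_imply => t h t0 c hc.
by have := h (pickle c) t0; rewrite pickleK; apply.
Qed.

(** Convergence in H^1 together with an H^2 bound gives weak convergence in H^2_0: v is replaced by
    a test function phi, on which both Laplacians can be moved. *)
Lemma weak_cvg_form_a (q : nat -> R) (N t : R) : 0 <= t -> Hk0 Om 2 (psi t) ->
  (forall k, [/\ 0 < q k, Hk0 Om 2 (psi (q k)), Hk_norm Om 2 (psi (q k)) <= N &
    `|t - q k| < harmonic k]) ->
  forall v, Hk0 Om 2 v -> form_a Om (psi (q k)) v @[k --> \oo] --> form_a Om (psi t) v.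
Proof.
move=> t0 ht hq v hv.
have sa := form_a_semi_inner oOm bOm.
have [C C0 hC] := poincare oOm bOm.
have ht2 := Hk0_Hk ht; have hv2 := Hk0_Hk hv.
have hq2 k : Hk Om 2 (psi (q k)) by have [_ /Hk0_Hk] := hq k.
have qt : q @ \oo --> t.
  apply/cvgrPdist_lt => e e0; have /cvgrPdist_lt/(_ e e0) := @cvg_harmonic R.
  apply: filterS => k; rewrite sub0r normrN ger0_norm; last exact: ltW (harmonic_gt0 k).
  by apply: lt_trans; have [] := hq k.
have cgrad : grad_norm Om (psi (q k) - psi t) @[k --> \oo] --> (0 : R).
  have := cvg_comp _ _ qt (@grad_norm_continuous t).
  rewrite (max_l t0); apply: cvg_trans; apply: near_eq_cvg; near=> k.
  by rewrite /= max_l//; apply: ltW; have [] := hq k.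
apply/cvgrPdist_le => e e0.
pose D := Hk_norm Om 2 (psi t) + `|N| + 1.
have D0 : 0 < D by rewrite ltr_wpDl// addr_ge0// Hk_norm_ge0.
have d0 : 0 < e / 2 / (4 * D) by rewrite !divr_gt0// mulr_gt0.
have [phi tp hphi] := Hk0_approx hv d0.
have hp2 := test_Hk oOm bOm 2 tp.
pose L := L2norm Om (plap (plap phi)).
have L0 : 0 <= L by exact: L2norm_ge0.
have cl : 0 < e / 2 / (C * L + 1) by rewrite !divr_gt0// ltr_wpDl// mulr_ge0// ltW.
near=> k.
have hk : grad_norm Om (psi (q k) - psi t) <= e / 2 / (C * L + 1).
  near: k; move/cvgrPdist_le: cgrad => /(_ _ cl); apply: filterS => k.
  by rewrite sub0r normrN => /(le_trans (ler_norm _)).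
have [q0 hqV qN _] := hq k.
have hd := sip_memB (hip_Hk0_semi_inner oOm bOm 2) hqV ht.
have hd2 := Hk0_Hk hd; have hvp := sip_memB sa hp2 hv2.
have e1 : form_a Om (psi (q k) - psi t) phi = ip Om (psi (q k) - psi t) (plap (plap phi)).
  exact: form_a_test.
have b1 := sip_normr_le (ip_semi_inner (open_measurable_plane oOm)) (Hk_L2 hd2)
  (test_L2 oOm bOm (test_plap (test_plap tp))).
rewrite -e1 snorm_ip -/L in b1.
have b2 := sip_normr_le sa hd2 hvp; rewrite !snorm_form_a in b2.
have b3 := lap_norm_le oOm hd2; have b4 := lap_norm_le oOm hvp.
have b5 := hC _ (Hk02_Hk01 hd).
have b6 := snormB (hip_semi_inner oOm bOm 2) (hq2 k) ht2.
rewrite !snorm_hip// in b6.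
have E1 := sipBl sa (hq2 k) ht2 hv2.
have E2 := sipBr sa hp2 hv2 hd2.
exact: weak_bound C0 L0 (ltW e0) E1 E2 b1 b2 b3 b4 b5 b6 qN (ltW hphi) hk
  (Hk_norm_ge0 _ _ _) (Hk_norm_ge0 _ _ _) (Hk_norm_ge0 _ _ _) (L2norm_ge0 _ _).
Unshelve. all: by end_near. Qed.

(** Outside one null set, the admissible test functions at t form a subspace containing all the
    selected values that approach psi(t). Weak limits of bounded sequences are strong limits of
    combinations, and [dquot_closed] then admits psi(t). *)
Lemma ae_dquot_self : {ae mu, forall t, 0 < t ->
  dquot n t (psi t) @[n --> \oo] --> G t (psi t)}.
Proof.
have [C C0 hC] := elliptic oOm bOm.
have sa : semi_inner (Hk0 Om 2) (form_a Om).
  apply: semi_inner_sub (form_a_semi_inner oOm bOm).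
  - exact: Hk0_Hk.
  - exact: (sip_mem0 (hip_Hk0_semi_inner oOm bOm 2)).
  - exact: (sip_lin (hip_Hk0_semi_inner oOm bOm 2)).
apply: ae_imply2 (ae_and psi_H20 G_dual) (ae_and G_le (ae_and ae_Phi_dquot ae_dquot_sel)).
move=> t [hV hD] [hG [hPhi hsel]] t0.
have {}hV := hV t0; have {}hD := hD t0; have {}hG := hG t0; have {}hPhi := hPhi t0.
have {}hsel := hsel t0.
have [N [c hc]] := sel_seq t0 hV.
pose X := [set chi | Hk0 Om 2 chi /\ dquot n t chi @[n --> \oo] --> G t chi].
have XV : X `<=` Hk0 Om 2 by move=> chi [].
have Xlin (a : R) u v : X u -> X v -> X (a *: u + v).
  move=> [hu cu] [hv cv]; split; first exact: (sip_lin sa).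
  have -> : G t (a *: u + v) = a * G t u + G t v by case: hD => Glin _; exact: Glin.
  have cuv : a * dquot n t u + dquot n t v @[n --> \oo] --> a * G t u + G t v.
    by apply: cvgD cv; exact: cvgMr.
  apply: cvg_trans cuv; apply: near_eq_cvg; apply: filterS (near_backward_ge0 t0) => n tn.
  exact: esym (dquot_lin a (ltW t0) tn (Hk2_Hk1 (Hk0_Hk hu)) (Hk2_Hk1 (Hk0_Hk hv))).
have Xc k : X (psi (sel (c k))) by have [_ h _ _] := hc k; split => //; exact: hsel.
have X0 : X 0.
  by have := Xlin (-1) _ _ (Xc 0%N) (Xc 0%N); rewrite scaleN1r addNr.
have Xb k : snorm (form_a Om) (psi (sel (c k))) <= 2 * N.
  have [_ h hN _] := hc k; rewrite snorm_form_a.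
  by apply: le_trans (lap_norm_le oOm (Hk0_Hk h)) _; rewrite ler_pM2l.
have wcv := weak_cvg_form_a (ltW t0) hV hc.
apply: (dquot_closed t0 hD hG hPhi hV) => e e0.
(* The approximation is measured by the Laplacian; the constant of [elliptic] converts it into the
   H^2 norm. *)
have eC : 0 < e / C by rewrite divr_gt0.
have [w Xw hw] := weak_limit_approx sa XV X0 Xlin hV Xc Xb wcv eC.
exists w; split; [exact: XV| |by case: Xw].
rewrite snorm_form_a in hw.
have hd := hC _ (sip_memB sa hV (XV _ Xw)).
by apply: le_lt_trans hd _; rewrite mulrC -ltr_pdivlMr.
Qed.

Hypothesis int_k : forall T, 0 < T ->
  mu.-integrable `[0, T] (fun t => (Hk_norm Om 2 (psi t) ^+ 2)%:E).

(** The growth lemma is applied to Phi - E, with the squared H^2 norm of psi as the integrable lower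
    bound and m^2 - (K - lam E) as the lower limit of the quotients. *)
Lemma energy_balance (K lam a b : R) :
  {ae mu, forall t, 0 < t -> 2 * G t (psi t) <= K - lam * energy t} ->
  0 <= a -> a < b ->
  energy b - energy a <= (\int[mu]_(t in `[a, b]) (K - lam * energy t))%R.
Proof.
move=> hK a0 ab; have b0 := le_lt_trans a0 ab.
have mI : measurable (`[a, b]%classic : set (measurableTypeR R)) by exact: measurable_itv.
have sub : `[a, b] `<=` (`[0, b] : set R) by apply: subset_itvr; rewrite bnd_simp.
have im : mu.-integrable `[a, b] (EFin \o (fun t => m t ^+ 2)).
  by apply: integrableS (int_m b0).
have ik : mu.-integrable `[a, b] (EFin \o (fun t => Hk_norm Om 2 (psi t) ^+ 2)).
  by apply: integrableS (int_k b0).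
have cE : continuous (fun t => K - lam * energy t).
  by move=> t; apply: cvgB; [exact: cvg_cst|apply: cvgMr; exact: energy_continuous].
have iE := integrable_continuous a b cE.
pose g t := m t ^+ 2 - (K - lam * energy t).
have ig : mu.-integrable `[a, b] (EFin \o g) by have := integrableB mI im iE.
have cZ : continuous (fun t => Phi t - energy t).
  by move=> t; apply: cvgB; [exact: Phi_continuous|exact: energy_continuous].
have hlow : {ae mu, forall t, a < t -> forall h, 0 < h ->
    - (h * Hk_norm Om 2 (psi t) ^+ 2) <= (Phi t - energy t) - (Phi (t - h) - energy (t - h))}.
  apply: ae_imply psi_H20 => t hV ta h h0; have t0 := le_lt_trans a0 ta.
  exact: energy_backward_le t0 h0 (hV t0).
have hlim : {ae mu, forall t, a < t -> forall e, 0 < e -> \forall n \near \oo,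
    g t - e <= ((Phi t - energy t) - (Phi (t - harmonic n) - energy (t - harmonic n))) / harmonic n}.
  apply: ae_imply2 (ae_and hK psi_H20) (ae_and ae_Phi_dquot ae_dquot_self).
  move=> t [hKt hV] [cPhi cd] ta e e0; have t0 := le_lt_trans a0 ta.
  have {}hKt := hKt t0; have {}hV := hV t0.
  have e4 : 0 < e / 4 by rewrite divr_gt0.
  near=> n.
  have h1 : `|m t ^+ 2 - (Phi t - Phi (t - harmonic n)) / harmonic n| <= e / 4.
    by near: n; move/cvgrPdist_le: (cPhi t0); exact.
  have h2 : `|G t (psi t) - dquot n t (psi t)| <= e / 4.
    by near: n; move/cvgrPdist_le: (cd t0); exact.
  have tn : 0 <= t - harmonic n by near: n; exact: near_backward_ge0.
  have st : t - harmonic n <= t by rewrite gerBl ltW.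
  exact: liminf_bound (harmonic_gt0 n) h1 h2 (energy_le tn st) hKt.
have := fatou_growth ab cZ (fun t => sqr_ge0 (Hk_norm Om 2 (psi t))) ik ig hlow hlim.
(* The integral of m^2 is exactly the increment of Phi, so the auxiliary function disappears from
   the inequality. *)
have -> : (\int[mu]_(t in `[a, b]) g t)%R = (Phi b - Phi a) -
    (\int[mu]_(t in `[a, b]) (K - lam * energy t))%R.
  have -> := RintegralB mI im iE; congr (_ - _).
  by rewrite /Phi (primitiveB (int_m b0) a0 (ltW ab)).
move: (Phi b) (Phi a) (energy b) (energy a) (Rintegral _ _ _) => pb pa eb ea I; lra.
Unshelve. all: by end_near. Qed.

End EnergyBalance.

(** * Dissipation and the absorbing ball *)

Section DissipationArithmetic.
Variable R : rcfType.

(** With c = mu |CF| C, Young's inequality gives 2 c l <= nu l^2 + c^2 / nu. The other nu l^2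
    dominates (nu / C^2) E because E <= n^2 <= C^2 l^2. The bound CF may be negative, hence its
    absolute value; the added 1 keeps K positive when the forcing vanishes. *)
Lemma dissipation_bound (nu mu C CF F G a b b0 l n E : R) : 0 < nu -> 0 < mu -> 0 < C ->
  G + nu * a + b + mu * b0 = mu * F -> a = l ^+ 2 -> b = 0 -> b0 = 0 ->
  `|F| <= CF * n -> n <= C * l -> 0 <= n -> E <= n ^+ 2 ->
  2 * G <= ((mu * (`|CF| * C)) ^+ 2 / nu + 1) - nu / C ^+ 2 * E.
Proof.
move=> nu0 mu0 C0 hG aE bE b0E hF hn n0 hE; rewrite aE bE b0E in hG.
pose c := mu * (`|CF| * C).
have hF' : F <= `|CF| * (C * l).
  apply: le_trans (ler_norm _) (le_trans hF _); apply: le_trans (_ : `|CF| * n <= _).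
    by rewrite ler_wpM2r// ler_norm.
  by rewrite ler_wpM2l.
have h1 : mu * F <= c * l by rewrite /c -mulrA ler_pM2l// -mulrA.
have h2 : 2 * (c * l) <= nu * l ^+ 2 + c ^+ 2 / nu.
  have : 0 <= (nu * l - c) ^+ 2 / nu by rewrite divr_ge0 ?sqr_ge0 ?ltW.
  have -> : (nu * l - c) ^+ 2 / nu = nu * l ^+ 2 + c ^+ 2 / nu - 2 * (c * l).
    by field; rewrite gt_eqF.
  lra.
have h3 : nu / C ^+ 2 * E <= nu * l ^+ 2.
  have : E <= C ^+ 2 * l ^+ 2.
    by apply: le_trans hE _; rewrite -exprMn ler_sqr ?nnegrE// (le_trans n0).
  have nC : 0 <= nu / C ^+ 2 by rewrite divr_ge0 ?sqr_ge0 ?ltW.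
  move/(ler_wpM2l nC)/le_trans; apply.
  by rewrite le_eqVlt; apply/orP; left; apply/eqP; field; rewrite gt_eqF.
rewrite -/c; lra.
Qed.

End DissipationArithmetic.

Section Semigroup.
Variables (R : realType) (Om : set (R * R)).
Hypotheses (oOm : open Om) (bOm : bounded_set Om).
Implicit Types (u v : R * R -> R) (psi : R -> R * R -> R) (F : (R * R -> R) -> R).

Let sip : semi_inner (L2 Om) (ip Om).
Proof. exact: ip_semi_inner (open_measurable_plane oOm). Qed.

(** The two products of first derivatives cancel pointwise, leaving an inner product with the zero
    function. *)
Lemma form_b_self u : Hk Om 2 u -> form_b Om u u u = 0.
Proof.
move=> hu; rewrite /form_b [X in X - _]mulrC subrr.
rewrite (sip_sym sip (lap_L2 oOm hu) (sip_mem0 sip)).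
exact: (sip0l sip (lap_L2 oOm hu)).
Qed.

Lemma form_b0_self u : Hk Om 1 u -> form_b0 Om u u = 0.
Proof.
move=> hu; have E := sip_sym sip (@wpd_L2 _ _ 1 1 0 _ hu isT) (Hk_L2 hu).
by rewrite /form_b0 E subrr mulr0.
Qed.

(** K and lam are chosen before the solution: they depend on Om, nu, mu and F but not on the initial
    value, which makes the ball uniform. *)
Lemma weak_solution_dissipation (nu mu : R) F : 0 < nu -> 0 < mu -> Hkdual Om 2 F ->
  exists K lam : R, [/\ 0 < K, 0 < lam & forall psi (psi0 : R * R -> R),
    weak_solution Om nu mu F psi0 psi ->
    continuous (energy Om psi) /\
    forall a b, 0 <= a -> a < b ->
      energy Om psi b - energy Om psi a <=
      (\int[@lebesgue_measure R]_(t in `[a, b]) (K - lam * energy Om psi t))%R].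
Proof.
move=> nu0 mu0 [_ [CF hCF]]; have [C C0 hC] := elliptic oOm bOm.
exists ((mu * (`|CF| * C)) ^+ 2 / nu + 1), (nu / C ^+ 2); split.
- by rewrite ltr_wpDl// divr_ge0 ?sqr_ge0 ?ltW.
- by rewrite divr_gt0// exprn_gt0.
move=> psi psi0 [[psiH psic] [psiV _ psik] _ [G [[GV Gmeas [m [mi Gm]]] Gint] heq]].
split; first exact: (energy_continuous oOm bOm psiH psic).
move=> a b a0 ab.
apply: (energy_balance oOm bOm psiH psic Gmeas mi Gm Gint psiV GV psik) => //.
apply: ae_imply2 psiV heq => t hV ht t0; have {}hV := hV t0.
have hV2 := Hk0_Hk hV; have hV1 := Hk2_Hk1 hV2.
have hE : energy Om psi t <= Hk_norm Om 2 (psi t) ^+ 2.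
  rewrite /energy max_l; last exact: ltW.
  exact: sqr_le_sqr (sqrtr_ge0 _) (le_trans (grad_norm_le oOm hV1) (Hk_norm12 Om (psi t))).
exact: dissipation_bound nu0 mu0 C0 (ht t0 _ hV)
  (esym (L2norm_sqr oOm (lap_L2 oOm hV2))) (form_b_self hV2) (form_b0_self hV1)
  (hCF _ hV) (hC _ hV) (Hk_norm_ge0 _ _ _) hE.
Qed.

End Semigroup.

Theorem lemma2p12 (R : realType) (Om : set (R * R)) (nu mu : R)
    (F : (R * R -> R) -> R) (S : R -> (R * R -> R) -> R * R -> R)
    (hOm : bounded_domain Om) (nu_gt0 : 0 < nu) (mu_gt0 : 0 < mu)
    (hF : Hkdual Om 2 F) (hS : QG_semigroup Om nu mu F S) :
  exists2 rho0 : R, 0 < rho0 &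
    forall rho : R, 0 < rho ->
      exists2 tstar : R, 0 < tstar &
        forall t : R, tstar <= t ->
          S t @` ball_H Om rho `<=` ball_H Om rho0.
Proof.
case: hOm => oOm _ _ bOm.
have [K [lam [K0 lam0 hdiss]]] := weak_solution_dissipation oOm bOm nu_gt0 mu_gt0 hF.
pose M := 2 * K / lam.
(* The energy is only shown to be at most M, and the ball is open; the added 1 gives the strict
   inequality. *)
exists (Num.sqrt M + 1) => [|rho rho0]; first by rewrite ltr_wpDl// sqrtr_ge0.
have T0 : 0 < rho ^+ 2 / K + 1 by rewrite ltr_wpDl// divr_ge0 ?sqr_ge0 ?ltW.
(* The entry time of [absorbing_level] for initial energy at most rho^2. *)
exists (rho ^+ 2 / K + 1) => // t Tt _ [psi0 [hpsi0 psi0rho] <-].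
have t0 : 0 <= t by exact: le_trans (ltW T0) Tt.
have sol := hS _ hpsi0; have [cE hE] := hdiss _ _ sol.
have [[psiH _] _ psi00 _] := sol.
split; first exact: psiH.
have E0 : energy Om (fun t => S t psi0) 0 <= rho ^+ 2.
  have h0 := Hk_L2 (Hk0_Hk (psiH 0 (lexx 0))); have hp := Hk_L2 (Hk0_Hk hpsi0).
  rewrite /energy max_l// /grad_norm /ip_grad.
  (* The solution starts at psi0 only almost everywhere on Om, yet the chosen weak derivatives are
     the same functions. *)
  rewrite (wpd_ae_eq oOm bOm 1 0 h0 hp psi00) (wpd_ae_eq oOm bOm 0 1 h0 hp psi00).
  by apply: sqr_le_sqr (ltW psi0rho); exact: sqrtr_ge0.
have Epos s : 0 <= energy Om (fun t => S t psi0) s by exact: sqr_ge0.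
have := absorbing_level (M := M) K0 cE Epos E0 _ Tt.
move=> /(_ (fun a b a0 ab hM => decrease_above K0 lam0 ab cE (hE a b a0 ab) hM)).
rewrite /energy max_l// => hM.
apply: le_lt_trans (_ : Num.sqrt M < _); last by rewrite ltrDl.
by rewrite -[leLHS]ger0_norm ?sqrtr_ge0// -sqrtr_sqr; exact: ler_wsqrtr.
Qed.
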